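(* Let $Z$ be a 12-dimensional oriented smooth closed manifold and let $i,j\in\{1,2\}$. Then $$\Big\{e^{\frac{1}{720}(c_{2}(W_{i})+c_{2}(W_{j}))}\widehat{A}(TZ)\tfrac{1}{30}\big(c_{2}(W_{i})+c_{2}(W_{j})\big)\big(\mathrm{ch}(\triangle(Z))+128\big)\Big\}^{(12)}$$ $$=\Big\{e^{\frac{1}{720}(c_{2}(W_{i})+c_{2}(W_{j}))}\widehat{A}(TZ)\Big(\mathrm{ch}(\triangle(Z))\,\mathrm{ch}(8+2\widetilde{T_{\mathbf C}Z}+W_{i}+W_{j})+\mathrm{ch}\big(1024+128\widetilde{T_{\mathbf C}Z}+128W_{i}+128W_{j}+128\wedge^{2}(\widetilde{T_{\mathbf C}Z})\big)\Big)\Big\}^{(12)}.$$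
   Context: $Z$ carries a Riemannian metric; $\nabla^{TZ}$ is the Levi-Civita connection on $TZ$, $R^{TZ}$ its curvature, $T_{\mathbf C}Z=TZ\otimes\mathbf C$. All characteristic classes are represented by their Chern–Weil forms, and $\{\omega\}^{(12)}$ is the degree 12 component of a differential form $\omega$. $\widehat A(TZ)=\det^{1/2}\Big(\frac{\frac{\sqrt{-1}}{4\pi}R^{TZ}}{\sinh(\frac{\sqrt{-1}}{4\pi}R^{TZ})}\Big)$. $\triangle(Z)$ is the spinor bundle of $Z$ (rank $2^6$); only its Chern character form $\mathrm{ch}(\triangle(Z))=\det^{1/2}\big(2\cosh(\frac{\sqrt{-1}}{4\pi}R^{TZ})\big)$ is used, and this form is defined by $R^{TZ}$ alone. For a complex bundle $E$ with connection of curvature $R^E$, $\mathrm{ch}(E)=\mathrm{tr}\exp(\frac{\sqrt{-1}}{2\pi}R^{E})$, extended additively to virtual bundles; integers denote trivial (virtual) bundles. $\widetilde{E}=E-\dim E$. $\wedge_{q}(E)=\mathbf C+qE+q^{2}\wedge^{2}(E)+\cdots$ is extended to virtual bundles by $\wedge_q(E-F)=\wedge_q(E)/\wedge_q(F)$, and $\wedge^2(\widetilde E)$ is the coefficient of $q^2$ in $\wedge_q(\widetilde E)$. $P_1,P_2$ are principal $E_8$ bundles over $Z$ with connections; $W_i=P_i\times_{\rho_1}V_1$ is the complex vector bundle associated to the 248-dimensional adjoint representation $\rho_1$ of $E_8$, with induced connection; $c_2(W_i)$ is its second Chern form. *)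

(* Defs.v *)
From HB Require Import structures.
From mathcomp Require Import all_boot all_order all_algebra.
From mathcomp Require Import complex mxtens ring.
From mathcomp Require Import boolp.
Set Implicit Arguments. Unset Strict Implicit. Unset Printing Implicit Defensive.
Import Order.TTheory GRing.Theory Num.Theory.
Local Open Scope ring_scope.

Section Exterior.
Variables (K : comNzRingType) (n : nat).

(** [a S] is the coefficient of [dx_{s1} /\ ... /\ dx_{sk}], where
    [s1 < ... < sk] are the elements of [S]. *)
Definition ext := {ffun {set 'I_n} -> K}.
HB.instance Definition _ := GRing.Zmodule.on ext.
Implicit Types (A B C S : {set 'I_n}) (a b c : ext).

Definition inversions A B : nat := (\sum_(i in A) \sum_(j in B) (j < i))%N.

Definition wedge a b : ext :=
  [ffun S : {set 'I_n} => \sum_(A : {set 'I_n} | A \subset S)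
     (-1) ^+ inversions A (S :\: A) * a A * b (S :\: A)].

Definition ext1 : ext := [ffun S : {set 'I_n} => (S == set0)%:R].

Lemma inversions0l A : inversions set0 A = 0%N.
Proof. by rewrite /inversions big_set0. Qed.

Lemma inversions0r A : inversions A set0 = 0%N.
Proof. by rewrite /inversions big1 // => i _; rewrite big_set0. Qed.

Lemma inversionsUl A B C : [disjoint A & B] ->
  inversions (A :|: B) C = (inversions A C + inversions B C)%N.
Proof.
by move=> dAB; rewrite /inversions -bigU //=; apply: eq_bigl => i; rewrite !inE.
Qed.

Lemma inversionsUr A B C : [disjoint B & C] ->
  inversions A (B :|: C) = (inversions A B + inversions A C)%N.
Proof.
move=> dBC; rewrite /inversions -big_split; apply: eq_bigr => i _.
by rewrite -bigU //=; apply: eq_bigl => j; rewrite !inE.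
Qed.

Lemma inversionsC A B : [disjoint A & B] ->
  (inversions A B + inversions B A)%N = (#|A| * #|B|)%N.
Proof.
move=> dAB; rewrite /inversions [X in (_ + X)%N]exchange_big -big_split /=.
rewrite -sum_nat_const; apply: eq_bigr => i iA.
rewrite -big_split /= -sum1_card; apply: eq_bigr => j jB.
case: ltngtP => // /val_inj ij.
by move/pred0P: dAB => /(_ i) /=; rewrite iA -ij jB.
Qed.

Lemma wedgeA : associative wedge.
Proof.
move=> a b c; apply/ffunP => S; rewrite !ffunE.
under eq_bigr do rewrite ffunE mulr_sumr.
under [RHS]eq_bigr do rewrite ffunE mulr_sumr mulr_suml.
rewrite [RHS](exchange_big_dep (fun A => A \subset S)) /=; last first.
  by move=> A B AS BA; apply: subset_trans BA AS.
apply: eq_bigr => A AS.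
rewrite [RHS](reindex_onto (fun B => A :|: B) (fun B => B :\: A)) /=; last first.
  by move=> B /andP[_ AB]; apply/setP => x; rewrite !inE; case: (boolP (x \in A)) => //= /(subsetP AB).
apply: eq_big => [B|B].
  rewrite subsetUl subUset AS subsetD /= andbT; congr (_ && _).
  rewrite setDUl setDv set0U; by apply/idP/eqP => /setDidPl.
rewrite subsetD => /andP[BS dBA].
have dAB : [disjoint A & B] by rewrite disjoint_sym.
have -> : (A :|: B) :\: A = B by rewrite setDUl setDv set0U; apply/setDidPl.
have -> : S :\: (A :|: B) = (S :\: A) :\: B by rewrite setDDl.
set D := (S :\: A) :\: B.
have BSA : B \subset S :\: A by rewrite subsetD BS.
have dBD : [disjoint B & D] by rewrite /D -setI_eq0 setIDA setIC -setIDA setDv setI0.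
have -> : S :\: A = B :|: D by rewrite /D setUC [X in X :|: _]setDE setUIl [~: B :|: B]setUC setUCr setIT; apply/esym/setUidPl.
rewrite inversionsUr // inversionsUl // !exprD !mulrA.
ring.
Qed.


Lemma wedge1l : left_id ext1 wedge.
Proof.
move=> a; apply/ffunP => S; rewrite ffunE (bigD1 set0) ?sub0set //= big1.
  by rewrite setD0 inversions0l expr0 ffunE eqxx !mul1r addr0.
by move=> A /andP[_ /negPf A0]; rewrite ffunE A0 mulr0 mul0r.
Qed.

Lemma wedge1r : right_id ext1 wedge.
Proof.
move=> a; apply/ffunP => S; rewrite ffunE (bigD1 S) //= big1.
  by rewrite setDv inversions0r expr0 ffunE eqxx mulr1 mul1r addr0.
move=> A /andP[AS AnS]; rewrite [ext1 _]ffunE setD_eq0.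
by rewrite (_ : (S \subset A) = false) ?mulr0 //; apply: contraNF AnS => SA; rewrite eqEsubset AS.
Qed.

Lemma wedgeDl : left_distributive wedge +%R.
Proof.
move=> a b c; apply/ffunP => S; rewrite !ffunE -big_split /=.
by apply: eq_bigr => A _; rewrite ffunE mulrDr mulrDl.
Qed.

Lemma wedgeDr : right_distributive wedge +%R.
Proof.
move=> a b c; apply/ffunP => S; rewrite !ffunE -big_split /=.
by apply: eq_bigr => A _; rewrite ffunE mulrDr.
Qed.

Lemma ext1_neq0 : ext1 != 0.
Proof. by apply/eqP => /ffunP/(_ set0)/eqP; rewrite !ffunE eqxx oner_eq0. Qed.

HB.instance Definition _ := GRing.Zmodule_isNzRing.Build ext
  wedgeA wedge1l wedge1r wedgeDl wedgeDr ext1_neq0.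

(** The forms of even degree are the commutative ring over which Chern-Weil
    theory takes traces and determinants. *)
Definition even_supp : {pred ext} :=
  fun a => [forall S : {set 'I_n}, odd #|S| ==> (a S == 0)].

Lemma even_suppP a :
  reflect (forall S, odd #|S| -> a S = 0) (a \in even_supp).
Proof.
apply: (iffP forallP) => [h S oS|h S]; first by have := h S; rewrite oS => /eqP.
by apply/implyP => /h ->.
Qed.

Lemma even_supp_subring : subring_closed even_supp.
Proof.
split.
- apply/even_suppP => S oS; rewrite ffunE; case: eqP => // S0.
  by rewrite S0 cards0 in oS.
- move=> a b /even_suppP ha /even_suppP hb; apply/even_suppP => S oS.
  by rewrite !ffunE ha // hb // subrr.
- move=> a b /even_suppP ha /even_suppP hb; apply/even_suppP => S oS.
  rewrite ffunE big1 // => A AS.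
  case oA : (odd #|A|); first by rewrite ha // mulr0 mul0r.
  rewrite (hb (S :\: A)) ?mulr0 // cardsD (setIidPr AS) oddB ?subset_leq_card //.
  by rewrite oA oS.
Qed.

HB.instance Definition _ := GRing.isSubringClosed.Build ext even_supp
  even_supp_subring.

Record evenform := EvenForm {
  form_val :> ext;
  form_even : form_val \in even_supp }.

HB.instance Definition _ := [isSub for form_val].
HB.instance Definition _ := [Choice of evenform by <:].
HB.instance Definition _ := [SubChoice_isSubNzRing of evenform by <:].

Lemma evenform_mulC : commutative (@GRing.mul evenform).
Proof.
move=> a b; apply/val_inj; rewrite !rmorphM /=; apply/ffunP => S.
rewrite !ffunE (reindex_onto (fun A => S :\: A) (fun A => S :\: A)) /=; last first.
  by move=> A AS; rewrite setDDr setDv set0U; apply/setIidPr.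
apply: eq_big => [A|A /andP[_ /eqP hA]].
  rewrite subsetDl /= setDDr setDv set0U.
  by apply/eqP/idP => [/setIidPr|/setIidPr].
rewrite hA.
have AS : A \subset S by rewrite -hA subsetDl.
case oA : (odd #|A|).
  have bA : form_val b A = 0 := even_suppP _ (form_even b) A oA.
  by rewrite bA !(mulr0, mul0r).
have dA : [disjoint A & S :\: A] by rewrite disjoint_sym; apply/setDidPl; rewrite setDDl setUid.
suff -> : (-1) ^+ inversions (S :\: A) A = (-1) ^+ inversions A (S :\: A) :> K by ring.
rewrite -signr_odd -[RHS]signr_odd; congr (_ ^+ _).
have := congr1 odd (inversionsC dA); rewrite oddD oddM oA /=.
by do 2!case: (odd _).
Qed.

HB.instance Definition _ :=
  GRing.PzRing_hasCommutativeMul.Build evenform evenform_mulC.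

Implicit Types u v w : evenform.

Definition ef_unit : {pred evenform} := fun u => `[< exists v, v * u = 1 >].

Definition ef_inv u : evenform :=
  if pselect (exists v, v * u = 1) is left h then projT1 (cid h) else u.

Lemma ef_mulVx : {in ef_unit, left_inverse 1 ef_inv *%R}.
Proof.
move=> u /asboolP hu; rewrite /ef_inv; case: pselect => // h.
exact: (projT2 (cid h)).
Qed.

Lemma ef_unitPl u v : v * u = 1 -> ef_unit u.
Proof. by move=> h; apply/asboolP; exists v. Qed.

Lemma ef_inv_out : {in [predC ef_unit], ef_inv =1 id}.
Proof.
by move=> u /asboolP hu; rewrite /ef_inv; case: pselect.
Qed.

HB.instance Definition _ := GRing.ComNzRing_hasMulInverse.Build evenform
  ef_mulVx ef_unitPl ef_inv_out.

Lemma cst_form_even (c : K) :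
  [ffun S : {set 'I_n} => if S == set0 then c else 0] \in even_supp.
Proof.
apply/even_suppP => S oS; rewrite ffunE; case: eqP => // S0.
by rewrite S0 cards0 in oS.
Qed.

Definition cst_form (c : K) : evenform := EvenForm (cst_form_even c).

Lemma form2_even (w : 'I_n -> 'I_n -> K) :
  [ffun S : {set 'I_n} => \sum_(i < n) \sum_(j < n | (i < j)%N)
     (if S == [set i; j] then w i j else 0)] \in even_supp.
Proof.
apply/even_suppP => S oS; rewrite ffunE big1 // => i _; rewrite big1 // => j ij.
case: eqP => // Sij; move: oS; rewrite Sij cards2.
by rewrite (_ : i != j) //; apply: contraTneq ij => ->; rewrite ltnn.
Qed.

(** [\sum_(i < j) w i j dx_i /\ dx_j] *)
Definition form2 (w : 'I_n -> 'I_n -> K) : evenform := EvenForm (form2_even w).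

Lemma hcomp_even (d : nat) u :
  [ffun S : {set 'I_n} => if #|S| == d then form_val u S else 0] \in even_supp.
Proof.
apply/even_suppP => S oS; rewrite ffunE; case: eqP => // _.
exact: (even_suppP _ (form_even u)).
Qed.

(** The degree-[d] component. *)
Definition hcomp (d : nat) u : evenform := EvenForm (hcomp_even d u).

End Exterior.
Arguments cst_form {K} n c.
Arguments form2 {K n} w.

From mathcomp Require Import all_classical all_reals all_analysis.
Import numFieldNormedType.Exports.
Local Open Scope classical_set_scope.
Local Open Scope ring_scope.
Local Open Scope complex_scope.

Section ChernWeil.
Variables (R : realType) (n : nat).
Local Notation form := (evenform R[i] n).
Local Notation cst := (cst_form n).

(** Each series below is applied to arguments without a degree-0 part, whose
    powers of exponent greater than [n] vanish. *)
Definition form_exp (w : form) : form :=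
  \sum_(k < n.+1) cst (k`!)%:R^-1 * w ^+ k.

Definition mx_exp r (X : 'M[form]_r) : 'M[form]_r :=
  \sum_(k < n.+1) cst (k`!)%:R^-1 *: X ^+ k.

Definition mx_cosh r (X : 'M[form]_r) : 'M[form]_r :=
  \sum_(k < n.+1) cst ((2 * k)`!)%:R^-1 *: X ^+ (2 * k).

(** [sinh X / X] *)
Definition mx_sinhc r (X : 'M[form]_r) : 'M[form]_r :=
  \sum_(k < n.+1) cst ((2 * k).+1`!)%:R^-1 *: X ^+ (2 * k).

(** The square root with positive degree-0 part; it is unique when the
    degree-0 part of [w] is positive. *)
Definition form_sqrt (w : form) : form :=
  xget 0 [set v : form | v ^+ 2 = w /\ 0 < form_val v finset.set0].

(** A complex vector bundle with connection, at a point and in a local frame: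
    its rank and its curvature matrix. *)
Record lbundle := LBundle { rk : nat ; curv : 'M[form]_rk }.
Arguments LBundle {rk} curv.

Definition hat_A (E : lbundle) : form :=
  form_sqrt (\det (invmx (mx_sinhc (cst ('i / (4 * pi%:C)) *: curv E)))).

Definition ch_spinor (E : lbundle) : form :=
  form_sqrt (\det (2 *: mx_cosh (cst ('i / (4 * pi%:C)) *: curv E))).

Definition ch (E : lbundle) : form :=
  \tr (mx_exp (cst ('i / (2 * pi%:C)) *: curv E)).

Definition total_chern (E : lbundle) : form :=
  \det (1%:M + cst ('i / (2 * pi%:C)) *: curv E).

Definition chern2 (E : lbundle) : form := hcomp 4 (total_chern E).

Definition btriv (r : nat) : lbundle := LBundle (0 : 'M[form]_r).

Definition bsum (E F : lbundle) : lbundle :=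
  LBundle (block_mx (curv E) 0 0 (curv F)).

Definition btens (E F : lbundle) : lbundle :=
  LBundle (curv E *t 1%:M + 1%:M *t curv F).

Definition ksubsets (r k : nat) : {set {set 'I_r}} :=
  [set S : {set 'I_r} | #|S| == k]%SET.

(** The derivation of the exterior power [/\^k C^r] extending [X], in the basis
    [e_{s1} /\ ... /\ e_{sk}] for [s1 < ... < sk]. *)
Definition mx_wedge r (k : nat) (X : 'M[form]_r) : 'M[form]_#|ksubsets r k| :=
  \matrix_(p < #|ksubsets r k|, q < #|ksubsets r k|)
    let S : {set 'I_r} := enum_val p in let T : {set 'I_r} := enum_val q in
    \sum_(s in S) \sum_(t in T | (S :\ s == T :\ t)%SET)
      (-1) ^+ (\sum_(u in S) (u < s) + \sum_(u in T) (u < t))%N * X s t.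

Definition bwedge (k : nat) (E : lbundle) : lbundle :=
  LBundle (mx_wedge k (curv E)).

(** Formal differences [vpos - vneg]. *)
Record virt := Virt { vpos : lbundle ; vneg : lbundle }.

Definition virt_of (E : lbundle) : virt := Virt E (btriv 0).

Definition vch (E : virt) : form := ch (vpos E) - ch (vneg E).

Definition vtriv (m : nat) : virt := virt_of (btriv m).

Definition vadd (E F : virt) : virt :=
  Virt (bsum (vpos E) (vpos F)) (bsum (vneg E) (vneg F)).

Definition vopp (E : virt) : virt := Virt (vneg E) (vpos E).

Definition vmuln (m : nat) (E : virt) : virt := iter m (vadd E) (vtriv 0).

Definition vmul (E F : virt) : virt :=
  Virt (bsum (btens (vpos E) (vpos F)) (btens (vneg E) (vneg F)))
       (bsum (btens (vpos E) (vneg F)) (btens (vneg E) (vpos F))).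

(** [E - dim E], where [dim E] may be negative. *)
Definition vreduced (E : virt) : virt :=
  vadd E (Virt (btriv (rk (vneg E))) (btriv (rk (vpos E)))).

(** Power series in [q] whose coefficients are virtual bundles. *)
Definition vseries := nat -> virt.

Definition vs_one : vseries := fun k => if k is 0%N then vtriv 1 else vtriv 0.

Definition vs_sub (a b : vseries) : vseries := fun k => vadd (a k) (vopp (b k)).

Definition vs_mul (a b : vseries) : vseries :=
  fun k => \big[vadd/vtriv 0]_(l < k.+1) vmul (a l) (b (k - l)%N).

(** Geometric series: the inverse of [b] when [b 0] is the trivial line
    bundle, since then [(1 - b)^l] only contributes to the powers [q^k] with
    [l <= k]. *)
Definition vs_inv (b : vseries) : vseries :=
  fun k => \big[vadd/vtriv 0]_(l < k.+1)
    iter l (vs_mul (vs_sub vs_one b)) vs_one k.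

Definition wedge_q (E : lbundle) : vseries := fun k => virt_of (bwedge k E).

Definition vwedge_q (E : virt) : vseries :=
  vs_mul (wedge_q (vpos E)) (vs_inv (wedge_q (vneg E))).

Definition vwedge (k : nat) (E : virt) : virt := vwedge_q E k.

End ChernWeil.
Arguments LBundle {R n rk} curv.
Arguments vtriv {R n} m.
Coercion virt_of : lbundle >-> virt.

Declare Scope virt_scope.
Delimit Scope virt_scope with virt.
Bind Scope virt_scope with virt.
Notation "E + F" := (vadd E F) : virt_scope.
Notation "m * E" := (vmuln m E) : virt_scope.
Notation "m %:V" := (vtriv m) (at level 2, format "m %:V") : virt_scope.
Arguments vmuln {R n} m%_N E%_virt.
Arguments vtriv {R n} m%_N.

Section Smooth.
Variables (R : realType) (n : nat).
Implicit Types (f : 'rV[R]_n -> R) (U : set 'rV[R]_n).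

Definition pd (mu : 'I_n) f : 'rV[R]_n -> R := fun x => 'D_(delta_mx 0 mu) f x.

Definition pd_mx p q (mu : 'I_n) (F : 'rV[R]_n -> 'M[R]_(p, q)) (x : 'rV[R]_n) :
  'M[R]_(p, q) := \matrix_(i, j) pd mu (fun y => F y i j) x.

Fixpoint Ck_on (k : nat) U f : Prop :=
  (forall x, U x -> {for x, continuous f}) /\
  (if k is l.+1 then
     forall mu, (forall x, U x -> derivable f x (delta_mx 0 mu)) /\
                Ck_on l U (pd mu f)
   else True).

(** All iterated partial derivatives exist and are continuous; meant for open
    [U]. *)
Definition smooth_on U f : Prop := forall k, Ck_on k U f.

End Smooth.

Record oriented_atlas (R : realType) (n : nat) (Z : topologicalType) := {
  chart : Type ;
  cdom : chart -> set Z ;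
  cmap : chart -> Z -> 'rV[R]_n ;
  cinv : chart -> 'rV[R]_n -> Z ;
  jac (a b : chart) (x : 'rV[R]_n) : 'M[R]_n :=
    \matrix_(i, j) pd j (fun y => cmap b (cinv a y) 0 i) x ;
  cdom_open : forall a, open (cdom a) ;
  cdom_cover : forall z, exists a, cdom a z ;
  cimg_open : forall a, open (cmap a @` cdom a) ;
  cmapK : forall a z, cdom a z -> cinv a (cmap a z) = z ;
  cmap_continuous : forall a z, cdom a z -> {for z, continuous (cmap a)} ;
  cinv_continuous : forall a x, (cmap a @` cdom a) x ->
    {for x, continuous (cinv a)} ;
  ctrans_smooth : forall a b i,
    smooth_on (cmap a @` (cdom a `&` cdom b))
      (fun x => cmap b (cinv a x) 0 i) ;
  ctrans_oriented : forall a b z, cdom a z -> cdom b z ->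
    0 < \det (jac a b (cmap a z)) }.

Section Geometry.
Variables (R : realType) (n : nat) (Z : topologicalType).
Variable M : oriented_atlas R n Z.

Definition smooth_on_mfd (U : set Z) (f : Z -> R) : Prop :=
  forall a : chart M,
    smooth_on (cmap a @` (cdom a `&` U)) (fun x => f (cinv a x)).

Record riemannian_metric := {
  gmx : chart M -> 'rV[R]_n -> 'M[R]_n ;
  gmx_smooth : forall a i j,
    smooth_on (cmap a @` cdom a) (fun x => gmx a x i j) ;
  gmx_sym : forall a z, cdom a z -> (gmx a (cmap a z))^T = gmx a (cmap a z) ;
  gmx_pos : forall a z (v : 'cV[R]_n), cdom a z -> v != 0 ->
    0 < (v^T *m gmx a (cmap a z) *m v) 0 0 ;
  gmx_trans : forall a b z, cdom a z -> cdom b z ->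
    gmx a (cmap a z) = (jac a b (cmap a z))^T *m gmx b (cmap b z)
                         *m jac a b (cmap a z) }.

(** [om k a mu] is the [dx_mu]-component, in the chart [a], of the connection
    matrix in the frame over [dom k]; frames are related by [s_k = h k l s_l]
    on components, so that [h om_l = om_k h + dh]. *)
Definition is_connection (r : nat) (I : Type) (dom : I -> set Z)
    (h : I -> I -> Z -> 'M[R]_r)
    (om : I -> chart M -> 'I_n -> 'rV[R]_n -> 'M[R]_r) : Prop :=
  [/\ forall k a mu i j,
        smooth_on (cmap a @` (cdom a `&` dom k)) (fun x => om k a mu x i j),
      forall k a b mu z, cdom a z -> cdom b z -> dom k z ->
        om k a mu (cmap a z) =
          \sum_nu jac a b (cmap a z) nu mu *: om k b nu (cmap b z)
    & forall k l a mu z, cdom a z -> dom k z -> dom l z ->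
        h k l z *m om l a mu (cmap a z) =
          om k a mu (cmap a z) *m h k l z
          + pd_mx mu (fun x => h k l (cinv a x)) (cmap a z)].

(** [d om + om /\ om] *)
Definition curvature (r : nat) (om : 'I_n -> 'rV[R]_n -> 'M[R]_r)
    (x : 'rV[R]_n) (mu nu : 'I_n) : 'M[R]_r :=
  pd_mx mu (om nu) x - pd_mx nu (om mu) x
  + om mu x *m om nu x - om nu x *m om mu x.

(** The complexification, at [x], of a real bundle with connection matrix [om]. *)
Definition complexified (r : nat) (om : 'I_n -> 'rV[R]_n -> 'M[R]_r)
    (x : 'rV[R]_n) : lbundle R n :=
  LBundle (\matrix_(i < r, j < r)
             form2 (fun mu nu => (curvature om x mu nu i j)%:C)).

(** The coordinate frame of [TZ] over each chart. *)
Record tangent_connection := {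
  christoffel : chart M -> chart M -> 'I_n -> 'rV[R]_n -> 'M[R]_n ;
  christoffelP : is_connection (@cdom _ _ _ M)
    (fun a b z => jac b a (cmap b z)) christoffel }.

Definition levi_civita (g : riemannian_metric) (D : tangent_connection) :=
  forall a z mu nu, cdom a z ->
    let x := cmap a z in
    let om := christoffel D a a in
    (forall i, om mu x i nu = om nu x i mu) /\
    pd_mx mu (gmx g a) x = (om mu x)^T *m gmx g a x + gmx g a x *m om mu x.

Definition TCZ (D : tangent_connection) (a : chart M) (x : 'rV[R]_n) :=
  complexified (christoffel D a a) x.

End Geometry.

Section LieAlgebra.
Variables (R : realType) (N : nat) (br : 'cV[R]_N -> 'cV[R]_N -> 'cV[R]_N).

Definition lie_bracket : Prop :=
  [/\ forall c X Y V, br (c *: X + Y) V = c *: br X V + br Y V,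
      forall c X Y V, br V (c *: X + Y) = c *: br V X + br V Y,
      forall X, br X X = 0
    & forall X Y V, br X (br Y V) + br Y (br V X) + br V (br X Y) = 0].

Definition ad (X : 'cV[R]_N) : 'M[R]_N :=
  \matrix_(i, j) br X (delta_mx j 0) i 0.

Definition killing (X Y : 'cV[R]_N) : R := \tr (ad X *m ad Y).

Definition lie_aut (h : 'M[R]_N) : Prop :=
  h \in unitmx /\ forall X Y, h *m br X Y = br (h *m X) (h *m Y).

End LieAlgebra.

Definition e8_root (R : realType) (alpha : 'I_8 -> R) : Prop :=
  [/\ (forall i, alpha i \is a Num.int) \/
      (forall i, alpha i - 2^-1 \is a Num.int),
      (\sum_i alpha i) / 2 \is a Num.int
    & \sum_i alpha i ^+ 2 = 2].

(** The Lie algebra of the compact group E8. As [8 + 240 = 248], the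
    complexification of the span of the [e8_cartan i] and the [e8_root] spaces
    exhaust the complexified algebra. *)
Record compact_e8 (R : realType) := {
  e8_br : 'cV[R]_248 -> 'cV[R]_248 -> 'cV[R]_248 ;
  e8_lie : lie_bracket e8_br ;
  e8_compact : forall X, X != 0 -> killing e8_br X X < 0 ;
  e8_cartan : 'I_8 -> 'cV[R]_248 ;
  e8_cartan_comm : forall i j, e8_br (e8_cartan i) (e8_cartan j) = 0 ;
  e8_roots : forall alpha, e8_root alpha ->
    exists2 v : 'cV[R[i]]_248, v != 0 &
      forall i, map_mx (real_complex R) (ad e8_br (e8_cartan i)) *m v
                = ('i * (alpha i)%:C) *: v }.

Section E8Bundles.
Variables (R : realType) (n : nat) (Z : topologicalType).
Variables (M : oriented_atlas R n Z) (g : compact_e8 R).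

(** E8 is the automorphism group of its Lie algebra, and this inclusion into
    the linear group is the adjoint representation. *)
Definition E8 (h : 'M[R]_248) : Prop := lie_aut (e8_br g) h.

Record principal_e8_bundle := {
  triv : Type ;
  tdom : triv -> set Z ;
  ttrans : triv -> triv -> Z -> 'M[R]_248 ;
  tdom_open : forall k, open (tdom k) ;
  tdom_cover : forall z, exists k, tdom k z ;
  ttrans_E8 : forall k l z, tdom k z -> tdom l z -> E8 (ttrans k l z) ;
  ttrans_smooth : forall k l i j,
    smooth_on_mfd M (tdom k `&` tdom l) (fun z => ttrans k l z i j) ;
  ttrans_id : forall k z, tdom k z -> ttrans k k z = 1%:M ;
  ttrans_cocycle : forall k l m z, tdom k z -> tdom l z -> tdom m z ->
    ttrans k l z *m ttrans l m z = ttrans k m z }.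

(** The local connection forms take values in the Lie algebra of E8. Their
    transformation law is stated in the adjoint representation, which is
    faithful. *)
Record e8_connection (P : principal_e8_bundle) := {
  gauge : triv P -> chart M -> 'I_n -> 'rV[R]_n -> 'cV[R]_248 ;
  gaugeP : is_connection (@tdom P) (@ttrans P)
    (fun k a mu x => ad (e8_br g) (gauge k a mu x)) }.

(** The complex vector bundle associated to the adjoint representation, with
    the induced connection, in the trivialization [k]. *)
Definition adjoint_bundle (P : principal_e8_bundle) (A : e8_connection P)
    (k : triv P) (a : chart M) (x : 'rV[R]_n) : lbundle R n :=
  complexified (fun mu y => ad (e8_br g) (gauge A k a mu y)) x.

End E8Bundles.

(* Main.v *)
From HB Require Import structures.
Require Import Defs.
From mathcomp Require Import all_boot all_order all_algebra.
From mathcomp Require Import perm complex mxtens ring lra.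
From mathcomp Require Import boolp reals trigo.
Set Implicit Arguments. Unset Strict Implicit. Unset Printing Implicit Defensive.
Import Order.TTheory GRing.Theory Num.Theory.
Local Open Scope ring_scope.

(** The identity holds point by point on [Z], as an identity between
    polynomials in a few differential forms; no integration takes place.

    Every form in the statement is a polynomial in five forms. On the tangent
    side, the curvature of the Levi-Civita connection is antisymmetric for the
    metric ([metric_curvature], from the symmetry of second derivatives), so the
    traces of its odd powers vanish ([skew_trace]) and everything is expressed by
    the traces of its second, fourth and sixth powers: Newton's identities give
    the determinants that define the A-hat form and the Chern character of the
    spinor bundle ([hat_A_graded], [ch_spinor_graded]), and the trace formula
    [trace_wedge2] gives the Chern character of the exterior square
    ([ch_wedge_graded]). On the gauge side, E8 has no independent invariants of
    degree 4 and 6: for an E8-valued two-form [F],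
    [100 tr (ad F)^4 = (tr (ad F)^2)^2] and
    [7200 tr (ad F)^6 = (tr (ad F)^2)^3] ([e8_traces]). Hence the Chern character
    of an adjoint bundle is a polynomial in its second Chern form
    ([ch_adjoint_graded]).

    The E8 relations are invariant under inner automorphisms, hence need only be
    checked on a Cartan subalgebra, where they are relations between power sums
    of the 240 roots. A two-form is nilpotent and thus has no useful conjugate in
    the Cartan subalgebra, but its sum with a constant regular element has one,
    found by Newton's method with the nilpotency of forms of positive degree as
    convergence ([cartan_spectrum]). The component of highest degree of the
    relations for the sum is the relation for the two-form.

    What remains is an identity between polynomials truncated in degree 12
    ([weight14_identity]), with the following explanation. With [c] the sum of
    the two second Chern forms, the degree 12 component of [exp (E_2 c / 720)]
    times the A-hat form times suitable series of Chern characters, with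
    constant term [ch (spinor bundle) + 128], is a modular form of weight 14.
    Such forms are multiples of [E_4^2 E_6 = 1 - 24 q + ...], so the coefficient
    of [q] plus 24 times the constant term vanishes. As [E_2 = 1 - 24 q - ...],
    the exponential contributes the factor [- c / 30] to the coefficient of [q],
    which is the left side of the theorem with the opposite sign; the right side
    collects the contribution of the other factors and 24 times the constant
    term. *)

(** * The ring of forms of even degree *)

Section Forms.
Variables (K : comNzRingType) (n : nat).
Local Notation form := (evenform K n).
Implicit Types (u v w : form) (S : {set 'I_n}) (c : K).

Lemma form_valM u v S :
  form_val (u * v) S = \sum_(B : {set 'I_n} | B \subset S)
    (-1) ^+ inversions B (S :\: B) * form_val u B * form_val v (S :\: B).
Proof. by rewrite [form_val (u * v)]/= ffunE. Qed.

Lemma form_valD u v S : form_val (u + v) S = form_val u S + form_val v S.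
Proof. by rewrite [form_val (u + v)]/= ffunE. Qed.

Lemma form_valN u S : form_val (- u) S = - form_val u S.
Proof. by rewrite [form_val (- u)]/= ffunE. Qed.

Lemma form_val0 S : form_val (0 : form) S = 0.
Proof. by rewrite /= ffunE. Qed.

Lemma form_val1 S : form_val (1 : form) S = (S == set0)%:R.
Proof. by rewrite /= ffunE. Qed.

Lemma formP u v : (forall S, form_val u S = form_val v S) -> u = v.
Proof. by move=> uv; apply/val_inj/ffunP => S; apply: uv. Qed.

Lemma form_val_cst c S : form_val (cst_form n c) S = if S == set0 then c else 0.
Proof. by rewrite /= ffunE. Qed.

Lemma form_val_cstM c u S : form_val (cst_form n c * u) S = c * form_val u S.
Proof.
rewrite form_valM (bigD1 set0) ?sub0set //= big1 => [|B /andP[_ /negPf B0]].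
  by rewrite setD0 inversions0l expr0 mul1r addr0 ffunE eqxx.
by rewrite ffunE B0 mulr0 mul0r.
Qed.

Lemma cst_form_is_zmod_morphism : zmod_morphism (@cst_form K n).
Proof.
by move=> c d; apply: formP => S; rewrite form_valD form_valN !form_val_cst;
  case: ifP; rewrite ?subr0.
Qed.

Lemma cst_form_is_monoid_morphism : monoid_morphism (@cst_form K n).
Proof.
split=> [|c d]; apply: formP => S; last first.
  by rewrite form_val_cstM !form_val_cst; case: ifP; rewrite ?mulr0.
by rewrite form_val1 form_val_cst; case: ifP.
Qed.

HB.instance Definition _ := GRing.isZmodMorphism.Build K form (@cst_form K n)
  cst_form_is_zmod_morphism.
HB.instance Definition _ := GRing.isMonoidMorphism.Build K form (@cst_form K n)
  cst_form_is_monoid_morphism.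

Definition const_part u : K := form_val u set0.

Lemma const_part_is_zmod_morphism : zmod_morphism const_part.
Proof. by move=> u v; rewrite /const_part form_valD form_valN. Qed.

Lemma const_part_is_monoid_morphism : monoid_morphism const_part.
Proof.
split=> [|u v]; first by rewrite /const_part form_val1 eqxx.
rewrite /const_part form_valM (bigD1 set0) ?sub0set //= big1 => [|B].
  by rewrite setD0 inversions0l expr0 mul1r addr0.
by rewrite subset0 => /andP[->].
Qed.

HB.instance Definition _ := GRing.isZmodMorphism.Build form K const_part
  const_part_is_zmod_morphism.
HB.instance Definition _ := GRing.isMonoidMorphism.Build form K const_part
  const_part_is_monoid_morphism.

Lemma const_part_cst c : const_part (cst_form n c) = c.
Proof. by rewrite /const_part form_val_cst eqxx. Qed.

(** [ord_ge m] is the [m]-th step of the filtration by degree; as forms of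
    degree above [n] vanish, it makes every form without constant part
    nilpotent. *)
Definition ord_ge (m : nat) u := forall S, (#|S| < m)%N -> form_val u S = 0.
Definition deg_le (m : nat) u := forall S, (m < #|S|)%N -> form_val u S = 0.
Definition homog (m : nat) u := forall S, #|S| != m -> form_val u S = 0.

Lemma ord_ge_zero m : ord_ge m 0. Proof. by move=> S _; rewrite form_val0. Qed.

Lemma ord_geD m u v : ord_ge m u -> ord_ge m v -> ord_ge m (u + v).
Proof. by move=> hu hv S Sm; rewrite form_valD hu ?hv ?addr0. Qed.

Lemma ord_ge_sum m (I : Type) (r : seq I) (P : pred I) (F : I -> form) :
  (forall i, P i -> ord_ge m (F i)) -> ord_ge m (\sum_(i <- r | P i) F i).
Proof.
by move=> hF; apply: big_ind => //; [exact: ord_ge_zero | exact: ord_geD].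
Qed.

Lemma ord_geW m p u : (p <= m)%N -> ord_ge m u -> ord_ge p u.
Proof. by move=> pm hu S Sp; apply: hu; apply: leq_trans pm. Qed.

Lemma ord_geM m p u v : ord_ge m u -> ord_ge p v -> ord_ge (m + p) (u * v).
Proof.
move=> hu hv S Smp; rewrite form_valM big1 // => B BS.
have [Bm|mB] := ltnP #|B| m; first by rewrite hu // mulr0 mul0r.
rewrite (hv (S :\: B)) ?mulr0 // cardsD (setIidPr BS).
by rewrite ltn_subLR ?subset_leq_card //; apply: leq_trans Smp _; rewrite leq_add2r.
Qed.

Lemma ord_geMl m u v : ord_ge m v -> ord_ge m (u * v).
Proof. by move=> hv; rewrite -[m]add0n; apply: ord_geM. Qed.

Lemma ord_geMr m u v : ord_ge m u -> ord_ge m (u * v).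
Proof. by rewrite mulrC; apply: ord_geMl. Qed.

Lemma ord_geX m k u : ord_ge m u -> ord_ge (k * m) (u ^+ k).
Proof.
by move=> hu; elim: k => [|k ihk] //; rewrite mulSn exprS; apply: ord_geM.
Qed.

Lemma ord_ge_eq0 m u : (n < m)%N -> ord_ge m u -> u = 0.
Proof.
move=> nm hu; apply: formP => S; rewrite form_val0 hu //.
by apply: leq_ltn_trans nm; rewrite -[n in (_ <= n)%N]card_ord max_card.
Qed.

Lemma ord_ge1P u : const_part u = 0 -> ord_ge 1 u.
Proof. by move=> u0 S; rewrite ltnS leqn0 cards_eq0 => /eqP ->. Qed.

Lemma const_part_ord m u : (0 < m)%N -> ord_ge m u -> const_part u = 0.
Proof. by move=> m0 hu; apply: hu; rewrite cards0. Qed.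

Lemma homog_ord m u : homog m u -> ord_ge m u.
Proof. by move=> hu S Sm; apply: hu; rewrite neq_ltn Sm. Qed.

Lemma homog_deg m u : homog m u -> deg_le m u.
Proof. by move=> hu S Sm; apply: hu; rewrite neq_ltn Sm orbT. Qed.

Lemma homog_zero m : homog m 0. Proof. by move=> S _; rewrite form_val0. Qed.

Lemma homogD m u v : homog m u -> homog m v -> homog m (u + v).
Proof. by move=> hu hv S Sm; rewrite form_valD hu ?hv ?addr0. Qed.

Lemma homogN m u : homog m u -> homog m (- u).
Proof. by move=> hu S Sm; rewrite form_valN hu ?oppr0. Qed.

Lemma homog_sum m (I : Type) (r : seq I) (P : pred I) (F : I -> form) :
  (forall i, P i -> homog m (F i)) -> homog m (\sum_(i <- r | P i) F i).
Proof.
by move=> hF; apply: big_ind => //; [exact: homog_zero | exact: homogD].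
Qed.

Lemma homogM m p u v : homog m u -> homog p v -> homog (m + p) (u * v).
Proof.
move=> hu hv S Smp; rewrite form_valM big1 // => B BS.
have [Bm|mB] := eqVneq #|B| m; last by rewrite hu // mulr0 mul0r.
rewrite (hv (S :\: B)) ?mulr0 // cardsD (setIidPr BS) Bm.
by apply: contra Smp => /eqP <-; rewrite subnKC // -Bm subset_leq_card.
Qed.

Lemma homog_cst c : homog 0 (cst_form n c).
Proof. by move=> S; rewrite cards_eq0 form_val_cst => /negPf ->. Qed.

Lemma homog_nat k : homog 0 (k%:R).
Proof. by rewrite -(rmorph_nat (@cst_form K n)); apply: homog_cst. Qed.

Lemma homog_cstM m c u : homog m u -> homog m (cst_form n c * u).
Proof. by move=> hu; apply: (homogM (m := 0)) => //; apply: homog_cst. Qed.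

Lemma homogX m k u : homog m u -> homog (k * m) (u ^+ k).
Proof.
move=> hu; elim: k => [|k ihk]; first by rewrite expr0; apply: (homog_nat 1).
by rewrite mulSn exprS; apply: homogM.
Qed.

Lemma hcompE m u S : form_val (hcomp m u) S = if #|S| == m then form_val u S else 0.
Proof. by rewrite /= ffunE. Qed.

Lemma hcomp_homog m u : homog m (hcomp m u).
Proof. by move=> S /negPf Sm; rewrite hcompE Sm. Qed.

Lemma hcomp_is_zmod_morphism m : zmod_morphism (@hcomp K n m).
Proof.
move=> u v; apply: formP => S; rewrite form_valD form_valN !hcompE.
by case: ifP; rewrite ?subr0 // form_valD form_valN.
Qed.

HB.instance Definition _ m := GRing.isZmodMorphism.Build form form (@hcomp K n m)
  (@hcomp_is_zmod_morphism m).

Lemma hcomp_id m u : homog m u -> hcomp m u = u.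
Proof. by move=> hu; apply: formP => S; rewrite hcompE; case: ifPn => // /hu. Qed.

Lemma hcomp_off m p u : homog p u -> p != m -> hcomp m u = 0.
Proof.
move=> hu pm; apply: formP => S; rewrite hcompE form_val0; case: eqP => // Sm.
by apply: hu; rewrite Sm eq_sym.
Qed.

Lemma deg_le_zero m : deg_le m 0. Proof. by move=> S _; rewrite form_val0. Qed.

Lemma deg_leD m u v : deg_le m u -> deg_le m v -> deg_le m (u + v).
Proof. by move=> hu hv S Sm; rewrite form_valD hu ?hv ?addr0. Qed.

Lemma deg_le_sum m (I : Type) (r : seq I) (P : pred I) (F : I -> form) :
  (forall i, P i -> deg_le m (F i)) -> deg_le m (\sum_(i <- r | P i) F i).
Proof.
by move=> hF; apply: big_ind => //; [exact: deg_le_zero | exact: deg_leD].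
Qed.

Lemma deg_leW m p u : (m <= p)%N -> deg_le m u -> deg_le p u.
Proof. by move=> mp hu S pS; apply: hu; apply: leq_ltn_trans pS. Qed.

Lemma deg_leM m p u v : deg_le m u -> deg_le p v -> deg_le (m + p) (u * v).
Proof.
move=> hu hv S Smp; rewrite form_valM big1 // => B BS.
have [Bm|mB] := ltnP m #|B|; first by rewrite hu // mulr0 mul0r.
rewrite (hv (S :\: B)) ?mulr0 // cardsD (setIidPr BS) ltn_subRL.
by apply: leq_ltn_trans Smp; rewrite leq_add2r.
Qed.

(** The top component is multiplicative. This isolates the part of highest
    degree of a polynomial in [h0 + F], for a constant [h0] and a two-form
    [F], as the same polynomial in [F]. *)
Lemma hcompM_top m p u v : deg_le m u -> deg_le p v ->
  hcomp (m + p) (u * v) = hcomp m u * hcomp p v.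
Proof.
move=> hu hv; apply: formP => S; rewrite hcompE !form_valM.
case: eqP => [Smp|/eqP Smp]; last first.
  rewrite big1 // => B BS; rewrite !hcompE.
  case: eqP => [Bm|]; last by rewrite mulr0 mul0r.
  rewrite cardsD (setIidPr BS) Bm; case: eqP => [SB|]; last by rewrite mulr0.
  by move: Smp; rewrite -SB subnKC ?eqxx // -Bm subset_leq_card.
apply: eq_bigr => B BS; rewrite !hcompE cardsD (setIidPr BS) Smp.
have [Bm|Bm|Bm] := ltngtP #|B| m.
- rewrite (hv (S :\: B)) ?mulr0 ?mul0r // cardsD (setIidPr BS) Smp.
  by rewrite ltn_subRL ltn_add2r.
- by rewrite hu // mulr0 !mul0r.
- by rewrite Bm addnC addnK eqxx.
Qed.

Lemma homog_hcompM m p u v : homog m u ->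
  hcomp (m + p) (u * v) = u * hcomp p v.
Proof.
move=> hu; apply: formP => S; rewrite hcompE !form_valM.
case: eqP => [Smp|/eqP Smp].
  apply: eq_bigr => B BS; rewrite hcompE cardsD (setIidPr BS) Smp.
  have [->|/hu ->] := eqVneq #|B| m; last by rewrite !mulr0 !mul0r.
  by rewrite addKn eqxx.
rewrite big1 // => B BS; rewrite hcompE cardsD (setIidPr BS).
have [Bm|/hu ->] := eqVneq #|B| m; last by rewrite !mulr0 !mul0r.
case: eqP => [SB|]; last by rewrite mulr0.
by move: Smp; rewrite -SB -Bm subnKC ?eqxx // subset_leq_card.
Qed.

End Forms.

Section FormUnits.
Variables (K : fieldType) (n : nat).
Local Notation form := (evenform K n).

(** The part of positive degree is nilpotent, so the geometric series inverts
    any form with invertible constant part. *)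
Lemma form_unitP (u : form) : const_part u != 0 -> u \is a GRing.unit.
Proof.
move=> u0; pose c := const_part u; pose w := 1 - cst_form n c^-1 * u.
have wn : w ^+ n.+1 = 0.
  apply: (@ord_ge_eq0 _ _ n.+1) => //; rewrite -[X in ord_ge X _]muln1.
  apply: ord_geX; apply: ord_ge1P.
  by rewrite rmorphB rmorphM rmorph1 /= const_part_cst mulVf ?subrr.
suff : cst_form n c^-1 * u \is a GRing.unit.
  by rewrite unitrM => /andP[].
have -> : cst_form n c^-1 * u = 1 - w by rewrite /w subKr.
apply/unitrP; exists (\sum_(i < n.+1) w ^+ i).
have h : (1 - w) * (\sum_(i < n.+1) w ^+ i) = 1.
  by rewrite -[X in X * _]opprB mulNr -subrX1 wn sub0r opprK.
by rewrite h [X in X = _]mulrC h.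
Qed.

End FormUnits.

Section Form2.
Variables (K : comNzRingType) (n : nat).
Local Notation form := (evenform K n).
Implicit Types (w : 'I_n -> 'I_n -> K).

Lemma form2E w S : form_val (form2 w : form) S = \sum_(i < n) \sum_(j < n | (i < j)%N)
     (if S == [set i; j]%SET then w i j else 0).
Proof. by rewrite /= ffunE. Qed.

Lemma form2_homog w : homog 2 (form2 w : form).
Proof.
move=> S S2; rewrite form2E big1 // => i _; rewrite big1 // => j ij.
case: eqP => // Sij; move: S2; rewrite Sij cards2.
by rewrite (_ : i != j) //; apply: contraTneq ij => ->; rewrite ltnn.
Qed.

Lemma eq_form2 w w' : (forall i j, w i j = w' i j) -> form2 w = form2 w' :> form.
Proof.
move=> ww; apply: formP => S; rewrite !form2E; apply: eq_bigr => i _.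
by apply: eq_bigr => j _; rewrite ww.
Qed.

(** The coefficient functions of two-forms carry all linear relations between
    curvature components over to relations between two-forms. *)
Lemma form2_sum (I : Type) (r : seq I) (c : I -> K) (w : I -> 'I_n -> 'I_n -> K) :
  form2 (fun i j => \sum_(k <- r) c k * w k i j)
  = \sum_(k <- r) cst_form n (c k) * form2 (w k) :> form.
Proof.
elim: r => [|k r ih].
  rewrite big_nil; apply: formP => S; rewrite form2E form_val0.
  by rewrite big1 // => i _; rewrite big1 // => j _; rewrite big_nil if_same.
rewrite big_cons -ih; apply: formP => S.
rewrite form_valD form_val_cstM !form2E mulr_sumr -big_split /=.
apply: eq_bigr => i _; rewrite mulr_sumr -big_split /=; apply: eq_bigr => j _.
by rewrite big_cons; case: ifP; rewrite ?mulr0 ?addr0.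
Qed.

Lemma form2N w : form2 (fun i j => - w i j) = - form2 w :> form.
Proof.
apply: formP => S; rewrite form_valN !form2E -sumrN; apply: eq_bigr => i _.
by rewrite -sumrN; apply: eq_bigr => j _; case: ifP; rewrite ?oppr0.
Qed.

End Form2.

(** * Newton's identities *)

Section Newton.
Variable K : comNzRingType.

Lemma deriv_prod (I : finType) (P : pred I) (F : I -> {poly K}) :
  (\prod_(i | P i) F i)^`()
  = \sum_(i | P i) (F i)^`() * \prod_(j | P j && (j != i)) F j.
Proof.
have gen (s : seq I) : uniq s -> (\prod_(i <- s) F i)^`()
    = \sum_(i <- s) (F i)^`() * \prod_(j <- s | j != i) F j.
  elim: s => [|i s ih] /=; first by rewrite !big_nil -[1]/(1%:P) derivC.
  case/andP=> is0 us; rewrite !big_cons derivM ih // eqxx /=.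
  congr (_ * _ + _).
    rewrite big_seq [RHS]big_seq_cond; apply: eq_bigl => j.
    by case: eqVneq => [->|]; rewrite ?(negPf is0) // andbT.
  rewrite mulr_sumr big_seq [RHS]big_seq; apply: eq_bigr => j js.
  rewrite big_cons ifT; first by rewrite mulrCA.
  by apply: contraNneq is0 => ->.
rewrite -big_filter gen ?filter_uniq ?index_enum_uniq // big_filter.
apply: eq_bigr => i _; rewrite big_filter_cond; congr (_ * _).
Qed.

(** Jacobi's formula: grouping the Leibniz expansion of the derivative by the
    row that is differentiated leaves the cofactor expansion of that row. *)
Lemma deriv_det r (M : 'M[{poly K}]_r) :
  (\det M)^`() = \tr (map_mx (@deriv K) M *m \adj M).
Proof.
rewrite /determinant raddf_sum /=.
transitivity (\sum_(i < r) \sum_(s : 'S_r)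
   ((-1) ^+ s * ((M i (s i))^`() * \prod_(j | j != i) M j (s j)))).
  rewrite exchange_big; apply: eq_bigr => s _ /=.
  rewrite -mulr_sumr.
  rewrite -signr_odd; case: (odd s); last by rewrite !mul1r deriv_prod.
  by rewrite !mulN1r derivN deriv_prod.
rewrite /mxtrace; apply: eq_bigr => i _; rewrite mxE.
rewrite (partition_big (fun s : 'S_r => s i) predT) //=.
apply: eq_bigr => j _; rewrite !mxE expand_cofactor mulr_sumr.
apply: eq_bigr => s /eqP sij; rewrite sij mulrCA; congr (_ * (_ * _)).
by apply: eq_bigl => k; rewrite eq_sym.
Qed.

Variables (r : nat) (N : 'M[K]_r).

(** The [k]-th elementary symmetric function of the eigenvalues of [N]. *)
Definition elem_sym k := (\det (1%:M + 'X *: map_mx polyC N))`_k.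

Let p := \det (1%:M + 'X *: map_mx polyC N).
Let Q k := map_mx (coefp k) (\adj (1%:M + 'X *: map_mx polyC N)).

Lemma elem_sym0 : elem_sym 0 = 1.
Proof.
rewrite /elem_sym -horner_coef0 -horner_evalE -det_map_mx; apply/eqP.
rewrite (_ : map_mx _ _ = 1%:M) ?det1 //; apply/matrixP=> i j.
rewrite !mxE /= horner_evalE hornerD hornerM hornerX mul0r addr0.
by rewrite hornerMn hornerC.
Qed.

(** Compare the coefficients of ['X^k] in [(1 + 'X N) adj (1 + 'X N) = det (1
    + 'X N)]: this determines the adjugate recursively. *)
Lemma adj_coef k :
  Q k = \sum_(j < k.+1) ((-1) ^+ j * elem_sym (k - j)) *: N ^+ j.
Proof.
(* Coefficient of ['X^l] in [(1 + 'X N) adj (1 + 'X N) = p]. *)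
have hQ l : Q l + (if l is l'.+1 then N *m Q l' else 0) = (elem_sym l)%:M.
  apply/matrixP => i j.
  have /matrixP/(_ i j) := mul_mx_adj (1%:M + 'X *: map_mx polyC N).
  rewrite mulmxDl mul1mx -scalemxAl => /(congr1 (coefp l)).
  rewrite !mxE /= coefD => h.
  case: l h => [|l]; rewrite ?coefMn coefXM /= => <-; congr (_ + _).
    by rewrite mxE.
  rewrite mxE coef_sum; apply: eq_bigr => m _; rewrite !mxE /= coefCM.
  by [].
elim: k => [|k ihk].
  by have := hQ 0%N; rewrite addr0 big_ord1 => ->; rewrite mul1r scalemx1.
have := hQ k.+1; rewrite ihk => /(canRL (addrK _)) ->.
rewrite [RHS]big_ord_recl /= expr0 mul1r subn0 scalemx1; congr (_ + _).
rewrite mulmx_sumr -sumrN; apply: eq_bigr => j _ /=.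
by rewrite -scalemxAr -[N *m _]exprS /bump add1n subSS [(-1) ^+ j.+1]exprS mulN1r mulNr scaleNr.
Qed.

(** Newton's identities, over any commutative ring: Jacobi's formula for [det
    (1 + 'X N)], with the coefficients of the adjugate replaced by their
    values. *)
Lemma newton k :
  elem_sym k.+1 *+ k.+1 = \sum_(j < k.+1) (-1) ^+ j * elem_sym (k - j) * \tr (N ^+ j.+1).
Proof.
rewrite /elem_sym -coef_deriv deriv_det.
have -> : map_mx (@deriv K) (1%:M + 'X *: map_mx polyC N) = map_mx polyC N.
  apply/matrixP=> i j; rewrite !mxE derivD derivMn -[1]/(1%:P) derivC mul0rn add0r.
  by rewrite derivM derivX derivC mulr0 addr0 mul1r.
transitivity (\tr (N *m Q k)).
  rewrite /mxtrace coef_sum; apply: eq_bigr => i _; rewrite !mxE coef_sum.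
  by apply: eq_bigr => j _; rewrite !mxE coefCM.
rewrite adj_coef mulmx_sumr raddf_sum; apply: eq_bigr => j _ /=.
by rewrite -scalemxAr -[N *m _]exprS mxtraceZ.
Qed.

Lemma det_1D m : (forall k, (m <= k)%N -> elem_sym k = 0) ->
  \det (1%:M + N) = \sum_(k < m) elem_sym k.
Proof.
move=> h; have sp : (size p <= m)%N by apply/leq_sizeP.
transitivity p.[1].
  rewrite -horner_evalE -det_map_mx; congr (\det _); apply/matrixP=> i j.
  rewrite !mxE /= horner_evalE hornerD hornerM hornerX hornerC mul1r.
  by rewrite hornerMn hornerC.
rewrite (horner_coef_wide _ sp); apply: eq_bigr => k _.
by rewrite expr1n mulr1.
Qed.

End Newton.

(** * Conjugation into a Cartan subalgebra over the ring of forms *)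

(** Rearrangement of a Cauchy product. *)
Lemma big_triangle (V : nmodType) m (F : nat -> nat -> V) :
  (\sum_(k < m) \sum_(j < k.+1) F j (k - j)%N
   = \sum_(j < m) \sum_(l < m - j) F j l)%R.
Proof.
elim: m => [|m ih]; first by rewrite !big_ord0.
rewrite big_ord_recr /= ih [RHS]big_ord_recr /= subSnn big_ord1.
rewrite [X in _ + X]big_ord_recr /= subnn addrA; congr (_ + _).
rewrite -big_split; apply: eq_bigr => j _ /=.
by rewrite subSn ?big_ord_recr //= ltnW.
Qed.

Lemma big_square_truncate (V : nmodType) p (F : nat -> nat -> V) :
  (forall j l, (p <= j)%N || (p <= l)%N -> F j l = 0) ->
  \sum_(k < p + p) \sum_(j < k.+1) F j (k - j)%N = \sum_(j < p) \sum_(l < p) F j l.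
Proof.
move=> F0; rewrite big_triangle.
have cut (q : nat) (G : nat -> V) : (p <= q)%N -> (forall l, (p <= l)%N -> G l = 0) ->
    \sum_(l < q) G l = \sum_(l < p) G l.
  move=> pq G0; rewrite -(subnKC pq) big_split_ord /= [X in _ + X]big1 ?addr0 //.
  by move=> i _; apply: G0; rewrite leq_addr.
rewrite (cut _ (fun j => \sum_(l < p + p - j) F j l)) ?leq_addr // => [|j pj].
  apply: eq_bigr => j _; apply: (cut _ (F j)); first by rewrite -addnBA ?leq_addr // ltnW.
  by move=> l pl; rewrite F0 // pl orbT.
by rewrite big1 // => l _; rewrite F0 // pj.
Qed.

Section MatrixForms.
Variables (F : fieldType) (n : nat).
Local Notation form := (evenform F n).
Local Notation cst := (cst_form n).

Definition mx_ord d p q (A : 'M[form]_(p, q)) := forall i j, ord_ge d (A i j).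

Lemma mx_ordD d p q (A B : 'M[form]_(p, q)) :
  mx_ord d A -> mx_ord d B -> mx_ord d (A + B).
Proof. by move=> hA hB i j; rewrite mxE; apply: ord_geD. Qed.

Lemma mx_ordZ d p q a (A : 'M[form]_(p, q)) : mx_ord d A -> mx_ord d (a *: A).
Proof. by move=> hA i j; rewrite mxE; apply: ord_geMl. Qed.

Lemma mx_ord_sum d p q (I : Type) (r : seq I) (P : pred I) (A : I -> 'M[form]_(p, q)) :
  (forall k, P k -> mx_ord d (A k)) -> mx_ord d (\sum_(k <- r | P k) A k).
Proof.
by move=> hA i j; rewrite summxE; apply: ord_ge_sum => k Pk; apply: hA.
Qed.

Lemma mx_ordM d e p q r (A : 'M[form]_(p, q)) (B : 'M[form]_(q, r)) :
  mx_ord d A -> mx_ord e B -> mx_ord (d + e) (A *m B).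
Proof.
by move=> hA hB i j; rewrite mxE; apply: ord_ge_sum => k _; apply: ord_geM.
Qed.

Lemma mx_ordW d e p q (A : 'M[form]_(p, q)) : (e <= d)%N -> mx_ord d A -> mx_ord e A.
Proof. by move=> ed hA i j; apply: ord_geW ed (hA i j). Qed.

Lemma mx_ordMl d p q r (A : 'M[form]_(p, q)) (B : 'M[form]_(q, r)) :
  mx_ord d B -> mx_ord d (A *m B).
Proof. by move=> hB; rewrite -[d in mx_ord d]add0n; apply: mx_ordM. Qed.

Lemma mx_ordMr d p q r (A : 'M[form]_(p, q)) (B : 'M[form]_(q, r)) :
  mx_ord d A -> mx_ord d (A *m B).
Proof. by move=> hA; rewrite -[d in mx_ord d]addn0; apply: mx_ordM. Qed.

Lemma mx_ordX d k p (A : 'M[form]_p) : mx_ord d A -> mx_ord (k * d) (A ^+ k).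
Proof.
by move=> hA; elim: k => [|k ih] //; rewrite exprS mulSn; apply: mx_ordM.
Qed.

Lemma mx_ord_eq0 d p q (A : 'M[form]_(p, q)) : (n < d)%N -> mx_ord d A -> A = 0.
Proof. by move=> nd hA; apply/matrixP=> i j; rewrite mxE; apply: (ord_ge_eq0 nd); apply: hA. Qed.

Lemma mxtrace_conjX r (U A : 'M[form]_r) k :
  U \in unitmx -> \tr ((U *m A *m invmx U) ^+ k) = \tr (A ^+ k).
Proof.
move=> Uu; have -> : (U *m A *m invmx U) ^+ k = U *m (A ^+ k) *m invmx U.
  elim: k => [|k ih]; first by rewrite !expr0 mulmx1 mulmxV.
  by rewrite !exprS ih -!mulmxE !mulmxA mulmxKV.
by rewrite -mulmxA mxtrace_mulC mulmxKV.
Qed.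

Lemma trace_diag_exp r s (L : 'rV[form]_s) k :
  \tr ((block_mx 0 0 0 (diag_mx L) : 'M_(r + s)) ^+ k.+1)
  = \sum_a (L 0 a) ^+ k.+1.
Proof.
have -> : (block_mx 0 0 0 (diag_mx L) : 'M_(r + s)) ^+ k.+1
    = block_mx 0 0 0 (diag_mx (\row_a (L 0 a) ^+ k.+1)).
  elim: k => [|k ih].
    by rewrite expr1; congr (block_mx _ _ _ (diag_mx _)); apply/rowP => a; rewrite mxE.
  rewrite exprS ih -mulmxE mulmx_block !mulmx0 !mul0mx !addr0 add0r.
  rewrite mulmx_diag; congr (block_mx _ _ _ (diag_mx _)); apply/rowP => a.
  by rewrite !mxE -exprS.
rewrite mxtrace_block mxtrace0 add0r mxtrace_diag.
by apply: eq_bigr => a _; rewrite mxE.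
Qed.

Lemma unitmx_const p (U : 'M[form]_p) :
  map_mx (@const_part F n) U = 1%:M -> U \in unitmx.
Proof.
by move=> U1; rewrite unitmxE form_unitP // -det_map_mx U1 det1 oner_neq0.
Qed.

Lemma const_part_mx_ord d p q (A : 'M[form]_(p, q)) :
  (0 < d)%N -> mx_ord d A -> map_mx (@const_part F n) A = 0.
Proof. by move=> d0 hA; apply/matrixP=> i j; rewrite !mxE (const_part_ord d0). Qed.

End MatrixForms.

(** A Lie algebra of dimension [N] over [F] is given by the matrices [adm k]
    of [ad e_k] in a basis; [adK] is its adjoint representation after
    extension of scalars from [F] to the ring of forms. *)
Section FormLie.
Variables (F : numFieldType) (n N : nat).
Local Notation form := (evenform F n).
Local Notation cst := (cst_form n).
Variable adm : 'I_N -> 'M[F]_N.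
Hypothesis adm_anti : forall k j i, adm k i j = - adm j i k.
Hypothesis adm_jacobi : forall k m,
  adm k *m adm m - adm m *m adm k = \sum_l adm k l m *: adm l.

Definition adK (x : 'cV[form]_N) : 'M[form]_N :=
  \sum_k x k 0 *: map_mx cst (adm k).

Lemma adKD x y : adK (x + y) = adK x + adK y.
Proof.
by rewrite /adK -big_split; apply: eq_bigr => k _; rewrite mxE scalerDl.
Qed.

Lemma adKZ a x : adK (a *: x) = a *: adK x.
Proof.
by rewrite /adK scaler_sumr; apply: eq_bigr => k _; rewrite mxE scalerA.
Qed.

Lemma adK_sum (I : Type) (r : seq I) (P : pred I) (x : I -> 'cV[form]_N) :
  adK (\sum_(i <- r | P i) x i) = \sum_(i <- r | P i) adK (x i).
Proof.
apply: (big_morph _ adKD); rewrite /adK big1 // => k _.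
by rewrite mxE scale0r.
Qed.

Lemma adKE x i j : adK x i j = \sum_k x k 0 * cst (adm k i j).
Proof. by rewrite summxE; apply: eq_bigr => k _; rewrite !mxE. Qed.

Lemma adK_anti x y : adK x *m y = - (adK y *m x).
Proof.
apply/matrixP => i j; rewrite !mxE (ord1 j) -sumrN.
under eq_bigr => l _ do rewrite adKE mulr_suml.
rewrite exchange_big /=; apply: eq_bigr => k _.
rewrite adKE mulr_suml -sumrN; apply: eq_bigr => l _.
by rewrite [adm k i l]adm_anti rmorphN /= mulrN mulNr mulrAC [x _ _ * _]mulrC mulrAC.
Qed.

Lemma adK_jacobi x y : adK (adK x *m y) = adK x *m adK y - adK y *m adK x.
Proof.
have -> : adK x *m adK y - adK y *m adK x
    = \sum_k \sum_m (x k 0 * y m 0) *: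
       map_mx cst (adm k *m adm m - adm m *m adm k).
  rewrite {1 2}/adK mulmx_suml.
  under eq_bigr => k _ do rewrite mulmx_sumr.
  rewrite {1 2}/adK mulmx_suml.
  under [X in _ - X]eq_bigr => k _ do rewrite mulmx_sumr.
  rewrite [X in _ - X]exchange_big /= -sumrB; apply: eq_bigr => k _.
  rewrite -sumrB; apply: eq_bigr => m _.
  rewrite map_mxB !map_mxM -!scalemxAl -!scalemxAr !scalerA scalerBr.
  by rewrite [y m 0 * _]mulrC.
under [RHS]eq_bigr => k _ do under eq_bigr => m _ do
  rewrite adm_jacobi map_mx_sum scaler_sumr.
have adK_def z : adK z = \sum_k z k 0 *: map_mx cst (adm k) by [].
rewrite [LHS]adK_def; under [RHS]eq_bigr => k _ do rewrite exchange_big /=.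
rewrite [RHS]exchange_big /=; apply: eq_bigr => l _.
rewrite mxE scaler_suml.
under [LHS]eq_bigr => m _ do rewrite adKE mulr_suml scaler_suml.
rewrite exchange_big; apply: eq_bigr => k _; apply: eq_bigr => m _ /=.
by rewrite map_mxZ scalerA; congr (_ *: _); rewrite mulrAC.
Qed.

Lemma adK_ord d x : mx_ord d x -> mx_ord d (adK x).
Proof.
by move=> hx; apply: mx_ord_sum => k _ i j; rewrite mxE; apply: ord_geMr.
Qed.

(** The exponential of a matrix without constant part: the truncated terms
    vanish. *)
Definition mx_expn (D : 'M[form]_N) : 'M[form]_N :=
  \sum_(k < n.+1) cst (k`!)%:R^-1 *: D ^+ k.

Section InnerAutomorphism.
Variables (y : 'cV[form]_N) (y_ord : mx_ord 1 y).
Let D := adK y.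

Let D_ord k : mx_ord k (D ^+ k).
Proof. by rewrite -[k in mx_ord k]muln1; apply: mx_ordX; apply: adK_ord. Qed.

Let D_nil k : (n < k)%N -> D ^+ k = 0.
Proof. by move=> nk; apply: (mx_ord_eq0 nk); apply: D_ord. Qed.

Lemma mx_expn_unit : mx_expn D \in unitmx.
Proof.
apply: unitmx_const; rewrite map_mx_sum big_ord_recl big1 => [|k _].
  rewrite addr0 fact0 invr1 rmorph1 scale1r expr0; exact: map_mx1.
by rewrite map_mxZ (const_part_mx_ord _ (@D_ord (lift ord0 k))) ?scaler0.
Qed.

(** [exp (ad y)] is an automorphism, stated as an intertwining of adjoint
    representations. It follows from the Leibniz rule [D^k (ad x) = \sum_j
    'C(k, j) (ad (D^j x)) D^(k-j)] for [D = ad y], by rearranging the double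
    sum. *)
Lemma mx_expn_ad x : adK (mx_expn D *m x) *m mx_expn D = mx_expn D *m adK x.
Proof.
pose A j := adK (D ^+ j *m x).
have A_nil j : (n < j)%N -> A j = 0.
  by move=> nj; rewrite /A D_nil // mul0mx -[0](scale0r (0 : 'cV__)) adKZ scale0r.
have A_rec j : D * A j = A j.+1 + A j * D.
  by rewrite {2}/A exprS -mulmxE -[D *m _ *m x]mulmxA adK_jacobi subrK.
have leibniz k : D ^+ k * adK x = \sum_(j < k.+1) (A j * D ^+ (k - j)) *+ 'C(k, j).
  elim: k => [|k ih].
    by rewrite big_ord1 /= bin0 expr0 mul1r mulr1 /A expr0 mul1mx.
  rewrite exprS -mulrA ih mulr_sumr.
  under eq_bigr => j _ do rewrite mulrnAr mulrA A_rec mulrDl mulrnDl.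
  rewrite big_split /= [RHS]big_ord_recl /= bin0 subn0.
  under [X in _ = _ + X]eq_bigr => j _ do
    rewrite /bump add1n subSS binS mulrnDr.
  rewrite big_split addrA [LHS]addrC /=; congr (_ + _).
  rewrite [LHS]big_ord_recl /= bin0 subn0 -mulrA -exprS.
  rewrite [X in _ = _ + X]big_ord_recr /= bin_small // mulr0n addr0.
  congr (_ + _); apply: eq_bigr => j _; rewrite /bump add1n -mulrA.
  by rewrite -exprS -subSn // subSS.
have term k : cst (k`!)%:R^-1 *: (D ^+ k *m adK x) = \sum_(j < k.+1)
    (cst (j`!)%:R^-1 *: A j) *m (cst ((k - j)`!)%:R^-1 *: D ^+ (k - j)).
  rewrite [in LHS]mulmxE leibniz scaler_sumr; apply: eq_bigr => j _.
  rewrite -scalemxAl -scalemxAr scalerA -rmorphM -scalerMnr -scaler_nat.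
  rewrite -(rmorph_nat cst) scalerA -rmorphM; congr (cst _ *: _).
  have jk : (j <= k)%N by rewrite -ltnS.
  have nz m : (m`!)%:R != 0 :> F by rewrite pnatr_eq0 -lt0n fact_gt0.
  apply: (mulIf (nz k)); rewrite divfK // -[in RHS](bin_fact jk) !natrM.
  by field; rewrite !nz.
have -> : mx_expn D *m adK x = \sum_(k < n.+1 + n.+1) \sum_(j < k.+1)
    (cst (j`!)%:R^-1 *: A j) *m (cst ((k - j)`!)%:R^-1 *: D ^+ (k - j)).
  rewrite big_split_ord /= [X in _ + X]big1 ?addr0 => [|k _].
    by rewrite mulmx_suml; apply: eq_bigr => k _; rewrite -scalemxAl term.
  by rewrite -term D_nil ?leq_addr // mul0mx scaler0.
rewrite (@big_square_truncate _ _ (fun j l =>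
   (cst (j`!)%:R^-1 *: A j) *m (cst (l`!)%:R^-1 *: D ^+ l))).
  rewrite {1}/mx_expn [X in adK X]mulmx_suml adK_sum mulmx_suml; apply: eq_bigr => j _.
  by rewrite -scalemxAl adKZ /mx_expn mulmx_sumr.
by move=> j l /orP[/A_nil|/D_nil] ->; rewrite scaler0 ?mul0mx ?mulmx0.
Qed.

(** Power traces of the adjoint representation are invariant under inner
    automorphisms. *)
Lemma mx_expn_trace x k : \tr (adK (mx_expn D *m x) ^+ k) = \tr (adK x ^+ k).
Proof.
have -> : adK (mx_expn D *m x) = mx_expn D *m adK x *m invmx (mx_expn D).
  by rewrite -mx_expn_ad mulmxK ?mx_expn_unit.
by rewrite mxtrace_conjX ?mx_expn_unit.
Qed.

End InnerAutomorphism.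

(** [H] and [V] are the matrices of a basis of a Cartan subalgebra and of root
    vectors, [lam i a] is the value of the root [a] on the [i]-th basis vector
    of the Cartan subalgebra, and [B] inverts the basis. *)
Section CartanReduction.
Variables (r s : nat) (H : 'M[F]_(N, r)) (V : 'M[F]_(N, s)) (B : 'M[F]_(r + s, N)).
Variable lam : 'M[F]_(r, s).
Hypothesis basisK : row_mx H V *m B = 1%:M.
Hypothesis basisVK : B *m row_mx H V = 1%:M.

Let ad_col i := \sum_k H k i *: adm k.
Hypothesis cartan_comm : forall i, ad_col i *m H = 0.
Hypothesis cartan_root : forall i, ad_col i *m V = V *m diag_mx (row i lam).

Local Notation "A ^F" := (map_mx cst A) (at level 1, format "A ^F").

Lemma adK_cartan (c : 'cV[form]_r) :
  adK (H^F *m c) = \sum_i c i 0 *: (ad_col i)^F.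
Proof.
have -> : H^F *m c = \sum_i c i 0 *: (col i H)^F.
  apply/matrixP=> k l; rewrite !mxE summxE; apply: eq_bigr => i _.
  by rewrite (ord1 l) !mxE mulrC.
rewrite adK_sum; apply: eq_bigr => i _; rewrite adKZ; congr (_ *: _).
by rewrite map_mx_sum; apply: eq_bigr => k _; rewrite map_mxZ !mxE.
Qed.

Lemma adK_cartan_comm c : adK (H^F *m c) *m H^F = 0.
Proof.
rewrite adK_cartan mulmx_suml big1 // => i _.
by rewrite -scalemxAl -map_mxM cartan_comm map_mx0 scaler0.
Qed.

Lemma adK_cartan_root c :
  adK (H^F *m c) *m V^F = V^F *m diag_mx (c^T *m lam^F).
Proof.
rewrite adK_cartan mulmx_suml.
transitivity (V^F *m \sum_i c i 0 *: diag_mx (row i lam^F)).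
  rewrite mulmx_sumr; apply: eq_bigr => i _.
  rewrite -scalemxAl -map_mxM cartan_root map_mxM scalemxAr.
  by rewrite map_diag_mx map_row.
congr (_ *m _); apply/matrixP=> a b; rewrite summxE !mxE -sumrMnl.
by apply: eq_bigr => i _; rewrite !mxE mulrnAr.
Qed.

(** On the Cartan subalgebra the adjoint representation is diagonal in the
    basis of weight vectors. *)
Lemma trace_adK_cartan c k :
  \tr (adK (H^F *m c) ^+ k.+1) = \sum_a ((c^T *m lam^F) 0 a) ^+ k.+1.
Proof.
pose P := row_mx H^F V^F; pose L := c^T *m lam^F.
pose E := block_mx 0 0 0 (diag_mx L) : 'M_(r + s).
have hP : adK (H^F *m c) *m P = P *m E.
  rewrite /P /E mul_mx_row adK_cartan_comm adK_cartan_root mul_row_block.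
  by rewrite !mulmx0 !add0r.
have hX l : adK (H^F *m c) ^+ l *m P = P *m E ^+ l.
  elim: l => [|l ih]; first by rewrite !expr0 mul1mx mulmx1.
  by rewrite exprSr -mulmxE -mulmxA hP mulmxA ih -mulmxA exprSr.
have PB : P *m B^F = 1%:M by rewrite /P -map_row_mx -map_mxM basisK map_mx1.
have BP : B^F *m P = 1%:M by rewrite /P -map_row_mx -map_mxM basisVK map_mx1.
rewrite -[_ ^+ _]mulmx1 -PB mulmxA hX -mulmxA mxtrace_mulC -mulmxA BP mulmx1.
by rewrite trace_diag_exp.
Qed.

(** Newton's method for the conjugation of [h0 + x1], with [h0] regular, into
    the Cartan subalgebra. If an element is [h + v] with [h] in the Cartan
    subalgebra and [v] in the span of the root vectors and of order [m + 1],
    then [y] with [[y, h] = - v] exists because the roots do not vanish on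
    [h], and [exp (ad y)] moves [h + v] to an element of the Cartan subalgebra
    up to terms of higher order. The power traces do not change. *)
Lemma cartan_approx (c0 : 'cV[F]_r) (x1 : 'cV[form]_N) m :
  (forall a, (c0^T *m lam) 0 a != 0) -> mx_ord 1 x1 ->
  exists c v, [/\ mx_ord 1 (c - c0^F), mx_ord m.+1 v &
    forall k, \tr (adK (H^F *m c + V^F *m v) ^+ k)
              = \tr (adK ((H *m c0)^F + x1) ^+ k)].
Proof.
move=> c0_reg x1_ord.
have split w : w = H^F *m usubmx (B^F *m w) + V^F *m dsubmx (B^F *m w).
  rewrite -mul_row_col vsubmxK -map_row_mx mulmxA -map_mxM basisK map_mx1.
  by rewrite mul1mx.
have sub_ord d (w : 'cV[form]_N) : mx_ord d w ->
    mx_ord d (usubmx (B^F *m w)) /\ mx_ord d (dsubmx (B^F *m w)).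
  move=> hw; have hB : mx_ord d (B^F *m w) by apply: mx_ordMl.
  by split=> i j; rewrite mxE.
elim: m => [|m [c [v [c_ord v_ord tr_eq]]]].
  have [hu hd] := sub_ord _ _ x1_ord.
  exists (c0^F + usubmx (B^F *m x1)), (dsubmx (B^F *m x1)); split=> [||k].
    by rewrite addrC addKr.
  by [].
  by rewrite mulmxDr -addrA -split map_mxM.
pose L := c^T *m lam^F.
have L_unit a : L 0 a \is a GRing.unit.
  apply: form_unitP; rewrite (_ : const_part _ = (c0^T *m lam) 0 a) //.
  have hc : map_mx (@const_part F n) c = c0.
    apply/matrixP => i j; have := @const_part_mx_ord _ _ 1 _ _ _ isT c_ord.
    move/matrixP/(_ i j); rewrite !mxE rmorphB /= const_part_cst.
    by move/eqP; rewrite subr_eq0 => /eqP.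
  transitivity ((map_mx (@const_part F n) L) 0 a); first by rewrite [RHS]mxE.
  rewrite /L map_mxM -map_trmx hc -map_mx_comp; congr ((_ *m _) _ _).
  by apply/matrixP => i j; rewrite mxE /= const_part_cst.
(* [V^F *m t] solves [[y, h] = - v]: [ad h] multiplies the coordinates by [L]. *)
pose t : 'cV[form]_s := \col_a (v a 0 / L 0 a).
have t_ord : mx_ord m.+1 t.
  by move=> a j; rewrite mxE; apply: ord_geMr; apply: v_ord.
pose y := V^F *m t; have y_ord : mx_ord m.+1 y by apply: mx_ordMl.
have y_ord1 : mx_ord 1 y by apply: mx_ordW y_ord.
pose x := H^F *m c + V^F *m v; pose w := mx_expn (adK y) *m x - H^F *m c.
have Dx : mx_ord m.+2 (adK y *m x + V^F *m v).
  rewrite /x mulmxDr.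
  have -> : adK y *m (H^F *m c) = - (V^F *m v).
    rewrite adK_anti /y mulmxA adK_cartan_root -mulmxA; congr (- (_ *m _)).
    rewrite mul_diag_mx; apply/colP => a; rewrite mxE [t a 0]mxE mulrC divrK //.
  rewrite addrAC addNr add0r; apply: (@mx_ordW _ _ (m.+1 + m.+1)).
    by rewrite addSnnS leq_addl.
  by apply: mx_ordM; [apply: adK_ord | apply: mx_ordMl].
have w_ord : mx_ord m.+2 w.
  have -> : w = (mx_expn (adK y) *m x - x - adK y *m x) + (adK y *m x + V^F *m v).
    by rewrite addrA subrK /w {3}/x opprD addrA subrK.
  apply: mx_ordD => //.
  have pow_ord k : mx_ord m.+2 (adK y ^+ k.+2).
    apply: (@mx_ordW _ _ (k.+2 * m.+1)); last by apply/mx_ordX/adK_ord.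
    by rewrite !mulSn addnA addSnnS; apply: leq_trans (leq_addr _ _); rewrite leq_addl.
  (* One more vanishing term makes room for the two leading ones in all dimensions. *)
  have -> : mx_expn (adK y) = \sum_(k < n.+2) cst (k`!)%:R^-1 *: adK y ^+ k.
    rewrite [RHS]big_ord_recr /= (_ : _ ^+ n.+1 = 0) ?scaler0 ?addr0 //.
    apply: (@mx_ord_eq0 _ _ n.+1) => //; rewrite -[X in mx_ord X _]muln1.
    exact/mx_ordX/adK_ord.
  rewrite !big_ord_recl !fact0 !invr1 !rmorph1 !scale1r expr0 expr1.
  rewrite !mulmxDl mul1mx [x + _]addrC addrK [adK y *m x + _]addrC addrK.
  rewrite mulmx_suml; apply: mx_ord_sum => k _; rewrite -scalemxAl.
  by apply/mx_ordZ/mx_ordMr/pow_ord.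
have [hu hd] := sub_ord _ _ w_ord.
exists (c + usubmx (B^F *m w)), (dsubmx (B^F *m w)); split=> [||k].
  by rewrite addrAC; apply: mx_ordD => //; apply: mx_ordW hu.
  by [].
have -> : H^F *m (c + usubmx (B^F *m w)) + V^F *m dsubmx (B^F *m w)
    = mx_expn (adK y) *m x.
  by rewrite mulmxDr -addrA -split /w addrC subrK.
by rewrite (mx_expn_trace y_ord1).
Qed.

(** Regular elements perturbed by nilpotent ones have the spectrum of an
    element of the Cartan subalgebra: run the approximation past the top
    degree. This replaces, over the ring of forms, the conjugation of an
    element of a compact Lie algebra into a maximal torus. *)
Theorem cartan_spectrum (c0 : 'cV[F]_r) (x1 : 'cV[form]_N) :
  (forall a, (c0^T *m lam) 0 a != 0) -> mx_ord 1 x1 ->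
  exists c : 'cV[form]_r, forall k,
    \tr (adK ((H *m c0)^F + x1) ^+ k.+1) = \sum_a ((c^T *m lam^F) 0 a) ^+ k.+1.
Proof.
move=> c0_reg x1_ord.
have [c [v [_ v_ord tr_eq]]] := cartan_approx n c0_reg x1_ord.
exists c => k; rewrite -tr_eq (mx_ord_eq0 _ v_ord) // mulmx0 addr0.
exact: trace_adK_cartan.
Qed.

End CartanReduction.

End FormLie.

(** * The roots of E8 and their power sums *)

(** The roots of E8 are encoded by twice their coordinates: the vectors of
    signs with an even number of minus signs, and the [2 (+- e_i +- e_j)]. *)
Fixpoint signs (n : nat) : seq (seq int) :=
  if n is m.+1 then
    [seq 1 :: s | s <- signs m] ++ [seq -1 :: s | s <- signs m]
  else [:: [::]].

Fixpoint pairs (n : nat) : seq (seq int) :=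
  if n is m.+1 then
    [seq 0 :: s | s <- pairs m] ++
    [seq a :: s | a <- [:: 2; -2 : int],
                  s <- [seq set_nth 0 (nseq m 0) i b | i <- iota 0 m, b <- [:: 2; -2 : int]]]
  else [::].

Definition roots2 : seq (seq int) :=
  [seq s <- signs 8 | ~~ odd (count (pred1 (-1 : int)) s)] ++ pairs 8.

(** Unlike a big operator, this evaluates by computation on the list of roots.
    *)
Definition sumz (s : seq int) : int := foldr +%R 0 s.

Lemma size_roots2 : size roots2 = 240%N. Proof. by vm_compute. Qed.

Lemma uniq_roots2 : uniq roots2. Proof. by vm_compute. Qed.

Lemma roots2_size s : s \in roots2 -> size s = 8%N.
Proof.
have /allP h : all (fun s => size s == 8%N) roots2 by vm_compute.
by move=> /h /eqP.
Qed.

Lemma roots2_parity s : s \in roots2 ->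
  all (fun b => (2 %| b)%Z) s || all (fun b => (2 %| b - 1)%Z) s.
Proof.
by move: s; apply/allP; vm_compute.
Qed.

Lemma roots2_sum s : s \in roots2 -> (4 %| sumz s)%Z.
Proof. by move: s; apply/allP; vm_compute. Qed.

Lemma roots2_norm s : s \in roots2 -> sumz [seq b * b | b <- s] = 8.
Proof.
have /allP h : all (fun s => sumz [seq b * b | b <- s] == 8) roots2 by vm_compute.
by move=> /h /eqP.
Qed.

(** A regular element of the Cartan subalgebra, chosen with small integral
    coordinates. *)
Definition rho : seq int := [:: 0; 1; 2; 3; 4; 5; 6; 23].

Lemma roots2_rho s : s \in roots2 -> sumz [seq p.1 * p.2 | p <- zip rho s] != 0.
Proof. by move: s; apply/allP; vm_compute. Qed.

(** The roots form a tight frame; in particular they span. *)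
Lemma roots2_frame i j : (i < 8)%N -> (j < 8)%N ->
  sumz [seq s`_i * s`_j | s <- roots2] = if i == j then 240 else 0.
Proof.
move=> i8 j8; apply/eqP.
have /allP/(_ i) : all (fun i => all (fun j => sumz [seq s`_i * s`_j | s <- roots2]
   == if i == j then 240 else 0) (iota 0 8)) (iota 0 8) by vm_compute.
by rewrite mem_iota => /(_ i8) /allP/(_ j); rewrite mem_iota => /(_ j8).
Qed.

Section Moments.
Variable K : comNzRingType.

(** Integral multiples that reduce to plain ring terms for the coefficients of
    the roots. *)
Definition smulz (a : int) (b : K) : K :=
  match a with
  | Posz 0 => 0 | Posz 1 => b | Posz n => b *+ n
  | Negz 0 => - b | Negz n => - (b *+ n.+1)
  end.

Lemma smulzE a b : smulz a b = b *~ a.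
Proof. by case: a => [[|[|n]]|[|n]]. Qed.

Fixpoint lin (s : seq int) (x : seq K) : K :=
  match s, x with a :: s', b :: x' => smulz a b + lin s' x' | _, _ => 0 end.

Definition moment k x : K := foldr (fun s acc => lin s x ^+ k + acc) 0 roots2.

Variables a b c d e f g h : K.
Let x := [:: a; b; c; d; e; f; g; h].
Let q := a ^+ 2 + b ^+ 2 + c ^+ 2 + d ^+ 2 + e ^+ 2 + f ^+ 2 + g ^+ 2 + h ^+ 2.

Let roots2E : roots2 = ltac:(let t := eval vm_compute in roots2 in exact t).
Proof. by vm_compute. Qed.

(** Power sums of the roots. E8 has no invariant polynomial of degree 4 or 6
    other than the powers of the quadratic one, so these must be multiples of
    powers of [q]; the odd ones vanish as the roots come in opposite pairs. *)
Lemma moment1 : moment 1 x = 0.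
Proof. by rewrite /moment roots2E /x /=; ring. Qed.

Lemma moment2 : moment 2 x = q *+ 240.
Proof. by rewrite /moment roots2E /x /q /=; ring. Qed.

Lemma moment3 : moment 3 x = 0.
Proof. by rewrite /moment roots2E /x /=; ring. Qed.

Lemma moment4 : moment 4 x = q ^+ 2 *+ 576.
Proof. by rewrite /moment roots2E /x /q /=; ring. Qed.

Lemma moment5 : moment 5 x = 0.
Proof. by rewrite /moment roots2E /x /=; ring. Qed.

Lemma moment6 : moment 6 x = q ^+ 3 *+ 1920.
Proof. by rewrite /moment roots2E /x /q /=; ring. Qed.

End Moments.

(** * Weight vectors form a basis *)

Section WeightBasis.
Variables (F : fieldType) (N r s : nat).
Variables (adm : 'I_N -> 'M[F]_N) (H : 'M[F]_(N, r)) (V : 'M[F]_(N, s)).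
Variable lam : 'M[F]_(r, s).
Hypothesis dimN : (r + s)%N = N.
Let ad_col i := \sum_k H k i *: adm k.
Hypothesis cartan_comm : forall i, ad_col i *m H = 0.
Hypothesis cartan_root : forall i, ad_col i *m V = V *m diag_mx (row i lam).
Hypothesis V_neq0 : forall a, col a V != 0.
Hypothesis lam_neq0 : forall a, exists i, lam i a != 0.
Hypothesis lam_inj : forall a b, (forall i, lam i a = lam i b) -> a = b.
Hypothesis lam_free : forall c : 'rV[F]_r, c *m lam = 0 -> c = 0.

Let diag_col (mu : 'rV[F]_s) (d : 'cV[F]_s) a :
  (forall b, b != a -> mu 0 b = 0) ->
  V *m (diag_mx mu *m d) = (mu 0 a * d a 0) *: col a V.
Proof.
move=> mu0; apply/colP => k; rewrite !mxE (bigD1 a) //= big1 => [|b ba].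
  by rewrite addr0 mul_diag_mx mxE mulrC.
by rewrite mul_diag_mx mxE mu0 // mul0r mulr0.
Qed.

(** Joint eigenvectors for distinct systems of eigenvalues are independent.
    The weights annihilating the relation are closed under products with the
    [lam i - z], so Lagrange interpolation isolates each root vector. What
    remains is a relation in the Cartan subalgebra, which is trivial as it is
    killed by all roots and the roots span. *)
Lemma weight_free (c : 'cV[F]_r) (d : 'cV[F]_s) :
  H *m c + V *m d = 0 -> c = 0 /\ d = 0.
Proof.
move=> hcd.
pose S (mu : 'rV[F]_s) := V *m (diag_mx mu *m d) = 0.
have S_lam i : S (row i lam).
  have := congr1 (mulmx (ad_col i)) hcd.
  by rewrite mulmx0 mulmxDr !mulmxA cartan_comm cartan_root mul0mx add0r -mulmxA.
have S_mul i z mu : S mu -> S (\row_b (mu 0 b * (lam i b - z))).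
  move=> Smu.
  rewrite /S (_ : _ *m d = diag_mx (row i lam) *m (diag_mx mu *m d)
                             - z *: (diag_mx mu *m d)).
    by rewrite mulmxBr [V *m (_ *m (_ *m _))]mulmxA -cartan_root -mulmxA -scalemxAr Smu mulmx0 scaler0 subrr.
  by apply/colP => b; rewrite !mul_diag_mx !mxE; ring.
have d0 : d = 0.
  apply/colP => a; rewrite mxE.
  have sep b : exists i, b != a -> lam i a != lam i b.
    have [->|ba] := eqVneq b a.
      by have [i _] := lam_neq0 a; exists i; rewrite eqxx.
    case: (pickP (fun i => lam i a != lam i b)) => [i hi|h].
      by exists i.
    by case/negP: ba; rewrite (lam_inj (a := b) (b := a)) // => i;
       have /eqP := negbFE (h i).
  have [i0 hi0] := lam_neq0 a.
  (* [mu] is the Lagrange polynomial of [a], multiplied by a weight nonzero at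
     [a] to kill the Cartan part. *)
  have [mu [Smu mua mub]] : exists mu, [/\ S mu, mu 0 a != 0 &
      forall b, b \in enum 'I_s -> b != a -> mu 0 b = 0].
    elim: (enum 'I_s) => [|b t [mu [Smu mua mub]]].
      by exists (row i0 lam); split=> //; rewrite mxE.
    have [ba|ba] := eqVneq b a.
      by exists mu; split=> // b'; rewrite inE => /predU1P[->|/mub//]; rewrite ba eqxx.
    have [i /(_ ba) hi] := sep b.
    exists (\row_b' (mu 0 b' * (lam i b' - lam i b))); split.
    - exact: S_mul.
    - by rewrite mxE mulf_neq0 // subr_eq0.
    - move=> b'; rewrite inE mxE => /predU1P[->|bt] b'a; first by rewrite subrr mulr0.
      by rewrite mub ?mul0r.
  have := Smu; rewrite /S (@diag_col mu d a) => [/eqP|b]; last first.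
    by apply: mub; rewrite mem_enum.
  by rewrite scaler_eq0 (negPf (V_neq0 a)) orbF mulf_eq0 (negPf mua) => /eqP.
split=> //; apply: trmx_inj; rewrite trmx0; apply: lam_free.
move: hcd; rewrite d0 mulmx0 addr0 => Hc.
have Vmu : V *m diag_mx (c^T *m lam) = 0.
  have -> : V *m diag_mx (c^T *m lam) = \sum_i c i 0 *: (ad_col i *m V).
    transitivity (V *m \sum_i c i 0 *: diag_mx (row i lam)).
      congr (_ *m _); apply/matrixP=> a b; rewrite summxE !mxE -sumrMnl.
      by apply: eq_bigr => i _; rewrite !mxE mulrnAr.
    rewrite mulmx_sumr; apply: eq_bigr => i _.
    by rewrite cartan_root scalemxAr.
  under eq_bigr => i _ do rewrite scalemxAl.
  rewrite -mulmx_suml (_ : \sum_i _ = 0) ?mul0mx //.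
  rewrite /ad_col; under eq_bigr => i _ do rewrite scaler_sumr.
  rewrite exchange_big big1 //= => k _.
  under eq_bigr => i _ do rewrite scalerA.
  rewrite -scaler_suml; have /colP/(_ k) := Hc; rewrite !mxE => Hck.
  by rewrite (_ : \sum_i _ = 0) ?scale0r // -[RHS]Hck; apply: eq_bigr => i _; rewrite mulrC.
apply/rowP => a; rewrite [RHS]mxE.
apply/eqP; have := V_neq0 a; apply: contraNT => L0.
apply/eqP/colP => k; have /matrixP/(_ k a) := Vmu.
rewrite mul_mx_diag mxE [X in _ = X]mxE => /eqP; rewrite mulf_eq0 (negPf L0) orbF => /eqP Vka.
by rewrite mxE [RHS]mxE.
Qed.

Lemma weight_basis : exists B : 'M[F]_(r + s, N),
  row_mx H V *m B = 1%:M /\ B *m row_mx H V = 1%:M.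
Proof.
have free : row_free (row_mx H V)^T.
  apply: inj_row_free => v hv.
  have := congr1 trmx hv; rewrite trmx_mul trmxK trmx0 -[v^T]vsubmxK mul_row_col.
  move=> /weight_free[vu vd]; apply: trmx_inj.
  by rewrite -[v^T]vsubmxK vu vd col_mx0 trmx0.
have full : row_full (row_mx H V)^T.
  by rewrite /row_full (eqP free) dimN.
have [B1 h1] := row_freeP free; have [B2 h2] := row_fullP full.
have B12 : B1 = B2 by rewrite -[B1]mul1mx -h2 -mulmxA h1 mulmx1.
exists B1^T; split; apply: trmx_inj; rewrite trmx_mul trmxK trmx1 //.
by rewrite B12.
Qed.

End WeightBasis.

(** * Power traces of E8-valued two-forms *)

Section MomentsOrd.
Variable K : comNzRingType.

Lemma linE s (x : seq K) : size x = size s ->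
  lin s x = \sum_(i < size s) x`_i *~ s`_i.
Proof.
elim: s x => [|a s ih] [|b x] //=; first by rewrite big_ord0.
by case=> /ih ->; rewrite big_ord_recl /= smulzE.
Qed.

Lemma momentE k (x : seq K) :
  moment k x = \sum_(a < 240) (lin (nth [::] roots2 a) x) ^+ k.
Proof.
rewrite -[240%N]size_roots2 -(big_mkord xpredT (fun a => lin (nth [::] roots2 a) x ^+ k)).
by rewrite -(big_nth [::] xpredT (fun s => lin s x ^+ k)) unlock.
Qed.

(** The relations between the power sums are homogeneous in the coordinates,
    hence insensitive to the factor by which [roots2] differs from the weights
    of the adjoint representation. *)
Lemma moments (x : seq K) : size x = 8%N -> let m k := moment k x in
  [/\ m 1%N = 0, m 3%N = 0, m 5%N = 0,
      100 * m 4%N = m 2%N ^+ 2 & 7200 * m 6%N = m 2%N ^+ 3].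
Proof.
case: x => [|a [|b [|c [|d [|e [|f [|g [|h [|]]]]]]]]] // _ m; rewrite /m.
rewrite moment1 moment2 moment3 moment4 moment5 moment6.
by split=> //; set q := (_ + _); ring.
Qed.

Lemma scale_relation (p j m m' : K) a b :
  p * m = m' ^+ b -> p * (j ^+ (a * b) * m) = (j ^+ a * m') ^+ b.
Proof. by move=> h; rewrite mulrCA h exprMn exprM. Qed.

End MomentsOrd.

Lemma sumzE (s : seq int) : sumz s = \sum_(i < size s) s`_i.
Proof.
rewrite -(big_mkord xpredT (fun i => s`_i)).
by rewrite -(big_nth 0 xpredT id) unlock.
Qed.

Section TopDegree.
Variables (F : fieldType) (n N : nat).
Local Notation form := (evenform F n).

(** See [hcompM_top]: the leading part of the power traces of [h0 + F]. *)
Lemma trace_pow_top (A0 A1 : 'M[form]_N) k :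
  (forall i j, homog 0 (A0 i j)) -> (forall i j, homog 2 (A1 i j)) ->
  deg_le (k * 2) (\tr ((A0 + A1) ^+ k)) /\
  hcomp (k * 2) (\tr ((A0 + A1) ^+ k)) = \tr (A1 ^+ k).
Proof.
move=> h0 h1.
have h01 i j : deg_le 2 ((A0 + A1) i j) /\ hcomp 2 ((A0 + A1) i j) = A1 i j.
  rewrite mxE; split; last first.
    by rewrite raddfD /= (hcomp_off (h0 i j)) // add0r hcomp_id.
  apply: deg_leD; last exact: homog_deg.
  by apply: (deg_leW (m := 0)) => //; apply: homog_deg.
have pow i j : deg_le (k * 2) (((A0 + A1) ^+ k) i j) /\
    hcomp (k * 2) (((A0 + A1) ^+ k) i j) = (A1 ^+ k) i j.
  elim: k i j => [|k ih] i j.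
    rewrite !expr0 !mxE mul0n; have h : homog 0 ((i == j)%:R : form).
      exact: homog_nat.
    by split; [apply: homog_deg | rewrite hcomp_id].
  rewrite !exprS mulSn -!mulmxE ![(_ *m _) i j]mxE; split.
    by apply: deg_le_sum => l _; apply: deg_leM; [apply: (h01 _ _).1 | apply: (ih _ _).1].
  rewrite raddf_sum; apply: eq_bigr => l _ /=.
  by rewrite hcompM_top ?(h01 _ _).2 ?(ih _ _).2 //; [apply: (h01 _ _).1 | apply: (ih _ _).1].
rewrite /mxtrace; split; first by apply: deg_le_sum => i _; apply: (pow _ _).1.
by rewrite raddf_sum; apply: eq_bigr => i _; apply: (pow _ _).2.
Qed.

End TopDegree.

Section E8.
Local Open Scope complex_scope.
Variables (R : realType) (e8 : compact_e8 R) (n : nat).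
Local Notation C := R[i].
Local Notation form := (evenform C n).
Local Notation cst := (cst_form n).
Local Notation br := (e8_br e8).

(** The roots of E8 in the usual coordinates. *)
Definition root_coord (a : 'I_240) (i : 'I_8) : R := ((nth [::] roots2 a)`_i)%:~R / 2.

Lemma mem_root (a : 'I_240) : nth [::] roots2 a \in roots2.
Proof. by rewrite mem_nth // size_roots2. Qed.

Lemma root_coordP a : e8_root (root_coord a).
Proof.
have sa := roots2_size (mem_root a).
have nz2 : 2 != 0 :> R by rewrite pnatr_eq0.
split.
- have /orP[/allP h|/allP h] := roots2_parity (mem_root a); [left|right] => i.
    have /h/dvdzP[z zE] : (nth [::] roots2 a)`_i \in nth [::] roots2 a.
      by rewrite mem_nth // sa.
    by rewrite /root_coord zE intrM mulfK.
  have /h/dvdzP[z zE] : (nth [::] roots2 a)`_i \in nth [::] roots2 a.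
    by rewrite mem_nth // sa.
  rewrite /root_coord (_ : _ - _ = z%:~R) ?intr_int //.
  by apply: (mulIf nz2); rewrite mulrBl divfK // mulVf // -[1]/(1%:~R) -intrB zE intrM.
- have /dvdzP[z zE] := roots2_sum (mem_root a).
  rewrite -mulr_suml -mulrA -invfM.
  have -> : \sum_(i < 8) ((nth [::] roots2 a)`_i)%:~R = (sumz (nth [::] roots2 a))%:~R :> R.
    by rewrite sumzE sa rmorph_sum.
  rewrite zE intrM (_ : 2 * 2 = 4%:~R :> R); last by ring.
  by rewrite mulfK // pnatr_eq0.
- under eq_bigr => i _ do rewrite expr_div_n.
  rewrite -mulr_suml.
  have -> : \sum_(i < 8) ((nth [::] roots2 a)`_i)%:~R ^+ 2 = 8%:~R :> R.
    rewrite -(roots2_norm (mem_root a)) sumzE size_map sa rmorph_sum /=.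
    by apply: eq_bigr => i _; rewrite (nth_map 0) ?sa // rmorphM expr2.
  by apply: (mulIf (_ : 4 != 0 :> R)); rewrite ?pnatr_eq0 //; field.
Qed.

Let adm (k : 'I_248) : 'M[C]_248 := map_mx (real_complex R) (ad br (delta_mx k 0)).

Lemma br_sumr X (I : Type) (r : seq I) (c : I -> R) (Y : I -> 'cV[R]_248) :
  br X (\sum_(i <- r) c i *: Y i) = \sum_(i <- r) c i *: br X (Y i).
Proof.
have [_ lr _ _] := e8_lie e8.
elim: r => [|i r ih]; last by rewrite !big_cons lr ih.
rewrite !big_nil; have := lr 1 0 0 X; rewrite scaler0 addr0 scale1r => /eqP.
by rewrite -subr_eq0 opprD addrA subrr sub0r oppr_eq0 => /eqP.
Qed.

Lemma br_suml X (I : Type) (r : seq I) (c : I -> R) (Y : I -> 'cV[R]_248) :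
  br (\sum_(i <- r) c i *: Y i) X = \sum_(i <- r) c i *: br (Y i) X.
Proof.
have [ll _ _ _] := e8_lie e8.
elim: r => [|i r ih]; last by rewrite !big_cons ll ih.
rewrite !big_nil; have := ll 1 0 0 X; rewrite scaler0 addr0 scale1r => /eqP.
by rewrite -subr_eq0 opprD addrA subrr sub0r oppr_eq0 => /eqP.
Qed.

Lemma br_anti X Y : br X Y = - br Y X.
Proof.
have [ll lr alt _] := e8_lie e8.
have := alt (1 *: X + Y); rewrite ll lr lr !alt scaler0 add0r addr0 !scale1r.
by move/eqP; rewrite addr_eq0 => /eqP.
Qed.

Lemma cV_sum (X : 'cV[R]_248) : X = \sum_k X k 0 *: delta_mx k 0.
Proof.
apply/colP => i; rewrite summxE (bigD1 i) //= big1 => [|k ki].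
  by rewrite !mxE !eqxx mulr1 addr0.
by rewrite !mxE eq_sym (negPf ki) mulr0.
Qed.

Lemma ad_mul X Y : ad br X *m Y = br X Y.
Proof.
rewrite [in RHS](cV_sum Y) br_sumr; apply/colP => i; rewrite mxE summxE.
by apply: eq_bigr => k _; rewrite !mxE mulrC.
Qed.

Lemma ad_sum X : ad br X = \sum_k X k 0 *: ad br (delta_mx k 0).
Proof.
apply/matrixP => i j; rewrite mxE [in LHS](cV_sum X) br_suml !summxE.
by apply: eq_bigr => k _; rewrite !mxE.
Qed.

Lemma ad_br X Y : ad br (br X Y) = ad br X *m ad br Y - ad br Y *m ad br X.
Proof.
have [_ _ _ jac] := e8_lie e8.
have ext (A B : 'M[R]_248) : (forall Z : 'cV_248, A *m Z = B *m Z) -> A = B.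
  move=> h; apply/matrixP => i j; have := h (delta_mx j 0).
  by rewrite -!colE => /colP/(_ i); rewrite !mxE.
apply: ext => Z; rewrite mulmxBl -!mulmxA !ad_mul.
have e : br Y (br X Z) = - br Y (br Z X).
  by rewrite [br X Z]br_anti -ad_mul mulmxN ad_mul.
rewrite [LHS]br_anti e opprK.
by have /eqP := jac X Y Z; rewrite addr_eq0 => /eqP ->.
Qed.

Lemma adm_anti k j i : adm k i j = - adm j i k.
Proof. by rewrite !mxE br_anti mxE rmorphN. Qed.

Lemma adm_jacobi k m :
  adm k *m adm m - adm m *m adm k = \sum_l adm k l m *: adm l.
Proof.
rewrite /adm -!map_mxM -map_mxB -ad_br ad_sum map_mx_sum; apply: eq_bigr => l _.
by rewrite map_mxZ; congr (_ *: _); rewrite !mxE.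
Qed.

Let H : 'M[C]_(248, 8) := \matrix_(k, i) (e8_cartan e8 i k 0)%:C.

Let ad_colE i : \sum_k H k i *: adm k = map_mx (real_complex R) (ad br (e8_cartan e8 i)).
Proof.
rewrite ad_sum map_mx_sum; apply: eq_bigr => k _.
by rewrite map_mxZ mxE.
Qed.

Let lam : 'M[C]_(8, 240) := \matrix_(i, a) ('i * (root_coord a i)%:C).

(** By definition of the compact form, each root has a root vector; the list
    of roots selects one for each. *)
Lemma root_vectors : exists V : 'M[C]_(248, 240), (forall a, col a V != 0) /\
  forall i, (\sum_k H k i *: adm k) *m V = V *m diag_mx (row i lam).
Proof.
have /choice[v hv] : forall a, exists v : 'cV[C]_248, v != 0 /\
    forall i, map_mx (real_complex R) (ad br (e8_cartan e8 i)) *m v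
              = ('i * (root_coord a i)%:C) *: v.
  by move=> a; have [v v0 hv] := e8_roots e8 (root_coordP a); exists v.
pose V := \matrix_(k, a) v a k 0.
have colV a : col a V = v a by apply/colP => k; rewrite !mxE.
exists V; split=> [a|i]; first by rewrite colV; case: (hv a).
rewrite ad_colE; apply/matrixP => k a.
transitivity ((map_mx (real_complex R) (ad br (e8_cartan e8 i)) *m v a) k 0).
  by rewrite !mxE; apply: eq_bigr => l _; rewrite [V _ _]mxE.
by rewrite (hv a).2 mul_mx_diag !mxE mulrC.
Qed.

Lemma cartan_commute i : (\sum_k H k i *: adm k) *m H = 0.
Proof.
rewrite ad_colE; have -> : H = map_mx (real_complex R) (\matrix_(k, j) e8_cartan e8 j k 0).
  by apply/matrixP => k j; rewrite !mxE.
rewrite -map_mxM; apply/matrixP => k j; rewrite [LHS]mxE [RHS]mxE.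
have -> : (ad br (e8_cartan e8 i) *m \matrix_(k, j) e8_cartan e8 j k 0) k j
    = br (e8_cartan e8 i) (e8_cartan e8 j) k 0.
  by rewrite -ad_mul [LHS]mxE [RHS]mxE; apply: eq_bigr => l _; rewrite [X in _ * X]mxE.
by rewrite e8_cartan_comm mxE.
Qed.

Let J : C := 'i / 2.

Let J_neq0 : J != 0.
Proof.
by rewrite mulf_neq0 ?invr_neq0 ?pnatr_eq0 // eq_complex /= oner_eq0 andbF.
Qed.

Lemma lamE i a : lam i a = J * ((nth [::] roots2 a)`_i)%:~R.
Proof.
rewrite mxE /root_coord /J rmorphM rmorph_int fmorphV rmorph_nat.
by rewrite mulrCA mulrC.
Qed.

Let nth_neq (a b : 'I_240) : a != b -> exists i : 'I_8,
  (nth [::] roots2 a)`_i != (nth [::] roots2 b)`_i.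
Proof.
move=> ab; apply/existsP; apply: contraNT ab; rewrite negb_exists => /forallP h.
apply/eqP/val_inj/eqP; rewrite -(nth_uniq [::] _ _ uniq_roots2) ?size_roots2 ?ltn_ord //.
apply/eqP; apply: (@eq_from_nth _ 0).
  by rewrite !(roots2_size (mem_root _)).
move=> i; rewrite (roots2_size (mem_root _)) => i8.
by have := h (Ordinal i8); rewrite negbK => /eqP.
Qed.

Let rho_c : 'cV[C]_8 := \col_i (rho`_i)%:~R.

Lemma rho_regular a : (rho_c^T *m lam) 0 a != 0.
Proof.
have -> : (rho_c^T *m lam) 0 a = J * (sumz [seq p.1 * p.2 | p <- zip rho (nth [::] roots2 a)])%:~R.
  rewrite sumzE size_map size_zip (roots2_size (mem_root a)) rmorph_sum mxE mulr_sumr.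
  apply: eq_bigr => i _; rewrite lamE !mxE (nth_map (0, 0)) ?nth_zip /=.
  - by rewrite rmorphM mulrCA.
  - by rewrite (roots2_size (mem_root a)).
  - by rewrite size_zip (roots2_size (mem_root a)).
by rewrite mulf_neq0 // intr_eq0 roots2_rho // mem_root.
Qed.

Lemma lam_neq0 a : exists i, lam i a != 0.
Proof.
have := rho_regular a; rewrite mxE => h.
apply/existsP; apply: contraNT h; rewrite negb_exists => /forallP h.
by apply/eqP/big1 => i _; have := h i; rewrite negbK => /eqP ->; rewrite mulr0.
Qed.

Lemma lam_inj a b : (forall i, lam i a = lam i b) -> a = b.
Proof.
move=> h; have [//|ab] := eqVneq a b; have [i /eqP] := nth_neq ab; case.
by have := h i; rewrite !lamE => /(mulfI J_neq0)/intr_inj.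
Qed.

Lemma lam_free (c : 'rV[C]_8) : c *m lam = 0 -> c = 0.
Proof.
move=> hc; apply/rowP => j; rewrite [RHS]mxE.
have frame i : \sum_a lam i a * lam j a = J ^+ 2 * (if i == j then 240 else 0).
  have := roots2_frame (ltn_ord i) (ltn_ord j).
  rewrite sumzE size_map size_roots2 => h.
  have -> : (if i == j then 240 else 0) = (if val i == val j then 240 else 0)%:~R :> C.
    by rewrite -val_eqE; case: ifP.
  rewrite -h rmorph_sum mulr_sumr; apply: eq_bigr => a _.
  by rewrite (nth_map [::]) ?size_roots2 // !lamE rmorphM expr2 mulrACA.
have : \sum_a (c *m lam) 0 a * lam j a = c 0 j * (J ^+ 2 * 240).
  under eq_bigr => a _ do rewrite mxE mulr_suml.
  rewrite exchange_big /=.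
  have inner i : \sum_a c 0 i * lam i a * lam j a
      = c 0 i * (J ^+ 2 * (if i == j then 240 else 0)).
    by rewrite -frame mulr_sumr; apply: eq_bigr => a _; rewrite mulrA.
  rewrite (bigD1 j) //= inner eqxx big1 ?addr0 // => i /negPf ij.
  by rewrite inner ij !mulr0.
rewrite hc big1 => [|a _]; last by rewrite mxE mul0r.
have nz : J ^+ 2 * 240 != 0 by rewrite mulf_neq0 ?expf_neq0 ?pnatr_eq0.
by move/esym/eqP; rewrite mulf_eq0 (negPf nz) orbF => /eqP.
Qed.

(** E8 has no independent invariants of degree 4 and 6, and none of odd
    degree. For an E8-valued two-form [x], shift [x] by a constant regular
    element: the sum is conjugate into the Cartan subalgebra, where the
    relations are those between the power sums of the roots. Their components
    of highest degree are the relations for [x] itself. *)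
Theorem e8_traces (x : 'cV[form]_248) : (forall k, homog 2 (x k 0)) ->
  let T k := \tr (adK adm x ^+ k) in
  [/\ T 1%N = 0, T 3%N = 0, T 5%N = 0,
      100 * T 4%N = T 2%N ^+ 2 & 7200 * T 6%N = T 2%N ^+ 3].
Proof.
move=> x2 T; have [V [V0 hV]] := root_vectors.
have [B [hB1 hB2]] := weight_basis (erefl : (8 + 240)%N = 248%N)
  cartan_commute hV V0 lam_neq0 lam_inj lam_free.
have x_ord : mx_ord 1 x.
  by move=> k j; rewrite (ord1 j); apply: (ord_geW (m := 2)) => //; apply/homog_ord.
have [c hc] := cartan_spectrum adm_anti adm_jacobi hB1 hB2 cartan_commute hV
  rho_regular x_ord.
pose X : seq form := [seq c i 0 | i <- enum 'I_8].
have X8 : size X = 8%N by rewrite size_map size_enum_ord.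
have LamE a : (c^T *m map_mx cst lam) 0 a = cst J * lin (nth [::] roots2 a) X.
  rewrite linE ?X8 ?(roots2_size (mem_root a)) // mxE mulr_sumr.
  apply: eq_bigr => i _; rewrite [c^T _ _]mxE [map_mx _ _ _ _]mxE lamE.
  rewrite rmorphM rmorph_int /= (nth_map i) ?size_enum_ord // nth_ord_enum.
  by rewrite mulrCA -[c i 0 *~ _]mulrzr.
have momE k : \sum_a ((c^T *m map_mx cst lam) 0 a) ^+ k = cst J ^+ k * moment k X.
  rewrite momentE mulr_sumr; apply: eq_bigr => a _.
  by rewrite LamE exprMn.
pose A0 := adK adm (map_mx cst (H *m rho_c)); pose A1 := adK adm x.
have A0_homog i j : homog 0 (A0 i j).
  rewrite /A0 adKE; apply: homog_sum => k _; rewrite mxE -rmorphM.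
  exact: homog_cst.
have A1_homog i j : homog 2 (A1 i j).
  rewrite /A1 adKE; apply: homog_sum => k _; rewrite mulrC.
  exact/homog_cstM/x2.
pose S k := \tr ((A0 + A1) ^+ k).
have SE k : S k.+1 = cst J ^+ k.+1 * moment k.+1 X.
  by rewrite /S /A0 /A1 -adKD hc momE.
have S_top k : hcomp (k * 2) (S k) = T k := (trace_pow_top k A0_homog A1_homog).2.
have S_deg k : deg_le (k * 2) (S k) := (trace_pow_top k A0_homog A1_homog).1.
have [m1 m3 m5 m4 m6] := moments X8.
split.
- by rewrite -S_top SE m1 mulr0 raddf0.
- by rewrite -S_top SE m3 mulr0 raddf0.
- by rewrite -S_top SE m5 mulr0 raddf0.
- have : 100 * S 4%N = S 2%N ^+ 2.
    by rewrite !SE; apply: (scale_relation (cst J) 2 m4).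
  move/(congr1 (hcomp (4 * 2))).
  rewrite [in RHS]expr2 (hcompM_top (S_deg 2) (S_deg 2)) (S_top 2).
  by rewrite -(rmorph_nat cst) (homog_hcompM _ _ (homog_cst _)) (S_top 4).
- have : 7200 * S 6%N = S 2%N ^+ 3.
    by rewrite !SE; apply: (scale_relation (cst J) 2 m6).
  move/(congr1 (hcomp (6 * 2))).
  rewrite [in RHS]exprS [in RHS]expr2.
  rewrite (hcompM_top (S_deg 2) (deg_leM (S_deg 2) (S_deg 2))).
  rewrite (hcompM_top (S_deg 2) (S_deg 2)) (S_top 2).
  by rewrite -(rmorph_nat cst) (homog_hcompM _ _ (homog_cst _)) (S_top 6).
Qed.

End E8.

(** * The exterior square of an endomorphism *)

Section TensorTrace.
Variables (K : comNzRingType) (m n : nat).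

Lemma big_tens (V : nmodType) (F : 'I_(m * n) -> V) :
  \sum_i F i = \sum_a \sum_b F (mxtens_index (a, b)).
Proof.
rewrite pair_bigA /= (reindex (@mxtens_index m n)) /=; first by apply: eq_bigr => -[].
by exists (@mxtens_unindex m n) => p _; rewrite ?mxtens_indexK ?mxtens_unindexK.
Qed.

Lemma trace_tens (A : 'M[K]_m) (B : 'M[K]_n) : \tr (A *t B) = \tr A * \tr B.
Proof.
rewrite /mxtrace big_tens mulr_suml; apply: eq_bigr => a _.
by rewrite mulr_sumr; apply: eq_bigr => b _; rewrite tensmxE.
Qed.

Lemma tens1mx : (1%:M : 'M[K]_m) *t (1%:M : 'M[K]_n) = 1%:M.
Proof.
apply/matrixP => i j; case: (mxtens_indexP i) => a b {i}.
case: (mxtens_indexP j) => c d {j}; rewrite tensmxE !mxE -natrM mulnb.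
by rewrite (inj_eq (can_inj (@mxtens_indexK m n))) xpair_eqE.
Qed.

Lemma tensl_exp l (A : 'M[K]_m) :
  (A *t (1%:M : 'M[K]_n)) ^+ l = (A ^+ l) *t 1%:M.
Proof.
elim: l => [|l ih]; first by rewrite !expr0 tens1mx.
by rewrite !exprS ih -!mulmxE tensmx_mul mul1mx.
Qed.

Lemma tensr_exp l (B : 'M[K]_n) :
  ((1%:M : 'M[K]_m) *t B) ^+ l = 1%:M *t (B ^+ l).
Proof.
elim: l => [|l ih]; first by rewrite !expr0 tens1mx.
by rewrite !exprS ih -!mulmxE tensmx_mul mul1mx.
Qed.

End TensorTrace.

Section ExteriorSquare.
Variables (R : realType) (n r : nat).
Local Notation form := (evenform R[i] n).
Variable X : 'M[form]_r.
Local Notation D := (mx_wedge 2 X).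
Implicit Types (a b c d : 'I_r) (S T : {set 'I_r}).

(** The derivation of the tensor square extending [X]. *)
Definition tens_sum : 'M[form]_(r * r) := X *t 1%:M + 1%:M *t X.

(** Coefficient of the tensor of [e_a] and [e_b] in the antisymmetric tensor
    that represents the exterior product of [e_s] and [e_t], for [S = {s <
    t}]. *)
Definition antisym a b S : form :=
  if (a != b) && (S == [set a; b]) then (-1) ^+ (b < a)%N else 0.

Definition antisym_mx : 'M[form]_(r * r, #|ksubsets r 2|) :=
  \matrix_(i, p) antisym (mxtens_unindex i).1 (mxtens_unindex i).2 (enum_val p).

Definition swap_mx : 'M[form]_(r * r) :=
  \matrix_(i, j) (((mxtens_unindex i).1 == (mxtens_unindex j).2)%:R *
                  ((mxtens_unindex i).2 == (mxtens_unindex j).1)%:R).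

Local Notation J := antisym_mx.

Lemma trace_tens_swap (A B : 'M[form]_r) : \tr (A *t B *m swap_mx) = \tr (A *m B).
Proof.
rewrite /mxtrace big_tens; apply: eq_bigr => a _; rewrite mxE.
apply: eq_bigr => b _; rewrite mxE big_tens (bigD1 b) //= [X in _ + X]big1 => [|c cb].
  rewrite addr0 (bigD1 a) //= [X in _ + X]big1 => [|d da].
    by rewrite tensmxE !mxE !mxtens_indexK /= !eqxx !mulr1 addr0.
  by rewrite [swap_mx _ _]mxE !mxtens_indexK /= (negPf da) !(mul0r, mulr0).
rewrite big1 // => d _.
by rewrite [swap_mx _ _]mxE !mxtens_indexK /= (negPf cb) !(mul0r, mulr0).
Qed.

Lemma antisymC a b S : antisym a b S = - antisym b a S.
Proof.
rewrite /antisym eq_sym setUC; case: ifP; rewrite ?oppr0 // => /andP[ba _].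
by case: ltngtP ba => [| |/val_inj ->]; rewrite ?eqxx ?expr0 ?expr1 ?opprK.
Qed.

Lemma set2_eq a b c d : c != d ->
  (a != b) && ([set c; d] == [set a; b])
  = ((a == c) && (b == d)) || ((a == d) && (b == c)).
Proof.
move=> cd; apply/andP/orP => [[ab /eqP/setP E]|].
  have := E a; have := E b; have := E c; have := E d.
  rewrite !inE !eqxx ?orbT /= => _ _ Eb Ea.
  case/orP: Ea => /eqP ea; subst a.
    left; rewrite eqxx; case/orP: Eb => /eqP eb; subst b; last exact: eqxx.
    by rewrite eqxx in ab.
  right; rewrite eqxx; case/orP: Eb => /eqP eb; subst b; first exact: eqxx.
  by rewrite eqxx in ab.
case=> /andP[/eqP -> /eqP ->]; first by [].
by rewrite eq_sym cd setUC eqxx.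
Qed.

Lemma antisym_remove T b t :
  ((t \in T) && ([set b] == T :\ t)) = ((t != b) && (T == [set t; b])).
Proof.
apply/andP/andP => [[tT /eqP bT]|[tb /eqP ->]].
  split; last by rewrite bT setD1K.
  by have := set11 b; rewrite bT !inE eq_sym => /andP[].
rewrite !inE eqxx; split=> //; apply/eqP/setP => u; rewrite !inE.
case: (eqVneq u t) => [->|]; first by rewrite (negPf tb).
by [].
Qed.

Lemma sum_below2 a b : a != b -> (\sum_(u in [set a; b]) (u < a) = (b < a))%N.
Proof.
move=> ab; rewrite big_setU1 ?inE //= big_set1 ltnn add0n; by [].
Qed.

(** The signs in the exterior square: removing [a] from [{a, b}] leaves [b],
    so the two sums over [s] are the two summands of the derivation on the
    tensor square. *)
Lemma wedge2_entry a b T : a != b ->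
  (-1) ^+ (b < a)%N * (\sum_(s in [set a; b]) \sum_(t in T | ([set a; b] :\ s == T :\ t))
     (-1) ^+ (\sum_(u in [set a; b]) (u < s) + \sum_(u in T) (u < t))%N * X s t)
  = \sum_c X a c * antisym c b T + \sum_c X b c * antisym a c T.
Proof.
move=> ab; rewrite big_setU1 ?inE //= big_set1 mulrDr.
have rem1 : [set a; b] :\ a = [set b].
  by apply/setP => u; rewrite !inE; case: (eqVneq u a) => [->|] //=; rewrite (negPf ab).
have rem2 : [set a; b] :\ b = [set a].
  apply/setP => u; rewrite !inE; case: (eqVneq u b) => [->|] //=; last by rewrite orbF.
  by rewrite eq_sym (negPf ab).
rewrite rem1 rem2 !mulr_sumr; congr (_ + _).
  rewrite (eq_bigl (fun t => (t != b) && (T == [set t; b]))) => [|t]; last first.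
    exact: antisym_remove.
  rewrite big_mkcond; apply: eq_bigr => t _; rewrite /antisym.
  case: ifP => [/andP[tb /eqP TE]|_]; last by rewrite mulr0.
  rewrite (sum_below2 ab) TE (sum_below2 tb) exprD !mulrA -expr2 -exprM.
  by rewrite mulnC exprM sqrrN !expr1n mul1r mulrC.
rewrite (eq_bigl (fun t => (t != a) && (T == [set t; a]))) => [|t]; last first.
  exact: antisym_remove.
rewrite big_mkcond; apply: eq_bigr => t _; rewrite antisymC /antisym.
case: ifP => [/andP[ta /eqP TE]|_]; last by rewrite oppr0 mulr0.
have -> : (\sum_(u in [set a; b]) (u < b) = (a < b))%N.
  by rewrite setUC sum_below2 // eq_sym.
rewrite TE (sum_below2 ta) exprD !mulrA -exprD [X in X * _ * _ = _](_ : _ = -1).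
  by rewrite mulN1r mulNr mulrN mulrC.
by case: ltngtP ab => [| |/val_inj ->]; rewrite ?eqxx.
Qed.

(** The antisymmetric tensors are stable under the derivation, which restricts
    there to the one of the exterior square. *)
Lemma wedge2_intertwine : tens_sum *m J = J *m D.
Proof.
apply/matrixP => i q; case: (mxtens_indexP i) => a b {i}.
have -> : (tens_sum *m J) (mxtens_index (a, b)) q =
    \sum_c X a c * antisym c b (enum_val q) + \sum_c X b c * antisym a c (enum_val q).
  rewrite mulmxDl mxE; congr (_ + _); rewrite mxE big_tens.
    apply: eq_bigr => c _; rewrite (bigD1 b) //= big1 => [|d db].
      by rewrite tensmxE [J _ _]mxE mxtens_indexK !mxE eqxx mulr1 addr0.
    by rewrite tensmxE [1%:M _ _]mxE eq_sym (negPf db) mulr0 mul0r.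
  rewrite (bigD1 a) //= [X in _ + X]big1 => [|d da].
    rewrite addr0; apply: eq_bigr => c _.
    by rewrite tensmxE [J _ _]mxE mxtens_indexK !mxE eqxx mul1r.
  rewrite big1 // => c _.
  by rewrite tensmxE [1%:M _ _]mxE eq_sym (negPf da) !mul0r.
rewrite mxE; have [ab|ab] := eqVneq a b.
  rewrite [RHS]big1 => [|p _]; last first.
    by rewrite [J _ _]mxE mxtens_indexK /antisym /= ab eqxx mul0r.
  rewrite -big_split big1 //= => c _; rewrite ab antisymC.
  by rewrite mulrN addNr.
have abk : [set a; b] \in ksubsets r 2 by rewrite inE cards2 ab.
rewrite [RHS](bigD1 (enum_rank_in abk [set a; b])) //= [X in _ = _ + X]big1 ?addr0 => [|p pab]; last first.
  rewrite [J _ _]mxE mxtens_indexK /antisym /= ab /= ifN ?mul0r //.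
  by apply: contra pab => /eqP pE; rewrite -(inj_eq enum_val_inj) enum_rankK_in // pE.
rewrite [J _ _]mxE mxtens_indexK /antisym /= ab enum_rankK_in // eqxx /=.
by rewrite mxE enum_rankK_in // wedge2_entry.
Qed.

Lemma antisym_norm : J^T *m J = (2 : form)%:M.
Proof.
apply/matrixP => p q; rewrite mxE big_tens [RHS]mxE.
have cardp (t : 'I_#|ksubsets r 2|) : #|(enum_val t : {set 'I_r})| == 2%N.
  by have := enum_valP t; rewrite inE.
have /cards2P[c [d [cd pE]]] := cardp p.
have [<-|pq] := eqVneq p q; last first.
  rewrite mulr0n big1 // => a _; rewrite big1 // => b _.
  rewrite !mxE mxtens_indexK /antisym /=; case: ifP => [/andP[_ /eqP ep]|_]; last first.
    by rewrite mul0r.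
  case: ifP => [/andP[_ /eqP eq]|_]; last by rewrite mulr0.
  by move: pq; rewrite -(inj_eq enum_val_inj) ep eq eqxx.
rewrite mulr1n.
transitivity (\sum_a \sum_b (if ((a == c) && (b == d)) || ((a == d) && (b == c)) then 1 else 0 : form)).
  apply: eq_bigr => a _; apply: eq_bigr => b _.
  rewrite !mxE mxtens_indexK /antisym /= pE set2_eq //; case: ifP; rewrite ?mulr0 //.
  by rewrite -expr2 sqrr_sign.
rewrite pair_bigA -big_mkcond /= sumr_const.
rewrite (_ : #|_| = #|[set (c, d); (d, c)]|).
  by rewrite cards2 xpair_eqE (negPf cd).
by apply: eq_card => -[a b]; rewrite !inE !xpair_eqE.
Qed.

Lemma antisym_proj : J *m J^T = 1%:M - swap_mx.
Proof.
apply/matrixP => i j; case: (mxtens_indexP i) => a b {i}.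
case: (mxtens_indexP j) => c d {j}; rewrite mxE.
have -> : (1%:M - swap_mx) (mxtens_index (a, b)) (mxtens_index (c, d))
    = ((a == c) && (b == d))%:R - ((a == d) && (b == c))%:R.
  rewrite !mxE !mxtens_indexK /= -natrM mulnb.
  by rewrite (inj_eq (can_inj (@mxtens_indexK r r))) xpair_eqE.
have [ab|ab] := eqVneq a b.
  rewrite big1 => [|p _]; last by rewrite [J _ _]mxE mxtens_indexK /antisym /= ab eqxx mul0r.
  by rewrite -ab [(a == c) && _]andbC subrr.
have abk : [set a; b] \in ksubsets r 2 by rewrite inE cards2 ab.
rewrite (bigD1 (enum_rank_in abk [set a; b])) //= big1 ?addr0 => [|p pab]; last first.
  rewrite [J _ _]mxE mxtens_indexK /antisym /= ab /= ifN ?mul0r //.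
  by apply: contra pab => /eqP pE; rewrite -(inj_eq enum_val_inj) enum_rankK_in // pE.
rewrite !mxE !mxtens_indexK enum_rankK_in //= /antisym ab eqxx /= set2_eq //.
rewrite ![c == _]eq_sym ![d == _]eq_sym.
have [ac|_] := eqVneq a c.
  have [bd|_] := eqVneq b d; first subst c d.
    by rewrite (negPf ab) /= subr0 -expr2 sqrr_sign.
  subst c; rewrite [b == a]eq_sym (negPf ab) !andbF /= mulr0 subrr.
  by [].
have [bc|_] := eqVneq b c; last by rewrite !andbF /= mulr0 subrr.
have [ad|_] := eqVneq a d; last by rewrite /= mulr0 subrr.
subst c d; rewrite /= sub0r -exprD.
by case: ltngtP ab => [| |/val_inj ->]; rewrite ?eqxx.
Qed.

(** With [Y] the derivation on the tensor square, [J] the inclusion of the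
    exterior square and [J^T J = 2], [J J^T = 1 - swap], [2 tr (D^k) = tr (J^T
    J D^k) = tr (Y^k J J^T) = tr (Y^k) - tr (Y^k swap)]; the two traces are
    computed from the binomial expansion of [Y^k]. *)
Lemma trace_wedge2 k :
  2 * \tr (D ^+ k) = \sum_(j < k.+1) \tr (X ^+ (k - j)) * \tr (X ^+ j) *+ 'C(k, j)
    - \tr (X ^+ k) *+ 2 ^ k.
Proof.
have YJ l : tens_sum ^+ l *m J = J *m D ^+ l.
  elim: l => [|l ih]; first by rewrite !expr0 mul1mx mulmx1.
  by rewrite exprSr -mulmxE -mulmxA wedge2_intertwine mulmxA ih -mulmxA exprSr.
have -> : 2 * \tr (D ^+ k) = \tr (tens_sum ^+ k *m (1%:M - swap_mx)).
  rewrite -antisym_proj mulmxA YJ -mulmxA mxtrace_mulC -mulmxA antisym_norm.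
  by rewrite mul_mx_scalar mxtraceZ.
have comm : GRing.comm (X *t (1%:M : 'M[form]_r)) ((1%:M : 'M[form]_r) *t X).
  by rewrite /GRing.comm -!mulmxE !tensmx_mul !mul1mx !mulmx1.
have -> : tens_sum ^+ k = \sum_(j < k.+1) (X ^+ (k - j) *t X ^+ j) *+ 'C(k, j).
  rewrite /tens_sum exprDn_comm //; apply: eq_bigr => j _.
  by rewrite tensl_exp tensr_exp -mulmxE tensmx_mul mul1mx mulmx1.
rewrite mulmxBr mulmx1 mulmx_suml [LHS]raddfB /= [X in X - _]raddf_sum [X in _ - X]raddf_sum /=; congr (_ - _).
  by apply: eq_bigr => j _; rewrite raddfMn /= trace_tens.
transitivity (\sum_(j < k.+1) \tr (X ^+ k) *+ 'C(k, j)).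
  apply: eq_bigr => j _; rewrite -scaler_nat -scalemxAl mxtraceZ trace_tens_swap.
  have jk : (j <= k)%N by rewrite -ltnS.
  by rewrite mulmxE -exprD subnK // mulr_natl.
rewrite sumrMnr; congr (_ *+ _).
have := Pascal 1 1 k; rewrite addn1 => ->; apply: eq_bigr => j _.
by rewrite !exp1n !muln1.
Qed.

End ExteriorSquare.

(** * Chern characters of virtual bundles *)

Section ChernCharacter.
Local Open Scope complex_scope.
Variables (R : realType) (n : nat).
Local Notation form := (evenform R[i] n).
Local Notation cst := (cst_form n).
Implicit Types (E F : lbundle R n) (U V : virt R n).

Lemma scalemx_exp r (a : form) (X : 'M[form]_r) k : (a *: X) ^+ k = a ^+ k *: X ^+ k.
Proof.
elim: k => [|k ih]; first by rewrite !expr0 scale1r.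
by rewrite !exprS ih -!mulmxE -scalemxAl -scalemxAr scalerA.
Qed.

(** The Chern character depends on a bundle only through these traces, which
    makes it insensitive to the frame. *)
Definition power_trace E k : form := \tr (curv E ^+ k).

Let c : R[i] := 'i / (2 * (pi : R)%:C).

Lemma chE E : ch E = \sum_(k < n.+1) cst (k`!)%:R^-1 * cst c ^+ k * power_trace E k.
Proof.
rewrite /ch /mx_exp raddf_sum; apply: eq_bigr => k _ /=.
by rewrite mxtraceZ scalemx_exp mxtraceZ mulrA.
Qed.

Lemma eq_ch E F : (forall k, power_trace E k = power_trace F k) -> ch E = ch F.
Proof. by move=> EF; rewrite !chE; apply: eq_bigr => k _; rewrite EF. Qed.

Lemma power_trace0 E : power_trace E 0 = (rk E)%:R.
Proof. by rewrite /power_trace expr0 mxtrace1. Qed.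

Lemma power_trace_bsum E F k :
  power_trace (bsum E F) k = power_trace E k + power_trace F k.
Proof.
rewrite /power_trace /=; have -> : block_mx (curv E) 0 0 (curv F) ^+ k
    = block_mx (curv E ^+ k) 0 0 (curv F ^+ k).
  elim: k => [|k ih]; first by rewrite !expr0 [1]scalar_mx_block.
  by rewrite !exprS ih -!mulmxE mulmx_block !(mulmx0, mul0mx) !(addr0, add0r).
by rewrite mxtrace_block.
Qed.

Lemma ch_bsum E F : ch (bsum E F) = ch E + ch F.
Proof.
rewrite !chE -big_split; apply: eq_bigr => k _ /=.
by rewrite power_trace_bsum mulrDr.
Qed.

(** In the exterior powers of the reduced tangent bundle, all bundles on the
    subtracted side are trivial. Multiplicativity of the Chern character is
    needed for such factors only. *)
Definition flat E := curv E = 0.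

Lemma flat_power_trace E k : flat E -> power_trace E k.+1 = 0.
Proof. by move=> E0; rewrite /power_trace E0 exprS mul0r mxtrace0. Qed.

Lemma ch_flat E : flat E -> ch E = (rk E)%:R.
Proof.
move=> E0; rewrite chE big_ord_recl big1 => [|k _]; last first.
  by rewrite flat_power_trace ?mulr0.
by rewrite fact0 invr1 rmorph1 expr0 !mul1r addr0 power_trace0.
Qed.

Lemma flat_bsum E F : flat E -> flat F -> flat (bsum E F).
Proof. by rewrite /flat /= => -> ->; rewrite block_mx0. Qed.

Lemma flat_btens E F : flat E -> flat F -> flat (btens E F).
Proof. by rewrite /flat /= => -> ->; rewrite tens0mx tensmx0 addr0. Qed.

Lemma flat_bwedge k E : flat E -> flat (bwedge k E).
Proof.
rewrite /flat /= => ->; apply/matrixP => p q; rewrite mxE [RHS]mxE /=.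
by rewrite big1 // => s _; rewrite big1 // => t _; rewrite mxE mulr0.
Qed.

Lemma ch_btens_flat E F : flat F -> ch (btens E F) = ch E * (rk F)%:R.
Proof.
move=> F0; rewrite !chE mulr_suml; apply: eq_bigr => k _.
rewrite -[RHS]mulrA; congr (_ * _).
rewrite /power_trace /btens /=. have -> : curv E *t 1%:M + 1%:M *t curv F = curv E *t (1%:M : 'M_(rk F)).
  by move: F0; rewrite /flat => ->; rewrite tensmx0 addr0.
by rewrite tensl_exp trace_tens mxtrace1.
Qed.

Lemma power_trace_wedge0 E k : power_trace (bwedge 0 E) k = power_trace (btriv R n 1) k.
Proof.
have W0 : flat (bwedge 0 E).
  rewrite /flat /=; apply/matrixP => p q; rewrite mxE [RHS]mxE /=.
  have := enum_valP p; rewrite inE cards_eq0 => /eqP ->.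
  by rewrite big_set0.
case: k => [|k]; last by rewrite !flat_power_trace.
by rewrite !power_trace0 /= card_draws bin0.
Qed.

(** The first exterior power is the bundle itself, in the frame indexed by
    singletons. *)
Lemma power_trace_wedge1 E k : power_trace (bwedge 1 E) k = power_trace E k.
Proof.
rewrite /power_trace /=; set X := curv E; set D := mx_wedge 1 X.
pose J : 'M[form]_(rk E, #|ksubsets (rk E) 1|) := \matrix_(a, p) (enum_val p == [set a])%:R.
have in1 (a : 'I_(rk E)) : [set a] \in ksubsets (rk E) 1 by rewrite inE cards1.
have Jsum q (F : 'I_(rk E) -> form) : \sum_a F a * J a q =
    \sum_(a in (enum_val q : {set 'I_(rk E)})) F a.
  have := enum_valP q; rewrite inE => /cards1P[b qb]; rewrite qb big_set1.
  rewrite (bigD1 b) //= big1 ?addr0 => [|a ab].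
    by rewrite mxE qb eqxx mulr1.
  by rewrite mxE qb (inj_eq set1_inj) eq_sym (negPf ab) mulr0.
have Jsum' a (F : 'I_#|ksubsets (rk E) 1| -> form) :
    \sum_p J a p * F p = F (enum_rank_in (in1 a) [set a]).
  rewrite (bigD1 (enum_rank_in (in1 a) [set a])) //= big1 ?addr0 => [|p pa].
    by rewrite mxE enum_rankK_in // eqxx mul1r.
  rewrite mxE (_ : _ == _ = false) ?mul0r //.
  by apply: contraNF pa => /eqP pE; rewrite -(inj_eq enum_val_inj) enum_rankK_in // pE.
have XJ : X *m J = J *m D.
  apply/matrixP => a q; rewrite mxE Jsum mxE Jsum' mxE /=.
  rewrite enum_rankK_in // big_set1.
  have := enum_valP q; rewrite inE => /cards1P[b ->]; rewrite big_set1.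
  rewrite (big_pred1 b) => [|t]; last first.
    by rewrite !inE /=; case: eqVneq => //= ->; rewrite !setDv eqxx.
  by rewrite !big_set1 !ltnn expr0 mul1r.
have JJt : J *m J^T = 1%:M.
  apply/matrixP => a b; rewrite mxE (Jsum' a (fun p => J^T p b)) !mxE enum_rankK_in //.
  by rewrite (inj_eq set1_inj).
have JtJ : J^T *m J = 1%:M.
  apply/matrixP => p q; rewrite mxE (Jsum q (fun a => J^T p a)) [RHS]mxE.
  rewrite -(inj_eq enum_val_inj).
  have := enum_valP q; rewrite inE => /cards1P[b ->].
  by rewrite big_set1 !mxE.
have XkJ l : X ^+ l *m J = J *m D ^+ l.
  elim: l => [|l ih]; first by rewrite !expr0 mul1mx mulmx1.
  by rewrite exprSr -mulmxE -mulmxA XJ mulmxA ih -mulmxA exprSr.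
rewrite -[D ^+ k]mul1mx -JtJ -mulmxA -XkJ mxtrace_mulC -mulmxA JJt.
by rewrite mulmx1.
Qed.

Lemma ch_btriv r : ch (btriv R n r) = r%:R.
Proof. by rewrite ch_flat. Qed.

Lemma vch_of E : vch E = ch E.
Proof. by rewrite /vch /= ch_btriv subr0. Qed.

Lemma vchD U V : vch (vadd U V) = vch U + vch V.
Proof. by rewrite /vch /= !ch_bsum opprD addrACA. Qed.

Lemma vch_triv m : vch (vtriv m : virt R n) = m%:R.
Proof. by rewrite vch_of ch_btriv. Qed.

Lemma vch_muln m V : vch (vmuln m V) = m%:R * vch V.
Proof.
rewrite /vmuln; elim: m => [|m ih] /=; first by rewrite vch_triv mul0r.
by rewrite vchD ih -[in RHS]natr1 mulrDl mul1r addrC.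
Qed.

Lemma vch_sum m (G : 'I_m -> virt R n) :
  vch (\big[@vadd R n/vtriv 0]_(l < m) G l) = \sum_(l < m) vch (G l).
Proof. by apply: (big_morph _ vchD); rewrite vch_triv. Qed.

Lemma vch_reduced E : vch (vreduced E) = ch E - (rk E)%:R.
Proof. by rewrite /vreduced vchD vch_of /vch /= !ch_btriv sub0r. Qed.

Definition vflat V := flat (vpos V) /\ flat (vneg V).

Lemma vch_mul_flat U V : vflat V -> vch (vmul U V) = vch U * vch V.
Proof.
case=> Vp Vn; rewrite /vch /= !ch_bsum !ch_btens_flat // (ch_flat Vp) (ch_flat Vn).
have expand (K : comNzRingType) (x y p q : K) :
    x * p + y * q - (x * q + y * p) = (x - y) * (p - q) by ring.
exact: expand.
Qed.

Lemma vflatD U V : vflat U -> vflat V -> vflat (vadd U V).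
Proof. by case=> ? ? [? ?]; split; apply: flat_bsum. Qed.

Lemma vflatN V : vflat V -> vflat (vopp V).
Proof. by case. Qed.

Lemma vflatM U V : vflat U -> vflat V -> vflat (vmul U V).
Proof. by case=> ? ? [? ?]; split; apply: flat_bsum; apply: flat_btens. Qed.

Lemma vflat_sum m (G : 'I_m -> virt R n) : (forall l, vflat (G l)) ->
  vflat (\big[@vadd R n/vtriv 0]_(l < m) G l).
Proof. by move=> hG; apply: big_ind => //; apply: vflatD. Qed.

Definition sflat (a : vseries R n) := forall k, vflat (a k).

Lemma sflat_one : sflat (@vs_one R n). Proof. by case. Qed.

Lemma sflat_mul a b : sflat a -> sflat b -> sflat (vs_mul a b).
Proof. by move=> ha hb k; apply: vflat_sum => l; apply: vflatM. Qed.

Lemma sflat_sub a b : sflat a -> sflat b -> sflat (vs_sub a b).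
Proof. by move=> ha hb k; apply: vflatD => //; apply: vflatN. Qed.

Lemma sflat_iter a b l : sflat a -> sflat b -> sflat (iter l (vs_mul a) b).
Proof. by move=> ha hb; elim: l => //= l ih; apply: sflat_mul. Qed.

Lemma sflat_inv b : sflat b -> sflat (vs_inv b).
Proof.
move=> hb k; apply: vflat_sum => l; apply: sflat_iter; last exact: sflat_one.
by apply: sflat_sub => //; apply: sflat_one.
Qed.

Lemma vchN V : vch (vopp V) = - vch V.
Proof. by rewrite /vch opprB. Qed.

Lemma vch_series_mul a b k : sflat b ->
  vch (vs_mul a b k) = \sum_(l < k.+1) vch (a l) * vch (b (k - l)%N).
Proof.
by move=> hb; rewrite vch_sum; apply: eq_bigr => l _; rewrite vch_mul_flat.
Qed.

Lemma vch_series_mul0 a b : sflat b ->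
  vch (vs_mul a b 0) = vch (a 0%N) * vch (b 0%N).
Proof. by move=> hb; rewrite vch_series_mul // !big_ord_recr big_ord0 /= add0r. Qed.

Lemma vch_series_mul1 a b : sflat b ->
  vch (vs_mul a b 1) = vch (a 0%N) * vch (b 1%N) + vch (a 1%N) * vch (b 0%N).
Proof. by move=> hb; rewrite vch_series_mul // !big_ord_recr big_ord0 /= add0r. Qed.

Lemma vch_series_mul2 a b : sflat b ->
  vch (vs_mul a b 2) =
  vch (a 0%N) * vch (b 2%N) + vch (a 1%N) * vch (b 1%N) + vch (a 2%N) * vch (b 0%N).
Proof. by move=> hb; rewrite vch_series_mul // !big_ord_recr big_ord0 /= add0r. Qed.

(** The first terms of a geometric series. *)
Lemma vch_series_inv b : sflat b -> vch (b 0%N) = 1 ->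
  [/\ vch (vs_inv b 0) = 1, vch (vs_inv b 1) = - vch (b 1%N) &
      vch (vs_inv b 2) = vch (b 1%N) ^+ 2 - vch (b 2%N)].
Proof.
move=> hb b0; set d := vs_sub (vs_one R n) b.
have dE k : vch (d k) = vch (vs_one R n k) - vch (b k) by rewrite vchD vchN.
have d0 : vch (d 0%N) = 0 by rewrite dE vch_triv b0 subrr.
have d1 : vch (d 1%N) = - vch (b 1%N) by rewrite dE vch_triv sub0r.
have d2 : vch (d 2%N) = - vch (b 2%N) by rewrite dE vch_triv sub0r.
have fo := sflat_one; have fd : sflat d by apply: sflat_sub.
have fdo : sflat (vs_mul d (vs_one R n)) by apply: sflat_mul.
have o0 : vch (vs_one R n 0) = 1 by rewrite vch_triv.
have o1 k : vch (vs_one R n k.+1) = 0 by rewrite vch_triv.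
have inv_sum k : vch (vs_inv b k) = \sum_(l < k.+1) vch (iter l (vs_mul d) (vs_one R n) k).
  by rewrite vch_sum.
split; rewrite inv_sum !big_ord_recr big_ord0 /= add0r ?o0 ?o1 ?add0r //.
- by rewrite vch_series_mul1 // d0 d1 o0 mul0r add0r mulr1.
- rewrite !(vch_series_mul2, vch_series_mul1, vch_series_mul0) //.
  by rewrite d0 d1 d2 o0 !o1 !(mul0r, mulr0, mulr1, add0r, addr0) mulrNN addrC expr2.
Qed.

Lemma ch_wedge0 E : ch (bwedge 0 E) = 1.
Proof. by rewrite (eq_ch (power_trace_wedge0 E)) ch_btriv. Qed.

Lemma ch_wedge1 E : ch (bwedge 1 E) = ch E.
Proof. exact/eq_ch/power_trace_wedge1. Qed.

Lemma power_trace_bwedge2 E k : 2 * power_trace (bwedge 2 E) k =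
  \sum_(j < k.+1) power_trace E (k - j) * power_trace E j *+ 'C(k, j)
  - power_trace E k *+ 2 ^ k.
Proof. exact: trace_wedge2. Qed.

Lemma power_trace_stab E r k :
  power_trace (bsum E (btriv R n r)) k = power_trace E k + (if k is 0 then r%:R else 0).
Proof.
rewrite power_trace_bsum; congr (_ + _); case: k => [|k]; last exact: flat_power_trace.
by rewrite power_trace0.
Qed.

(** Coefficient of [q^2] in the quotient of [\sum_k q^k ch (/\^k E)] by [(1 +
    q)^r], the total exterior power of a trivial bundle of rank [r]. *)
Lemma vch_wedge2_reduced E (r := rk E) : vch (vwedge 2 (vreduced E)) =
  ch (bwedge 2 (bsum E (btriv R n 0))) - r%:R * ch E + (r%:R ^+ 2 - 'C(r, 2)%:R).
Proof.
rewrite /vwedge /vwedge_q /= -/r.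
set b := wedge_q (bsum _ (btriv R n r)).
have bf : sflat b.
  move=> k; split=> //; apply: flat_bwedge; exact: flat_bsum.
have chb k : vch (b k) = 'C(r, k)%:R.
  rewrite vch_of ch_flat; last by apply: flat_bwedge; exact: flat_bsum.
  by rewrite /= card_draws card_ord.
have b0 : vch (b 0%N) = 1 by rewrite chb bin0.
have [i0 i1 i2] := vch_series_inv bf b0.
rewrite vch_series_mul2; last exact: sflat_inv.
rewrite !vch_of ch_wedge0 ch_wedge1 ch_bsum ch_btriv addr0 i0 i1 i2 !chb bin1.
by rewrite mul1r mulr1 mulrN [ch E * _]mulrC addrC addrA addrAC.
Qed.

End ChernCharacter.

(** * Homogeneous forms in dimension twelve *)

Section Rational.
Variables (F : numFieldType) (n : nat).
Local Notation form := (evenform F n).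
Local Notation cst := (cst_form n).

(** Integers are invertible in the ring of forms; identities with rational
    coefficients are proved after clearing denominators. *)
Lemma cst_natVK m (u : form) : cst (m.+1%:R^-1) * (m.+1%:R * u) = u.
Proof.
by rewrite -(rmorph_nat cst) mulrA -rmorphM mulVf ?pnatr_eq0 // rmorph1 mul1r.
Qed.

Lemma form_mulnI m (u v : form) : m.+1%:R * u = m.+1%:R * v -> u = v.
Proof. by move=> uv; rewrite -(cst_natVK m u) uv cst_natVK. Qed.

Definition mx_homog d p q (A : 'M[form]_(p, q)) := forall i j, homog d (A i j).

Lemma mx_homog_ord d p q (A : 'M[form]_(p, q)) : mx_homog d A -> mx_ord d A.
Proof. by move=> hA i j; apply/homog_ord/hA. Qed.

Lemma mx_homogM d e p q r (A : 'M[form]_(p, q)) (B : 'M[form]_(q, r)) :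
  mx_homog d A -> mx_homog e B -> mx_homog (d + e) (A *m B).
Proof.
by move=> hA hB i j; rewrite mxE; apply: homog_sum => k _; apply: homogM.
Qed.

Lemma mx_homogX d p (A : 'M[form]_p) k : mx_homog d A -> mx_homog (k * d) (A ^+ k).
Proof.
move=> hA; elim: k => [|k ih]; last by rewrite exprS mulSn; apply: mx_homogM.
by move=> i j; rewrite expr0 !mxE; apply: homog_nat.
Qed.

Lemma mx_homog_cstZ d p q a (A : 'M[form]_(p, q)) :
  mx_homog d A -> mx_homog d (cst a *: A).
Proof. by move=> hA i j; rewrite mxE; apply: homog_cstM. Qed.

Lemma trace_homog d p (A : 'M[form]_p) : mx_homog d A -> homog d (\tr A).
Proof. by move=> hA; apply: homog_sum => i _; apply: hA. Qed.

Lemma trace_ord d p (A : 'M[form]_p) : mx_ord d A -> ord_ge d (\tr A).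
Proof. by move=> hA; apply: ord_ge_sum => i _; apply: hA. Qed.

(** By induction on [k], from Newton's identities. *)
Lemma elem_sym_homog d p (A : 'M[form]_p) k : mx_homog d A -> homog (k * d) (elem_sym A k).
Proof.
move=> hA; elim/ltn_ind: k => -[_|k ih]; first by rewrite elem_sym0; apply: homog_nat 1%N.
rewrite -(cst_natVK k (elem_sym A k.+1)) mulr_natl newton.
apply: homog_cstM; apply: homog_sum => j _; rewrite -mulrA.
have jk : (j <= k)%N by rewrite -ltnS.
rewrite (_ : k.+1 * d = 0 + ((k - j) * d + j.+1 * d))%N; last first.
  by rewrite add0n -mulnDl addnS subnK.
apply: homogM; last first.
  apply: homogM; first by apply: ih; rewrite ltnS leq_subr.
  exact/trace_homog/mx_homogX.
rewrite -(rmorph1 cst) -rmorphN -rmorphXn; exact: homog_cst.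
Qed.

Lemma elem_sym_ord d p (A : 'M[form]_p) k : mx_ord d A -> ord_ge (k * d) (elem_sym A k).
Proof.
move=> hA; elim/ltn_ind: k => -[_|k ih] //.
rewrite -(cst_natVK k (elem_sym A k.+1)) mulr_natl newton.
apply: ord_geMl; apply: ord_ge_sum => j _.
have jk : (j <= k)%N by rewrite -ltnS.
rewrite (_ : k.+1 * d = (k - j) * d + j.+1 * d)%N; last by rewrite -mulnDl addnS subnK.
apply: ord_geM; first by apply/ord_geMl/ih; rewrite ltnS leq_subr.
exact/trace_ord/mx_ordX.
Qed.

Lemma newton1 p (A : 'M[form]_p) : elem_sym A 1 = \tr A.
Proof. by rewrite -[LHS]mulr1n newton big_ord1 /= expr0 elem_sym0 !mul1r expr1. Qed.

Lemma newton2 p (A : 'M[form]_p) :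
  2 * elem_sym A 2 = \tr A ^+ 2 - \tr (A ^+ 2).
Proof.
rewrite mulr_natl newton !big_ord_recr big_ord0 /= add0r newton1 elem_sym0 expr0 !expr1.
by rewrite mul1r mulr1 mulN1r expr2.
Qed.

Lemma newton3 p (A : 'M[form]_p) :
  6 * elem_sym A 3 = \tr A ^+ 3 - 3 * \tr A * \tr (A ^+ 2) + 2 * \tr (A ^+ 3).
Proof.
have h3 : 3 * elem_sym A 3 = elem_sym A 2 * \tr A - \tr A * \tr (A ^+ 2) + \tr (A ^+ 3).
  rewrite mulr_natl newton !big_ord_recr big_ord0 /= add0r newton1 elem_sym0 expr0 !expr1.
  by rewrite mul1r mulr1 mulN1r mulNr sqrrN expr1n mul1r.
have gen (K : comNzRingType) (e2 e3 a b c : K) :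
    3 * e3 = e2 * a - a * b + c -> 2 * e2 = a ^+ 2 - b ->
    6 * e3 = a ^+ 3 - 3 * a * b + 2 * c.
  move=> E3 E2; transitivity (2 * (3 * e3)); first by ring.
  rewrite E3; transitivity ((2 * e2) * a - 2 * a * b + 2 * c); first by ring.
  by rewrite E2; ring.
exact: gen h3 (newton2 A).
Qed.

End Rational.

Lemma truncated_powers (K : comNzRingType) r (P Q S : 'M[K]_r) (a b c : K)
    (N := a *: P + b *: Q + c *: S) :
  P *m P = Q -> P *m Q = S -> Q *m P = S -> P *m S = 0 -> S *m P = 0 ->
  Q *m Q = 0 -> Q *m S = 0 -> S *m Q = 0 -> S *m S = 0 ->
  N ^+ 2 = a ^+ 2 *: Q + (2 * a * b) *: S /\ N ^+ 3 = a ^+ 3 *: S.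
Proof.
move=> PP PQ QP PS SP QQ QS SQ SS.
have sq : N ^+ 2 = a ^+ 2 *: Q + (2 * a * b) *: S.
  rewrite expr2 -mulmxE /N !mulmxDl !mulmxDr -!scalemxAl -!scalemxAr.
  rewrite PP PQ QP PS SP QQ QS SQ SS !scaler0 !addr0 !scalerA -addrA -scalerDl.
  by congr (_ *: _ + _ *: _); ring.
split=> //; rewrite exprS sq -mulmxE /N !mulmxDl !mulmxDr -!scalemxAl -!scalemxAr.
rewrite PQ PS QQ QS SQ SS !scaler0 !addr0 !scalerA.
by congr (_ *: _); ring.
Qed.

Lemma mxtrace_comb2 (K : comNzRingType) r (P Q : 'M[K]_r) (a b : K) :
  \tr (a *: P + b *: Q) = a * \tr P + b * \tr Q.
Proof. by rewrite mxtraceD !mxtraceZ. Qed.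

Lemma mxtrace_comb3 (K : comNzRingType) r (P Q S : 'M[K]_r) (a b c : K) :
  \tr (a *: P + b *: Q + c *: S) = a * \tr P + b * \tr Q + c * \tr S.
Proof. by rewrite !mxtraceD !mxtraceZ. Qed.

Section Graded.
Variable F : numFieldType.
Local Notation form := (evenform F 12).
Local Notation cst := (cst_form 12).

(** The shape of every form in the statement: only the degrees 0, 4, 8, 12
    occur, because the odd power traces vanish. Products of components of
    total degree above 12 are zero, so these forms multiply like truncated
    power series. *)
Record graded (u a0 a1 a2 a3 : form) : Prop := Graded {
  graded_sum : u = a0 + a1 + a2 + a3 ;
  graded0 : homog 0 a0 ; graded1 : homog 4 a1 ;
  graded2 : homog 8 a2 ; graded3 : homog 12 a3 }.

Lemma gradedD u v a0 a1 a2 a3 b0 b1 b2 b3 :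
  graded u a0 a1 a2 a3 -> graded v b0 b1 b2 b3 ->
  graded (u + v) (a0 + b0) (a1 + b1) (a2 + b2) (a3 + b3).
Proof.
case=> -> ha0 ha1 ha2 ha3 [-> hb0 hb1 hb2 hb3].
split; [|exact: homogD..].
have gen (V : nmodType) (x0 x1 x2 x3 y0 y1 y2 y3 : V) :
   x0 + x1 + x2 + x3 + (y0 + y1 + y2 + y3) = x0 + y0 + (x1 + y1) + (x2 + y2) + (x3 + y3).
  rewrite addrACA; congr (_ + _); rewrite addrACA; congr (_ + _).
  exact: addrACA.
exact: gen.
Qed.

Lemma big_homog0 d (u : form) : (12 < d)%N -> homog d u -> u = 0.
Proof. by move=> d12 hu; apply: (@ord_ge_eq0 _ _ d) => //; apply: homog_ord. Qed.

Lemma gradedM u v a0 a1 a2 a3 b0 b1 b2 b3 :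
  graded u a0 a1 a2 a3 -> graded v b0 b1 b2 b3 ->
  graded (u * v) (a0 * b0) (a0 * b1 + a1 * b0) (a0 * b2 + a1 * b1 + a2 * b0)
    (a0 * b3 + a1 * b2 + a2 * b1 + a3 * b0).
Proof.
case=> -> ha0 ha1 ha2 ha3 [-> hb0 hb1 hb2 hb3].
have z13 : a1 * b3 = 0 by apply: (big_homog0 _ (homogM ha1 hb3)).
have z22 : a2 * b2 = 0 by apply: (big_homog0 _ (homogM ha2 hb2)).
have z31 : a3 * b1 = 0 by apply: (big_homog0 _ (homogM ha3 hb1)).
have z23 : a2 * b3 = 0 by apply: (big_homog0 _ (homogM ha2 hb3)).
have z32 : a3 * b2 = 0 by apply: (big_homog0 _ (homogM ha3 hb2)).
have z33 : a3 * b3 = 0 by apply: (big_homog0 _ (homogM ha3 hb3)).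
have gen (K : comNzRingType) (x0 x1 x2 x3 y0 y1 y2 y3 : K) :
    x1 * y3 = 0 -> x2 * y2 = 0 -> x3 * y1 = 0 -> x2 * y3 = 0 -> x3 * y2 = 0 ->
    x3 * y3 = 0 ->
    (x0 + x1 + x2 + x3) * (y0 + y1 + y2 + y3) = x0 * y0 + (x0 * y1 + x1 * y0) +
    (x0 * y2 + x1 * y1 + x2 * y0) + (x0 * y3 + x1 * y2 + x2 * y1 + x3 * y0).
  move=> e13 e22 e31 e23 e32 e33.
  rewrite -[RHS]addr0 -{1}e13 -{1}[RHS]addr0 -{1}e22 -{1}[RHS]addr0 -{1}e31.
  by rewrite -{1}[RHS]addr0 -{1}e23 -{1}[RHS]addr0 -{1}e32 -{1}[RHS]addr0 -{1}e33; ring.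
split; [exact: gen | exact: homogM ha0 hb0 | | |].
- by apply: homogD; [exact: homogM ha0 hb1 | exact: homogM ha1 hb0].
- apply: homogD; last exact: homogM ha2 hb0.
  by apply: homogD; [exact: homogM ha0 hb2 | exact: homogM ha1 hb1].
- apply: homogD; last exact: homogM ha3 hb0.
  apply: homogD; last exact: homogM ha2 hb1.
  by apply: homogD; [exact: homogM ha0 hb3 | exact: homogM ha1 hb2].
Qed.

Lemma graded_top u a0 a1 a2 a3 : graded u a0 a1 a2 a3 -> hcomp 12 u = a3.
Proof.
case=> -> h0 h1 h2 h3; rewrite !raddfD /= (hcomp_off h0) // (hcomp_off h1) //.
by rewrite (hcomp_off h2) // !add0r hcomp_id.
Qed.

Lemma graded_nat m : graded m%:R m%:R 0 0 0.
Proof. by split; [rewrite !addr0 | exact: homog_nat | exact: homog_zero..]. Qed.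

Lemma graded_homog4 u : homog 4 u -> graded u 0 u 0 0.
Proof. by split; rewrite ?add0r ?addr0 //; apply: homog_zero. Qed.

Lemma graded_const u a0 a1 a2 a3 : graded u a0 a1 a2 a3 ->
  const_part u = const_part a0.
Proof.
case=> -> h0 h1 h2 h3; rewrite !rmorphD /=.
by rewrite !(const_part_ord _ (homog_ord h1), const_part_ord _ (homog_ord h2),
   const_part_ord _ (homog_ord h3)) // !addr0.
Qed.

Section EvenSeries.
Variables (r : nat) (Y : 'M[form]_r) (a : nat -> F).
Hypothesis Y_homog : mx_homog 2 Y.
Hypothesis a0 : a 0%N = 1.
Local Notation t k := (\tr (Y ^+ k)).
Let al := cst (a 1%N).
Let be := cst (a 2%N).
Let ga := cst (a 3%N).

Let Y_nil k : (6 < k)%N -> Y ^+ k = 0.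
Proof.
move=> k6; apply: (@mx_ord_eq0 _ _ (k * 2)); last exact/mx_homog_ord/mx_homogX.
by apply: (@leq_trans (7 * 2)) => //; rewrite leq_mul2r k6 orbT.
Qed.

(** For an even series [1 + N] with [N] of order 4, the elementary symmetric
    functions of [N] of index 4 and more have degree at least 16 and vanish,
    and the first three are given by Newton's identities. *)
Lemma det_even_series (T1 := al * t 2 + be * t 4 + ga * t 6)
    (T2 := al ^+ 2 * t 4 + 2 * al * be * t 6) (T3 := al ^+ 3 * t 6) :
  exists e1 e2 e3,
  [/\ \det (\sum_(k < 13) cst (a k) *: Y ^+ (2 * k)) = 1 + e1 + e2 + e3,
      e1 = T1, 2 * e2 = T1 ^+ 2 - T2 & 6 * e3 = T1 ^+ 3 - 3 * T1 * T2 + 2 * T3].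
Proof.
pose N := al *: Y ^+ 2 + be *: Y ^+ 4 + ga *: Y ^+ 6.
have NE : \sum_(k < 13) cst (a k) *: Y ^+ (2 * k) = 1%:M + N.
  rewrite -(big_mkord xpredT (fun k => cst (a k) *: Y ^+ (2 * k))).
  rewrite (big_cat_nat (n := 4)) //=.
  have -> : \sum_(4 <= k < 13) cst (a k) *: Y ^+ (2 * k) = 0.
    rewrite big_nat_cond big1 // => k /andP[/andP[k4 _] _].
    by rewrite Y_nil ?scaler0 // (@leq_trans (2 * 4)) // leq_mul2l.
  rewrite addr0 big_mkord !big_ord_recr big_ord0 /= add0r a0 rmorph1 scale1r.
  by rewrite /N !addrA expr0.
have Ymul i j l : (i + j)%N = l -> Y ^+ i *m Y ^+ j = Y ^+ l.
  by move=> <-; rewrite exprD.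
have Ymul0 i j : (6 < i + j)%N -> Y ^+ i *m Y ^+ j = 0.
  by move=> ij; rewrite mulmxE -exprD Y_nil.
have [sq cb] := truncated_powers al be ga (Ymul 2 2 4 erefl)%N (Ymul 2 4 6 erefl)%N
  (Ymul 4 2 6 erefl)%N (Ymul0 2 6 isT)%N (Ymul0 6 2 isT)%N (Ymul0 4 4 isT)%N
  (Ymul0 4 6 isT)%N (Ymul0 6 4 isT)%N (Ymul0 6 6 isT)%N.
have N_ord : mx_ord 4 N.
  rewrite /N; apply: mx_ordD; first apply: mx_ordD.
  - apply: mx_ordZ; exact: (mx_homog_ord (@mx_homogX _ _ _ _ _ 2 Y_homog)).
  - apply/mx_ordZ/(@mx_ordW _ _ 8) => //; exact: (mx_homog_ord (@mx_homogX _ _ _ _ _ 4 Y_homog)).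
  - apply/mx_ordZ/(@mx_ordW _ _ 12) => //; exact: (mx_homog_ord (@mx_homogX _ _ _ _ _ 6 Y_homog)).
have t1 : \tr N = T1 := mxtrace_comb3 _ _ _ _ _ _.
have t2 : \tr (N ^+ 2) = T2 by rewrite sq; apply: mxtrace_comb2.
have t3 : \tr (N ^+ 3) = T3 by rewrite cb mxtraceZ.
exists (elem_sym N 1), (elem_sym N 2), (elem_sym N 3); split.
- rewrite NE (@det_1D _ _ _ 4) => [|k k4]; last first.
    apply: (@ord_ge_eq0 _ _ (k * 4)); last exact: elem_sym_ord.
    by apply: (@leq_trans (4 * 4)) => //; rewrite leq_mul2r k4 orbT.
  by rewrite !big_ord_recr big_ord0 /= add0r elem_sym0.
- by rewrite newton1 t1.
- by rewrite newton2 t1 t2.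
- by rewrite newton3 t1 t2 t3.
Qed.

End EvenSeries.

End Graded.

(** * The A-hat form and the Chern character of the spinor bundle *)

Section Identities.
Variable K : comNzRingType.
Implicit Types x y z : K.

(** The determinant of [det_even_series], multiplied by 6 to clear
    denominators, when the traces are multiples of [x], [y], [z] of degree 4,
    8, 12. *)
Lemma newton_sum x y z p q s p2 q2 s3 e1 e2 e3
    (T1 := p * x + q * y + s * z) (T2 := p2 * y + q2 * z) (T3 := s3 * z) :
  x * z = 0 -> y * y = 0 -> y * z = 0 -> z * z = 0 -> x * x * y = 0 ->
  e1 = T1 -> 2 * e2 = T1 ^+ 2 - T2 -> 6 * e3 = T1 ^+ 3 - 3 * T1 * T2 + 2 * T3 ->
  6 * (1 + e1 + e2 + e3) = 6 + 6 * p * x + (3 * p ^+ 2 * x ^+ 2 + 6 * q * y - 3 * p2 * y)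
    + (6 * s * z + 6 * p * q * x * y - 3 * q2 * z + p ^+ 3 * x ^+ 3
       - 3 * p * p2 * x * y + 2 * s3 * z).
Proof.
move=> xz yy yz zz xxy h1 h2 h3.
transitivity (6 + 6 * e1 + 3 * (2 * e2) + 6 * e3); first by ring.
rewrite h1 h2 h3 /T1 /T2 /T3.
pose w2 := q ^+ 2 * (y * y) + 2 * q * s * (y * z) + s ^+ 2 * (z * z).
transitivity (6 + 6 * p * x + (3 * p ^+ 2 * x ^+ 2 + 6 * q * y - 3 * p2 * y)
    + (6 * s * z + 6 * p * q * x * y - 3 * q2 * z + p ^+ 3 * x ^+ 3
       - 3 * p * p2 * x * y + 2 * s3 * z)
   + (6 * p * s * (x * z) + 3 * w2) + (3 * p ^+ 2 * q * (x * x * y)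
   + 3 * p ^+ 2 * s * x * (x * z) + (3 * p * x + q * y + s * z) * w2)
   - 3 * (p * q2 * (x * z) + q * p2 * (y * y) + (q * q2 + s * p2) * (y * z) + s * q2 * (z * z))).
  by rewrite /w2; ring.
by rewrite /w2 xz yy yz zz xxy !(mulr0, addr0, oppr0).
Qed.

(** The result is the expansion of [exp (12 x - 2 y + 16 z)]. *)
Lemma sinhc_values x y z :
  6 + 6 * 12 * x + (3 * 12 ^+ 2 * x ^+ 2 + 6 * 3 * y - 3 * 10 * y)
    + (6 * 9 * z + 6 * 12 * 3 * x * y - 3 * 126 * z + 12 ^+ 3 * x ^+ 3
       - 3 * 12 * 10 * x * y + 2 * 210 * z)
  = 6 * (1 + 12 * x + (72 * x ^+ 2 - 2 * y) + (288 * x ^+ 3 - 24 * x * y + 16 * z)).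
Proof. by ring. Qed.

(** The result is the expansion of [exp (36 x - 30 y + 1008 z)]. *)
Lemma cosh_values x y z :
  6 + 6 * 36 * x + (3 * 36 ^+ 2 * x ^+ 2 + 6 * 15 * y - 3 * 90 * y)
    + (6 * 63 * z + 6 * 36 * 15 * x * y - 3 * 1890 * z + 36 ^+ 3 * x ^+ 3
       - 3 * 36 * 90 * x * y + 2 * (63 * 90) * z)
  = 6 * (1 + 36 * x + (648 * x ^+ 2 - 30 * y)
         + (36 * 216 * x ^+ 3 - 1080 * x * y + 1008 * z)).
Proof. by ring. Qed.

(** The expansion of [exp (- 6 x + y - 8 z)] is the inverse square root of the
    determinant of [sinh Y / Y]. *)
Lemma hat_A_identity x y z (a1 := - (6 * x)) (a2 := 18 * x ^+ 2 + y)
    (a3 := - (36 * x ^+ 3) - 6 * x * y - 8 * z)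
    (b0 := 1 * 1) (b1 := 1 * a1 + a1 * 1) (b2 := 1 * a2 + a1 * a1 + a2 * 1)
    (b3 := 1 * a3 + a1 * a2 + a2 * a1 + a3 * 1)
    (d1 := 12 * x) (d2 := 72 * x ^+ 2 - 2 * y)
    (d3 := 288 * x ^+ 3 - 24 * x * y + 16 * z) :
  b0 * 1 + (b0 * d1 + b1 * 1) + (b0 * d2 + b1 * d1 + b2 * 1)
  + (b0 * d3 + b1 * d2 + b2 * d1 + b3 * 1) = 1.
Proof. by rewrite /b0 /b1 /b2 /b3 /a1 /a2 /a3 /d1 /d2 /d3; ring. Qed.

(** The expansion of [exp (18 x - 15 y + 504 z)] is a square root of the
    determinant of [cosh Y]. *)
Lemma spinor_identity x y z (a1 := 18 * x) (a2 := 162 * x ^+ 2 - 15 * y)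
    (a3 := 972 * x ^+ 3 - 270 * x * y + 504 * z) :
  1 * 1 + (1 * a1 + a1 * 1) + (1 * a2 + a1 * a1 + a2 * 1)
    + (1 * a3 + a1 * a2 + a2 * a1 + a3 * 1)
  = 1 + 36 * x + (648 * x ^+ 2 - 30 * y)
    + (36 * 216 * x ^+ 3 - 1080 * x * y + 1008 * z).
Proof. by rewrite /a1 /a2 /a3; ring. Qed.

Lemma spinor_scale x : (64 * x) ^+ 2 = 2 ^+ 12 * (x * x).
Proof. by ring. Qed.

End Identities.

From mathcomp Require Import classical_sets.

Section Sqrt.
Variables (R : realType) (n : nat).
Local Notation form := (evenform R[i] n).

(** Two square roots with positive constant parts agree: their sum is
    invertible. *)
Lemma form_sqrtE (w v : form) : v ^+ 2 = w -> 0 < const_part v -> form_sqrt w = v.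
Proof.
move=> vw v0; apply: xget_unique => // y [yw y0].
have u : y + v \is a GRing.unit.
  by apply: form_unitP; rewrite rmorphD gt_eqF // addr_gt0.
apply/eqP; rewrite -subr_eq0; apply/eqP/(mulIr u).
by rewrite -subr_sqr yw vw subrr mul0r.
Qed.

End Sqrt.

Section Twelve.
Local Open Scope complex_scope.
Variable R : realType.
Local Notation form := (evenform R[i] 12).
Local Notation cst := (cst_form 12).
Implicit Types (E : lbundle R 12).

Lemma natVcstK m (u : form) : m.+1%:R * (cst (m.+1%:R^-1) * u) = u.
Proof. by rewrite mulrCA cst_natVK. Qed.

Lemma cst_ratio (a : R[i]) (m k : nat) (u : form) :
  a * m%:R = k%:R -> cst a * (m%:R * u) = k%:R * u.
Proof. by move=> h; rewrite -!(rmorph_nat cst) mulrA -rmorphM h. Qed.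

Lemma cst_ratio2 (a : R[i]) (m1 m2 k : nat) (u : form) :
  a * m1%:R * m2%:R = k%:R -> cst a * (m1%:R * (m2%:R * u)) = k%:R * u.
Proof. by move=> h; rewrite -!(rmorph_nat cst) !mulrA -!rmorphM h. Qed.

Lemma homog_natM d m (u : form) : homog d u -> homog d (m%:R * u).
Proof. by move=> hu; rewrite -(rmorph_nat cst); apply: homog_cstM. Qed.

Section GenusForms.
Variables (X : 'M[form]_12).
Hypothesis X_homog : mx_homog 2 X.
Let E : lbundle R 12 := LBundle X.
Let Y := cst ('i / (4 * (pi : R)%:C)) *: X.
Let Y_homog : mx_homog 2 Y. Proof. exact: mx_homog_cstZ. Qed.
Let t k := \tr (Y ^+ k).

Let t_homog k : homog (k * 2) (t k).
Proof. exact/trace_homog/mx_homogX. Qed.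

(** The traces of the second, fourth and sixth powers of [Y], divided by 72,
    360 and 45360. With this scaling all the characteristic forms of the
    tangent bundle are polynomials in [px], [py], [pz] with integral
    coefficients. *)
Definition px : form := cst (72%:R^-1) * \tr (Y ^+ 2).
Definition py : form := cst (360%:R^-1) * \tr (Y ^+ 4).
Definition pz : form := cst (63%:R^-1) * (cst (720%:R^-1) * \tr (Y ^+ 6)).

Lemma t2E : t 2 = 72%:R * px. Proof. by rewrite natVcstK. Qed.
Lemma t4E : t 4 = 360%:R * py. Proof. by rewrite natVcstK. Qed.
Lemma t6E : t 6 = 720%:R * (63%:R * pz). Proof. by rewrite !natVcstK. Qed.

Lemma px_homog : homog 4 px. Proof. apply: homog_cstM; exact: (@t_homog 2). Qed.
Lemma py_homog : homog 8 py. Proof. apply: homog_cstM; exact: (@t_homog 4). Qed.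
Lemma pz_homog : homog 12 pz. Proof. apply: homog_cstM; apply: homog_cstM; exact: (@t_homog 6). Qed.

Lemma genus_graded (u1 u2 u3 : form) : homog 4 u1 -> homog 8 u2 -> homog 12 u3 ->
  graded (1 + u1 + u2 + u3) 1 u1 u2 u3.
Proof. by split=> //; apply: homog_nat 1%N. Qed.

Let relations : [/\ px * pz = 0, py * py = 0, py * pz = 0, pz * pz = 0 & px * px * py = 0].
Proof.
have hx := px_homog; have hy := py_homog; have hz := pz_homog.
split; [apply: (big_homog0 _ (homogM hx hz)) | apply: (big_homog0 _ (homogM hy hy)) |
  apply: (big_homog0 _ (homogM hy hz)) | apply: (big_homog0 _ (homogM hz hz)) |
  exact: (big_homog0 _ (homogM (homogM hx hx) hy))]; by [].
Qed.

Lemma det_sinhc : \det (mx_sinhc Y) =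
  1 + 12 * px + (72 * px ^+ 2 - 2 * py) + (288 * px ^+ 3 - 24 * px * py + 16 * pz).
Proof.
have [xz yy yz zz xxy] := relations.
have [|e1 [e2 [e3 [-> h1 h2 h3]]]] :=
  det_even_series (a := fun k => ((2 * k).+1`!)%:R^-1) Y_homog.
  exact: invr1.
have f3 : ((2 * 1).+1`!)%:R = 6%:R :> R[i] by [].
have f5 : ((2 * 2).+1`!)%:R = 120%:R :> R[i] by [].
have f7 : ((2 * 3).+1`!)%:R = 7%:R * 720%:R :> R[i].
  exact: natrM _ 7 (6`!).
rewrite f3 f5 f7 in h1 h2 h3.
have a2 : cst 6%:R^-1 * t 2 = 12 * px by rewrite t2E; apply: cst_ratio; field.
have b4 : cst 120%:R^-1 * t 4 = 3 * py by rewrite t4E; apply: cst_ratio; field.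
have c6 : cst (7%:R * 720%:R)^-1 * t 6 = 9 * pz.
  by rewrite t6E; apply: cst_ratio2; field.
have a4 : cst 6%:R^-1 ^+ 2 * t 4 = 10 * py.
  by rewrite -rmorphXn t4E; apply: cst_ratio; field.
have a6 : cst 6%:R^-1 ^+ 3 * t 6 = 210 * pz.
  by rewrite -rmorphXn t6E; apply: cst_ratio2; field.
have ab6 : 2 * cst 6%:R^-1 * cst 120%:R^-1 * t 6 = 126 * pz.
  by rewrite -(rmorph_nat cst 2) -!rmorphM t6E; apply: cst_ratio2; field.
move: h1 h2 h3; rewrite a2 b4 c6 a4 a6 ab6 => h1 h2 h3.
apply: (@form_mulnI _ _ 5); rewrite (newton_sum xz yy yz zz xxy h1 h2 h3).
exact: sinhc_values.
Qed.

Lemma det_cosh : \det (mx_cosh Y) =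
  1 + 36 * px + (648 * px ^+ 2 - 30 * py)
    + (36 * 216 * px ^+ 3 - 1080 * px * py + 1008 * pz).
Proof.
have [xz yy yz zz xxy] := relations.
have [|e1 [e2 [e3 [-> h1 h2 h3]]]] :=
  det_even_series (a := fun k => ((2 * k)`!)%:R^-1) Y_homog.
  exact: invr1.
have f2 : ((2 * 1)`!)%:R = 2%:R :> R[i] by [].
have f4 : ((2 * 2)`!)%:R = 24%:R :> R[i] by [].
have f6 : ((2 * 3)`!)%:R = 720%:R :> R[i] by [].
rewrite f2 f4 f6 in h1 h2 h3.
have a2 : cst 2%:R^-1 * t 2 = 36 * px by rewrite t2E; apply: cst_ratio; field.
have b4 : cst 24%:R^-1 * t 4 = 15 * py by rewrite t4E; apply: cst_ratio; field.
have c6 : cst 720%:R^-1 * t 6 = 63 * pz.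
  by rewrite t6E; apply: cst_ratio2; field.
have a4 : cst 2%:R^-1 ^+ 2 * t 4 = 90 * py.
  by rewrite -rmorphXn t4E; apply: cst_ratio; field.
have a6 : cst 2%:R^-1 ^+ 3 * t 6 = (63 * 90) * pz.
  by rewrite -natrM -rmorphXn t6E; apply: cst_ratio2; rewrite natrM; field.
have ab6 : 2 * cst 2%:R^-1 * cst 24%:R^-1 * t 6 = 1890 * pz.
  by rewrite -(rmorph_nat cst 2) -!rmorphM t6E; apply: cst_ratio2; field.
move: h1 h2 h3; rewrite a2 b4 c6 a4 a6 ab6 => h1 h2 h3.
apply: (@form_mulnI _ _ 5); rewrite (newton_sum xz yy yz zz xxy h1 h2 h3).
exact: cosh_values.
Qed.

Let pxx_homog : homog 8 (px ^+ 2).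
Proof. by rewrite expr2; apply: (homogM px_homog px_homog). Qed.

Let pxxx_homog : homog 12 (px ^+ 3).
Proof. by rewrite exprS; apply: (homogM px_homog pxx_homog). Qed.

Lemma sinhc_graded : graded (\det (mx_sinhc Y)) 1 (12 * px) (72 * px ^+ 2 - 2 * py)
  (288 * px ^+ 3 - 24 * px * py + 16 * pz).
Proof.
rewrite det_sinhc; apply: genus_graded; first exact/homog_natM/px_homog.
  by apply: homogD; [|apply: homogN]; apply: homog_natM => //; apply: py_homog.
apply: homogD; last exact/homog_natM/pz_homog.
apply: homogD; first exact: homog_natM.
apply: homogN; exact: (homogM (homog_natM 24 px_homog) py_homog).
Qed.

Lemma cosh_graded : graded (\det (mx_cosh Y)) 1 (36 * px) (648 * px ^+ 2 - 30 * py)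
  (36 * 216 * px ^+ 3 - 1080 * px * py + 1008 * pz).
Proof.
rewrite det_cosh; apply: genus_graded; first exact/homog_natM/px_homog.
  by apply: homogD; [|apply: homogN]; apply: homog_natM => //; apply: py_homog.
apply: homogD; last exact/homog_natM/pz_homog.
apply: homogD; first by rewrite -mulrA; do 2!apply: homog_natM.
apply: homogN; exact: (homogM (homog_natM 1080 px_homog) py_homog).
Qed.

Let genusA := 1 + - (6 * px) + (18 * px ^+ 2 + py)
  + (- (36 * px ^+ 3) - 6 * px * py - 8 * pz).

Let genusA_graded : graded genusA 1 (- (6 * px)) (18 * px ^+ 2 + py)
  (- (36 * px ^+ 3) - 6 * px * py - 8 * pz).
Proof.
apply: genus_graded; first exact/homogN/homog_natM/px_homog.
  by apply: homogD; [apply: homog_natM | apply: py_homog].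
apply: homogD; last exact/homogN/homog_natM/pz_homog.
apply: homogD; first exact/homogN/homog_natM.
apply: homogN; exact: (homogM (homog_natM 6 px_homog) py_homog).
Qed.

Lemma hat_A_graded : graded (hat_A E) 1 (- (6 * px)) (18 * px ^+ 2 + py)
  (- (36 * px ^+ 3) - 6 * px * py - 8 * pz).
Proof.
rewrite (_ : hat_A E = genusA) //; apply: form_sqrtE; last first.
  by rewrite (graded_const genusA_graded) rmorph1 ltr01.
have AAD : genusA * genusA * \det (mx_sinhc Y) = 1.
  rewrite (graded_sum (gradedM (gradedM genusA_graded genusA_graded) sinhc_graded)).
  exact: hat_A_identity.
have Du : \det (mx_sinhc Y) \is a GRing.unit.
  by apply/unitrP; exists (genusA * genusA); rewrite AAD mulrC AAD.
by rewrite det_inv expr2 -[LHS](mulrK Du) AAD mul1r.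
Qed.

Let genusS := 1 + 18 * px + (162 * px ^+ 2 - 15 * py)
  + (972 * px ^+ 3 - 270 * px * py + 504 * pz).

Let genusS_graded : graded genusS 1 (18 * px) (162 * px ^+ 2 - 15 * py)
  (972 * px ^+ 3 - 270 * px * py + 504 * pz).
Proof.
apply: genus_graded; first exact/homog_natM/px_homog.
  by apply: homogD; [|apply: homogN]; apply: homog_natM => //; apply: py_homog.
apply: homogD; last exact/homog_natM/pz_homog.
apply: homogD; first exact/homog_natM.
apply: homogN; exact: (homogM (homog_natM 270 px_homog) py_homog).
Qed.

Lemma ch_spinor_graded : graded (ch_spinor E) (64 * 1) (64 * (18 * px))
  (64 * (162 * px ^+ 2 - 15 * py)) (64 * (972 * px ^+ 3 - 270 * px * py + 504 * pz)).
Proof.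
rewrite (_ : ch_spinor E = 64 * genusS).
  have [-> h0 h1 h2 h3] := genusS_graded.
  by split; [rewrite !mulrDr | exact: homog_natM..].
apply: form_sqrtE; last first.
  rewrite rmorphM /= (graded_const genusS_graded) rmorph1 mulr1 rmorph_nat.
  by rewrite ltr0n.
have SS : genusS * genusS = \det (mx_cosh Y).
  rewrite (graded_sum (gradedM genusS_graded genusS_graded)) (graded_sum cosh_graded).
  exact: spinor_identity.
rewrite detZ -SS; exact: spinor_scale.
Qed.

End GenusForms.

Let c : R[i] := 'i / (2 * (pi : R)%:C).

(** The power traces with the normalization of the Chern character. *)
Definition chern_trace E k : form := cst c ^+ k * power_trace E k.

Lemma chern_trace_homog E k : mx_homog 2 (curv E) -> homog (k * 2) (chern_trace E k).
Proof.
move=> hE; rewrite /chern_trace -rmorphXn; apply: homog_cstM.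
by apply: trace_homog; apply: mx_homogX.
Qed.

Lemma ch_graded E : mx_homog 2 (curv E) ->
  chern_trace E 1 = 0 -> chern_trace E 3 = 0 -> chern_trace E 5 = 0 ->
  graded (ch E) (rk E)%:R (cst 2%:R^-1 * chern_trace E 2)
    (cst 24%:R^-1 * chern_trace E 4) (cst 720%:R^-1 * chern_trace E 6).
Proof.
move=> hE c1 c3 c5; split; first 1 last.
- exact: homog_nat.
- exact/homog_cstM/(@chern_trace_homog E 2).
- exact/homog_cstM/(@chern_trace_homog E 4).
- exact/homog_cstM/(@chern_trace_homog E 6).
pose f k := cst (k`!)%:R^-1 * chern_trace E k.
have -> : ch E = \sum_(0 <= k < 13) f k.
  by rewrite big_mkord chE; apply: eq_bigr => k _; rewrite /f mulrA.
rewrite (big_cat_nat (n := 7)) //=.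
have -> : \sum_(7 <= k < 13) f k = 0.
  rewrite big_nat_cond big1 // => k /andP[/andP[k7 _] _].
  rewrite /f (@big_homog0 _ (k * 2) (chern_trace E k)) ?mulr0 //.
    by apply: (@leq_trans (7 * 2)) => //; rewrite leq_mul2r k7 orbT.
  exact: chern_trace_homog.
rewrite addr0 big_mkord !big_ord_recr big_ord0 /= add0r.
rewrite {2}/f c1 {3}/f c3 {4}/f c5 !mulr0 !addr0 {1}/f fact0 invr1 rmorph1 mul1r.
by rewrite /chern_trace expr0 mul1r power_trace0.
Qed.

(** The second Chern form is the second elementary symmetric function, of
    degree 4; when the first Chern form vanishes, Newton's identities reduce
    it to a power trace. *)
Lemma chern2E E : mx_homog 2 (curv E) -> chern_trace E 1 = 0 ->
  2 * chern2 E = - chern_trace E 2.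
Proof.
move=> hE c1; pose G := cst c *: curv E.
have hG : mx_homog 2 G by apply: mx_homog_cstZ.
have trG k : \tr (G ^+ k) = chern_trace E k.
  by rewrite /G scalemx_exp mxtraceZ.
have -> : chern2 E = elem_sym G 2.
  rewrite /chern2 /total_chern -/G (@det_1D _ _ _ 7) => [|k k7]; last first.
    apply: (@big_homog0 _ (k * 2)); last exact: elem_sym_homog.
    by apply: (@leq_trans (7 * 2)) => //; rewrite leq_mul2r k7 orbT.
  rewrite raddf_sum (bigD1 (inord 2 : 'I_7)) //= big1 => [|k k2].
    rewrite inordK // addr0; apply: hcomp_id; exact: (elem_sym_homog (k := 2) hG).
  apply: (hcomp_off (elem_sym_homog (k := k) hG)).
  apply: contra k2 => /eqP h; apply/eqP/val_inj; rewrite /= inordK //.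
  by apply/eqP; rewrite -(eqn_pmul2r (isT : 0 < 2)%N); apply/eqP.
by rewrite newton2 trG -[\tr G]/(\tr (G ^+ 1)) trG c1 expr0n /= sub0r.
Qed.

End Twelve.

(** * Chern characters of the tangent and adjoint bundles *)

Section SkewTraces.
Variables (F : numFieldType) (n r : nat).
Local Notation form := (evenform F n).

(** [G X G^-1 = - X^T], so that an odd power trace equals its opposite. *)
Lemma skew_trace (G X : 'M[form]_r) k : G \in unitmx -> G *m X = - (X^T *m G) ->
  odd k -> \tr (X ^+ k) = 0.
Proof.
move=> Gu GX ok.
have GXl l : G *m X ^+ l = (-1) ^+ l *: ((X ^+ l)^T *m G).
  elim: l => [|l ih]; first by rewrite !expr0 scale1r mulmx1 trmx1 mul1mx.
  rewrite [in LHS]exprSr -mulmxE mulmxA ih -scalemxAl -mulmxA GX mulmxN mulmxA.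
  by rewrite -trmx_mul mulmxE -exprS [(-1) ^+ l.+1]exprS mulN1r scaleNr scalerN.
have tr_eq : \tr (X ^+ k) = - \tr (X ^+ k).
  rewrite -[in LHS](mulKmx Gu (X ^+ k)) GXl -scalemxAr mxtraceZ mxtrace_mulC.
  by rewrite mulmxK // mxtrace_tr -signr_odd ok expr1 mulN1r.
apply: (@form_mulnI _ _ 1); rewrite mulr0 mulr_natl mulr2n {1}tr_eq addNr.
by [].
Qed.

End SkewTraces.

Section Numerals.
Variable K : comNzRingType.
Implicit Types x y z : K.

Lemma scale_pow (a b m t : K) k : a = m * b -> a ^+ k * t = m ^+ k * (b ^+ k * t).
Proof. by move=> ->; rewrite exprMn mulrA. Qed.

Lemma tangent_numerals x y z :
  [/\ 2%:R ^+ 2 * (72%:R * x) = 2%:R * (144%:R * x),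
      2%:R ^+ 4 * (360%:R * y) = 24%:R * (240%:R * y) &
      2%:R ^+ 6 * (720%:R * (63%:R * z)) = 720%:R * (4032%:R * z)].
Proof. by split; ring. Qed.

Lemma wedge_numeral2 x (u := 2%:R * (144%:R * x)) :
  u * 12%:R *+ 1 + 0 * 0 *+ 2 + 12%:R * u *+ 1 - u *+ 4 = 2%:R * (2%:R * (1440%:R * x)).
Proof. by rewrite /u; ring. Qed.

Lemma wedge_numeral4 x y (u := 2%:R * (144%:R * x)) (v := 24%:R * (240%:R * y)) :
  v * 12%:R *+ 1 + 0 * 0 *+ 4 + u * u *+ 6 + 0 * 0 *+ 4 + 12%:R * v *+ 1 - v *+ 16
  = 2%:R * (24%:R * (960%:R * y + (72%:R * 144%:R) * x ^+ 2)).
Proof. by rewrite /u /v; ring. Qed.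

Lemma wedge_numeral6 x y z (u := 2%:R * (144%:R * x)) (v := 24%:R * (240%:R * y))
    (w := 720%:R * (4032%:R * z)) :
  w * 12%:R *+ 1 + 0 * 0 *+ 6 + v * u *+ 15 + 0 * 0 *+ 20 + u * v *+ 15 + 0 * 0 *+ 6
    + 12%:R * w *+ 1 - w *+ 64
  = 2%:R * (720%:R * (- ((280%:R * 288%:R) * z) + (180%:R * 192%:R) * (x * y))).
Proof. by rewrite /u /v /w; ring. Qed.

Lemma adjoint_numeral4 x :
  (2%:R * (- (4320%:R * x))) ^+ 2 = 100%:R * (24%:R * ((144%:R * 216%:R) * x ^+ 2)).
Proof. by ring. Qed.

Lemma adjoint_numeral6 x z :
  7200 * z = (2%:R * (- (4320%:R * x))) ^+ 3 ->
  72%:R * (100%:R * z) = 72%:R * (100%:R * (720%:R * (- ((288%:R * 432%:R) * x ^+ 3)))).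
Proof.
move=> h; transitivity (7200 * z); first by ring.
by apply: etrans h _; ring.
Qed.

End Numerals.

Lemma half_angle (F : numFieldType) (u q : F) : q != 0 ->
  u / (2 * q) = 2%:R * (u / (4 * q)).
Proof. by move=> q0; field. Qed.

Section TangentAndAdjoint.
Local Open Scope complex_scope.
Variable R : realType.
Local Notation form := (evenform R[i] 12).
Local Notation cst := (cst_form 12).
Implicit Types (E : lbundle R 12).

Lemma chern_trace_eq0 E k : power_trace E k = 0 -> chern_trace E k = 0.
Proof. by move=> h; rewrite /chern_trace h mulr0. Qed.

Section Tangent.
Variables (X : 'M[form]_12).
Hypothesis X_homog : mx_homog 2 X.
Hypothesis X_odd : forall k, odd k -> \tr (X ^+ k) = 0.
Let E : lbundle R 12 := LBundle X.
Let s : R[i] := 'i / (4 * (pi : R)%:C).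

Lemma chern_traceE k : chern_trace E k = 2%:R ^+ k * \tr ((cst s *: X) ^+ k).
Proof.
rewrite /chern_trace scalemx_exp mxtraceZ; apply: scale_pow.
rewrite -(rmorph_nat cst) -rmorphM; congr (cst _).
apply: half_angle; rewrite eq_complex /= eqxx andbT gt_eqF //; exact: pi_gt0.
Qed.

Let x := px X. Let y := py X. Let z := pz X.

Lemma tangent_traces : [/\ chern_trace E 2 = 2%:R * (144%:R * x),
  chern_trace E 4 = 24%:R * (240%:R * y) & chern_trace E 6 = 720%:R * (4032%:R * z)].
Proof.
have [n2 n4 n6] := tangent_numerals x y z.
by split; rewrite chern_traceE; [rewrite t2E; exact: n2 | rewrite t4E; exact: n4 |
  rewrite t6E; exact: n6].
Qed.

Let odd_chern_trace k : odd k -> chern_trace E k = 0.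
Proof. by move=> ok; apply: chern_trace_eq0; rewrite /power_trace X_odd. Qed.

Lemma ch_tangent_graded :
  graded (ch E) 12%:R (144%:R * x) (240%:R * y) (4032%:R * z).
Proof.
have := ch_graded (E := E) X_homog (odd_chern_trace (isT : odd 1))
  (odd_chern_trace (isT : odd 3)) (odd_chern_trace (isT : odd 5)).
by have [-> -> ->] := tangent_traces; rewrite !cst_natVK.
Qed.

Let E' := bsum E (btriv R 12 0).
Let W := bwedge 2 E'.

Let stable_trace k : chern_trace E' k = chern_trace E k.
Proof.
rewrite /chern_trace power_trace_stab; case: k => [|k]; by rewrite addr0.
Qed.

Let wedge_homog : mx_homog 2 (curv W).
Proof.
move=> p q; rewrite mxE; apply: homog_sum => i _; apply: homog_sum => j _.
rewrite -(rmorph1 cst) -rmorphN -rmorphXn; apply: homog_cstM.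
by rewrite /E' /=; case: (split_ordP i) => a ->; case: (split_ordP j) => b ->;
  rewrite ?block_mxEul ?block_mxEur ?block_mxEdl ?block_mxEdr ?mxE;
  try exact: homog_zero.
Qed.

(** [trace_wedge2] in terms of the normalized traces; adding the trivial
    bundle of rank zero does not change them. *)
Lemma wedge_trace k : 2%:R * chern_trace W k =
  \sum_(j < k.+1) chern_trace E (k - j) * chern_trace E j *+ 'C(k, j)
  - chern_trace E k *+ 2 ^ k.
Proof.
rewrite {1}/chern_trace mulrCA power_trace_bwedge2 -!stable_trace mulrBr mulrnAr.
congr (_ - _); rewrite mulr_sumr; apply: eq_bigr => j _.
have jk : (j <= k)%N by rewrite -ltnS.
rewrite -!stable_trace mulrnAr; congr (_ *+ _).
rewrite /chern_trace -mulrACA; congr (_ * _).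
by rewrite -exprD subnK.
Qed.

Let chern_trace0 : chern_trace E 0 = 12%:R.
Proof. by rewrite /chern_trace expr0 mul1r power_trace0. Qed.

Lemma ch_wedge_graded : graded (ch W) 66%:R (1440%:R * x)
  (960%:R * y + (72%:R * 144%:R) * x ^+ 2) (- ((280%:R * 288%:R) * z) + (180%:R * 192%:R) * (x * y)).
Proof.
have c1 := odd_chern_trace (isT : odd 1).
have c3 := odd_chern_trace (isT : odd 3).
have c5 := odd_chern_trace (isT : odd 5).
have W1 : chern_trace W 1 = 0.
  apply: (@form_mulnI _ _ 1); rewrite wedge_trace.
  by rewrite !big_ord_recr big_ord0 /= c1 !(mulr0, mul0r, mul0rn, addr0, subr0).
have W3 : chern_trace W 3 = 0.
  apply: (@form_mulnI _ _ 1); rewrite wedge_trace.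
  by rewrite !big_ord_recr big_ord0 /= c1 c3 !(mulr0, mul0r, mul0rn, addr0, subr0).
have W5 : chern_trace W 5 = 0.
  apply: (@form_mulnI _ _ 1); rewrite wedge_trace.
  by rewrite !big_ord_recr big_ord0 /= c1 c3 c5 !(mulr0, mul0r, mul0rn, addr0, subr0).
have [t2 t4 t6] := tangent_traces.
have W2 : chern_trace W 2 = 2%:R * (1440%:R * x).
  apply: (@form_mulnI _ _ 1); rewrite wedge_trace !big_ord_recr big_ord0 /= add0r.
  by rewrite c1 chern_trace0 t2; exact: wedge_numeral2.
have W4 : chern_trace W 4 = 24%:R * (960%:R * y + (72%:R * 144%:R) * x ^+ 2).
  apply: (@form_mulnI _ _ 1); rewrite wedge_trace !big_ord_recr big_ord0 /= add0r.
  by rewrite c1 c3 chern_trace0 t2 t4; exact: wedge_numeral4.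
have W6 : chern_trace W 6 = 720%:R * (- ((280%:R * 288%:R) * z) + (180%:R * 192%:R) * (x * y)).
  apply: (@form_mulnI _ _ 1); rewrite wedge_trace !big_ord_recr big_ord0 /= add0r.
  by rewrite c1 c3 c5 chern_trace0 t2 t4 t6; exact: wedge_numeral6.
have := ch_graded wedge_homog W1 W3 W5.
rewrite W2 W4 W6 !cst_natVK (_ : rk W = 66%N) //.
by rewrite /= card_draws card_ord.
Qed.

End Tangent.

Section Adjoint.
Variables (E : lbundle R 12).
Hypothesis E_homog : mx_homog 2 (curv E).
Hypotheses (T1 : power_trace E 1 = 0) (T3 : power_trace E 3 = 0) (T5 : power_trace E 5 = 0).
Hypothesis T4 : 100 * power_trace E 4 = power_trace E 2 ^+ 2.
Hypothesis T6 : 7200 * power_trace E 6 = power_trace E 2 ^+ 3.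

(** The scaling makes the Chern character of the adjoint bundle a polynomial
    in [pv] with integral coefficients. *)
Definition pv : form := cst 4320%:R^-1 * chern2 E.

Lemma chern2_pv : chern2 E = 4320%:R * pv.
Proof. by rewrite natVcstK. Qed.

Lemma pv_homog : homog 4 pv.
Proof. exact/homog_cstM/hcomp_homog. Qed.

(** Since the power traces of degree 4 and 6 are determined by the one of
    degree 2, the Chern character is a polynomial in the second Chern form. *)
Lemma ch_adjoint_graded : graded (ch E) (rk E)%:R (- (4320%:R * pv))
  ((144%:R * 216%:R) * pv ^+ 2) (- ((288%:R * 432%:R) * pv ^+ 3)).
Proof.
have c1 := chern_trace_eq0 T1; have c3 := chern_trace_eq0 T3.
have c5 := chern_trace_eq0 T5.
have c2 : chern_trace E 2 = 2%:R * (- (4320%:R * pv)).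
  by rewrite -chern2_pv mulrN (chern2E E_homog c1) opprK.
have c4 : chern_trace E 4 = 24%:R * ((144%:R * 216%:R) * pv ^+ 2).
  apply: (@form_mulnI _ _ 99).
  have -> : 100%:R * chern_trace E 4 = chern_trace E 2 ^+ 2.
    exact: (scale_relation _ 2 T4).
  by rewrite c2; exact: adjoint_numeral4.
have c6 : chern_trace E 6 = 720%:R * (- ((288%:R * 432%:R) * pv ^+ 3)).
  apply: (@form_mulnI _ _ 99); apply: (@form_mulnI _ _ 71).
  have h : 7200 * chern_trace E 6 = chern_trace E 2 ^+ 3.
    exact: (scale_relation _ 2 T6).
  by apply: adjoint_numeral6; apply: etrans h _; rewrite c2.
have := ch_graded E_homog c1 c3 c5.
by rewrite c2 c4 c6 !cst_natVK.
Qed.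

End Adjoint.
End TangentAndAdjoint.

(** * Symmetry of second derivatives *)

From mathcomp Require Import all_classical all_reals all_analysis.
Import numFieldNormedType.Exports.
Local Open Scope classical_set_scope.
Local Open Scope ring_scope.

Section Schwarz.
Variables (R : realType) (V : normedModType R).
Implicit Types (f : V -> R) (u v w x : V).

Lemma is_derive_line f u w (s : R) : derivable f (s *: u + w) u ->
  is_derive s 1 (fun t => f (t *: u + w)) ('D_u f (s *: u + w)).
Proof.
set g := (fun t => f (t *: u + w)).
have E : (fun h : R => h^-1 *: ((g \o shift s) (h *: 1) - g s))
       = (fun h : R => h^-1 *: ((f \o shift (s *: u + w)) (h *: u) - f (s *: u + w))).
  apply/funext => h /=; rewrite /g /=; congr (_ *: (f _ - _)).
  by rewrite [h *: 1]mulr1 scalerDl addrA.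
by move=> df; apply: DeriveDef; [rewrite /derivable E | rewrite /derive E].
Qed.

(** The mean value theorem, applied in the direction [u] to a difference in
    the direction [v], and then in the direction [v]. *)
Lemma second_difference f u v x (h : R) : 0 < h ->
  (forall s t, s \in `[0, h] -> t \in `[0, h] ->
     derivable f (s *: u + (t *: v + x)) u /\
     derivable ('D_u f) (t *: v + (s *: u + x)) v) ->
  exists s t, [/\ s \in `[0, h], t \in `[0, h] &
    f (h *: u + (h *: v + x)) - f (h *: u + x) - f (h *: v + x) + f x
    = 'D_v ('D_u f) (t *: v + (s *: u + x)) * h * h].
Proof.
move=> h0 hf; have hh : h \in `[0, h] by rewrite in_itv /= lexx ltW.
have zh : 0 \in `[0, h] by rewrite in_itv /= lexx ltW.
pose phi s := f (s *: u + (h *: v + x)) - f (s *: u + x).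
pose dphi s := 'D_u f (s *: u + (h *: v + x)) - 'D_u f (s *: u + x).
have dphiP s : s \in `[0, h] -> is_derive s 1 phi (dphi s).
  move=> sh; have [d1 _] := hf s h sh hh; have [d2 _] := hf s 0 sh zh.
  rewrite scale0r add0r in d2.
  exact: (is_deriveB (is_derive_line d1) (is_derive_line d2)).
have sub (c : R) : c \in `]0, h[ -> c \in `[0, h] by apply: subset_itv_oo_cc.
have [s sh Es] : exists2 s, s \in `]0, h[ & phi h - phi 0 = dphi s * (h - 0).
  apply: (@MVT _ phi dphi _ _ h0 (fun s sh => dphiP s (sub _ sh))).
  by apply: derivable_within_continuous => s sh; apply: (@ex_derive _ _ _ _ _ _ _ (dphiP s sh)).
pose psi t := 'D_u f (t *: v + (s *: u + x)).
have dpsiP t : t \in `[0, h] -> is_derive t 1 psi ('D_v ('D_u f) (t *: v + (s *: u + x))).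
  by move=> th; apply: is_derive_line; have [] := hf s t (sub _ sh) th.
have [t th Et] : exists2 t, t \in `]0, h[ &
    psi h - psi 0 = 'D_v ('D_u f) (t *: v + (s *: u + x)) * (h - 0).
  apply: (@MVT _ psi (fun t => 'D_v ('D_u f) (t *: v + (s *: u + x))) _ _ h0
    (fun t th => dpsiP t (sub _ th))).
  by apply: derivable_within_continuous => t th; apply: (@ex_derive _ _ _ _ _ _ _ (dpsiP t th)).
exists s, t; split; [exact: sub | exact: sub |].
have -> : f (h *: u + (h *: v + x)) - f (h *: u + x) - f (h *: v + x) + f x
   = phi h - phi 0.
  by rewrite /phi scale0r !add0r; ring.
rewrite Es subr0; congr (_ * _).
move: Et; rewrite subr0 => <-; rewrite /dphi /psi scale0r add0r.
by rewrite addrCA.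
Qed.

Let close_half (a b c e : R) : `|a - c| < e / 2 -> `|b - c| < e / 2 -> `|a - b| <= e.
Proof.
rewrite (distrC b) => ac cb; rewrite [e]splitr -(subrK c a) -addrA.
exact: le_trans (ler_normD _ _) (lerD (ltW ac) (ltW cb)).
Qed.

(** Schwarz's theorem: the second difference over a small parallelogram is a
    value of either mixed derivative at a nearby point. *)
Lemma derive_swap f u v x :
  (\forall y \near x, [/\ derivable f y u, derivable f y v,
     derivable ('D_u f) y v & derivable ('D_v f) y u]) ->
  {for x, continuous ('D_v ('D_u f))} -> {for x, continuous ('D_u ('D_v f))} ->
  'D_v ('D_u f) x = 'D_u ('D_v f) x.
Proof.
move=> hf cvu cuv; apply/eqP; rewrite -subr_eq0 -normr_le0.
apply/ler_addgt0Pl => e e0; rewrite addr0.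
have e2 : 0 < e / 2 by rewrite divr_gt0.
have n1 : \forall y \near x, `|'D_v ('D_u f) x - 'D_v ('D_u f) y| < e / 2.
  by move/cvgr_dist_lt: cvu; apply.
have n2 : \forall y \near x, `|'D_u ('D_v f) x - 'D_u ('D_v f) y| < e / 2.
  by move/cvgr_dist_lt: cuv; apply.
have /nbhs_ballP[d /= d0 hd] : \forall y \near x,
   [/\ derivable f y u, derivable f y v,
     derivable ('D_u f) y v & derivable ('D_v f) y u] /\
   (`|'D_v ('D_u f) x - 'D_v ('D_u f) y| < e / 2 /\
    `|'D_u ('D_v f) x - 'D_u ('D_v f) y| < e / 2).
  exact: filterI hf (filterI n1 n2).
(* The parallelogram with sides [h u] and [h v] lies in the ball of radius [d]. *)
pose k := `|u| + `|v| + 1; have k0 : 0 < k by rewrite /k ltr_wpDl.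
pose h := d / k; have h0 : 0 < h by rewrite divr_gt0.
have inball s t : s \in `[0, h] -> t \in `[0, h] -> ball x d (s *: u + (t *: v + x)).
  rewrite !in_itv /= => /andP[s0 sh] /andP[t0 th]; rewrite -ball_normE /= addrA.
  rewrite opprD addrCA subrr addr0 normrN (le_lt_trans (ler_normD _ _)) //.
  rewrite !normrZ !ger0_norm // (@le_lt_trans _ _ (h * (`|u| + `|v|))) //.
    by rewrite mulrDr lerD // ler_wpM2r.
  by rewrite /h mulrAC ltr_pdivrMr // ltr_pM2l // /k ltrDl.
have [s1 [t1 [s1h t1h E1]]] := @second_difference f u v x h h0 (fun s t sh th =>
  let: conj (And4 a _ b _) _ := hd _ (inball s t sh th) in
  conj a (eq_ind _ (fun z => derivable ('D_u f) z v) b _ (addrCA _ _ _))).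
have [s2 [t2 [s2h t2h E2]]] := @second_difference f v u x h h0 (fun s t sh th =>
  let: conj (And4 _ a _ b) _ := hd _ (inball t s th sh) in
  conj (eq_ind _ (fun z => derivable f z v) a _ (addrCA _ _ _)) b).
have [_ [l1 _]] := hd _ (inball s1 t1 s1h t1h).
have [_ [_ l2]] := hd _ (inball t2 s2 t2h s2h).
have E12 : f (h *: u + (h *: v + x)) - f (h *: u + x) - f (h *: v + x) + f x
    = f (h *: v + (h *: u + x)) - f (h *: v + x) - f (h *: u + x) + f x.
  by rewrite (addrCA (h *: u)); congr (_ + _); rewrite addrAC.
rewrite E12 E2 (addrCA (t1 *: v)) in E1.
have hn : h != 0 by rewrite gt_eqF.
move/(mulIf hn)/(mulIf hn): E1 => E1; rewrite -E1 in l1.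
exact: close_half l1 l2.
Qed.

End Schwarz.

(** * Curvatures of the Levi-Civita and of the gauge connection *)

Section MatrixDerivatives.
Variables (R : realType) (n : nat).
Implicit Types (mu nu : 'I_n) (x : 'rV[R]_n).

Definition mx_derivable p q (F : 'rV[R]_n -> 'M[R]_(p, q)) x mu :=
  forall i j, derivable (fun y => F y i j) x (delta_mx 0 mu).

Lemma pd_sum m (h : 'I_m -> 'rV[R]_n -> R) mu x :
  (forall k, derivable (h k) x (delta_mx 0 mu)) ->
  derivable (fun y => \sum_k h k y) x (delta_mx 0 mu) /\
  pd mu (fun y => \sum_k h k y) x = \sum_k pd mu (h k) x.
Proof.
move=> dh; rewrite /pd.
have -> : (fun y => \sum_k h k y) = \sum_k h k by rewrite fct_sumE.
by split; [exact: derivable_sum | rewrite derive_sum].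
Qed.

Lemma pdM (f g : 'rV[R]_n -> R) mu x :
  derivable f x (delta_mx 0 mu) -> derivable g x (delta_mx 0 mu) ->
  derivable (fun y => f y * g y) x (delta_mx 0 mu) /\
  pd mu (fun y => f y * g y) x = pd mu f x * g x + f x * pd mu g x.
Proof.
move=> df dg; split; first exact: (derivableM df dg).
by rewrite /pd (deriveM df dg) addrC [X in X + _]mulrC.
Qed.

Lemma pd_mxM p q r (A : 'rV[R]_n -> 'M[R]_(p, q)) (B : 'rV[R]_n -> 'M[R]_(q, r)) mu x :
  mx_derivable A x mu -> mx_derivable B x mu ->
  mx_derivable (fun y => A y *m B y) x mu /\
  pd_mx mu (fun y => A y *m B y) x = pd_mx mu A x *m B x + A x *m pd_mx mu B x.
Proof.
move=> dA dB.
have h i j : derivable (fun y => (A y *m B y) i j) x (delta_mx 0 mu) /\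
    pd mu (fun y => (A y *m B y) i j) x
    = \sum_k (pd mu (fun y => A y i k) x * B x k j + A x i k * pd mu (fun y => B y k j) x).
  have -> : (fun y => (A y *m B y) i j) = (fun y => \sum_k A y i k * B y k j).
    by apply/funext => y; rewrite mxE.
  have [d e] := @pd_sum _ (fun k y => A y i k * B y k j) mu x
    (fun k => (pdM (dA i k) (dB k j)).1).
  by split=> //; rewrite e; apply: eq_bigr => k _; rewrite (pdM (dA i k) (dB k j)).2.
split=> [i j|]; first exact: (h i j).1.
apply/matrixP => i j; rewrite mxE (h i j).2 big_split !mxE.
by congr (_ + _); apply: eq_bigr => k _; rewrite mxE.
Qed.

Lemma pd_mxD p q (A B : 'rV[R]_n -> 'M[R]_(p, q)) mu x :
  mx_derivable A x mu -> mx_derivable B x mu ->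
  pd_mx mu (fun y => A y + B y) x = pd_mx mu A x + pd_mx mu B x.
Proof.
move=> dA dB; apply/matrixP => i j; rewrite !mxE /pd.
have -> : (fun y => (A y + B y) i j) = (fun y => A y i j) + (fun y => B y i j).
  by apply/funext => y; rewrite mxE.
by rewrite deriveD.
Qed.

Lemma pd_mx_tr p q (A : 'rV[R]_n -> 'M[R]_(p, q)) mu x :
  pd_mx mu (fun y => (A y)^T) x = (pd_mx mu A x)^T.
Proof.
apply/matrixP => i j; rewrite !mxE; congr (pd mu _ x).
by apply/funext => y; rewrite mxE.
Qed.

Lemma mx_derivable_tr p q (A : 'rV[R]_n -> 'M[R]_(p, q)) mu x :
  mx_derivable A x mu -> mx_derivable (fun y => (A y)^T) x mu.
Proof.
move=> dA i j; rewrite (_ : (fun y => _) = (fun y => A y j i)) //.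
by apply/funext => y; rewrite mxE.
Qed.

Lemma pd_mxvec p q (F : 'rV[R]_n -> 'M[R]_(p, q)) mu x k : mx_derivable F x mu ->
  derivable (fun y => mxvec (F y) 0 k) x (delta_mx 0 mu) /\
  pd mu (fun y => mxvec (F y) 0 k) x = mxvec (pd_mx mu F x) 0 k.
Proof.
move=> dF; case/mxvec_indexP: k => i j.
rewrite (_ : (fun y => _) = (fun y => F y i j)); last first.
  by apply/funext => y; rewrite mxvecE.
by split; [exact: dF | rewrite mxvecE mxE].
Qed.

Lemma pd_swap (U : set 'rV[R]_n) (f : 'rV[R]_n -> R) mu nu x :
  open U -> smooth_on U f -> U x -> pd nu (pd mu f) x = pd mu (pd nu f) x.
Proof.
move=> oU sf Ux; have [_ sf2] := sf 2%N.
apply: derive_swap.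
- near=> y; have Uy : U y by near: y; exact: open_nbhs_nbhs.
  have [d1 [_ s1]] := sf2 mu; have [d2 [_ s2]] := sf2 nu.
  split; [exact: d1 | exact: d2 | exact: (s1 nu).1 | exact: (s2 mu).1].
- by have [_ [_ s1]] := sf2 mu; have [_ [+ _]] := s1 nu; apply.
- by have [_ [_ s1]] := sf2 nu; have [_ [+ _]] := s1 mu; apply.
Unshelve. all: by end_near. Qed.

Lemma smooth_derivable (U : set 'rV[R]_n) (f : 'rV[R]_n -> R) mu x :
  smooth_on U f -> U x -> derivable f x (delta_mx 0 mu).
Proof. by move=> sf Ux; have [_ /(_ mu)[+ _]] := sf 1%N; apply. Qed.

Lemma pd_near (U : set 'rV[R]_n) (f g : 'rV[R]_n -> R) mu x :
  open U -> U x -> (forall y, U y -> f y = g y) -> pd mu f x = pd mu g x.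
Proof.
move=> oU Ux fg; apply: near_eq_derive.
by near=> y; apply: fg; near: y; exact: open_nbhs_nbhs.
Unshelve. all: by end_near. Qed.

Lemma skew_bracket (G A B P Q : 'M[R]_n) :
  P^T *m G + B^T *m (A^T *m G + G *m A) + ((A^T *m G + G *m A) *m B + G *m P) =
  Q^T *m G + A^T *m (B^T *m G + G *m B) + ((B^T *m G + G *m B) *m A + G *m Q) ->
  (P - Q + A *m B - B *m A)^T *m G + G *m (P - Q + A *m B - B *m A) = 0.
Proof.
move=> swap; apply/matrixP => i j; move/matrixP/(_ i j): swap.
have De (X Y : 'M[R]_n) k l : (X + Y) k l = X k l + Y k l by rewrite mxE.
have Ne (X : 'M[R]_n) k l : (- X) k l = - X k l by rewrite mxE.
have Dt (X Y : 'M[R]_n) : (X + Y)^T = X^T + Y^T by apply/matrixP => k l; rewrite !mxE.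
have Nt (X : 'M[R]_n) : (- X)^T = - X^T by apply/matrixP => k l; rewrite !mxE.
rewrite !Dt !Nt !trmx_mul !(mulmxDl, mulmxDr, mulNmx, mulmxN) -!mulmxA !De !Ne.
by move=> h; rewrite [RHS]mxE; lra.
Qed.

(** A metric connection has curvature antisymmetric with respect to the
    metric: differentiate [d g = om^T g + g om] once more and compare the two
    mixed second derivatives of [g]. *)
Lemma metric_curvature (U : set 'rV[R]_n) (g : 'rV[R]_n -> 'M[R]_n)
    (om : 'I_n -> 'rV[R]_n -> 'M[R]_n) :
  open U -> (forall i j, smooth_on U (fun x => g x i j)) ->
  (forall mu i j, smooth_on U (fun x => om mu x i j)) ->
  (forall mu x, U x -> pd_mx mu g x = (om mu x)^T *m g x + g x *m om mu x) ->
  forall mu nu x, U x ->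
    (curvature om x mu nu)^T *m g x + g x *m curvature om x mu nu = 0.
Proof.
move=> oU sg som hg mu nu x Ux.
have dg k : mx_derivable g x k.
  by move=> i j; apply: smooth_derivable (sg i j) Ux.
have dom k l : mx_derivable (om k) x l.
  by move=> i j; apply: smooth_derivable (som k i j) Ux.
have second k l : pd_mx k (fun y => pd_mx l g y) x =
    (pd_mx k (om l) x)^T *m g x + (om l x)^T *m ((om k x)^T *m g x + g x *m om k x)
    + (((om k x)^T *m g x + g x *m om k x) *m om l x + g x *m pd_mx k (om l) x).
  have [d1 e1] := pd_mxM (mx_derivable_tr (dom l k)) (dg k).
  have [d2 e2] := pd_mxM (dg k) (dom l k).
  rewrite -!hg // -pd_mx_tr -e1 -e2 -(pd_mxD d1 d2).
  apply/matrixP => i j; rewrite !mxE; apply: (pd_near _ oU Ux) => y Uy.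
  by rewrite hg.
have swap : pd_mx mu (fun y => pd_mx nu g y) x = pd_mx nu (fun y => pd_mx mu g y) x.
  apply/matrixP => i j; rewrite [LHS]mxE [RHS]mxE.
  have E k : (fun y => pd_mx k g y i j) = pd k (fun y => g y i j).
    by apply/funext => y; rewrite mxE.
  rewrite (E mu) (E nu); exact: (pd_swap nu mu oU (sg i j) Ux).
move: swap; rewrite !second /curvature.
move: (g x) (om mu x) (om nu x) (pd_mx mu _ x) (pd_mx nu _ x) => G A B P Q swap.
exact: skew_bracket.
Qed.

End MatrixDerivatives.

Section AdjointCurvature.
Variables (R : realType) (n : nat) (e8 : compact_e8 R).
Local Notation br := (e8_br e8).

(** The image of [ad] is a linear subspace, given by linear equations with
    constant coefficients; these are preserved by differentiation. *)
Lemma ad_derivative (a : 'rV[R]_n -> 'cV[R]_248) mu x :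
  mx_derivable (fun y => ad br (a y)) x mu ->
  exists F, pd_mx mu (fun y => ad br (a y)) x = ad br F.
Proof.
move=> da; pose Mad := \matrix_k mxvec (ad br (delta_mx k 0)).
have adE X : mxvec (ad br X) = X^T *m Mad.
  apply/rowP => p; rewrite (ad_sum e8 X) linear_sum mxE summxE.
  by apply: eq_bigr => k _; rewrite linearZ !mxE.
have dm p := (pd_mxvec p da).1.
have : (mxvec (pd_mx mu (fun y => ad br (a y)) x) <= Mad)%MS.
  rewrite submxE; apply/eqP/rowP => q; rewrite !mxE.
  pose c p := cokermx Mad p q.
  have dc p : derivable (fun y : 'rV[R]_n => c p) x (delta_mx 0 mu).
    exact: derivable_cst.
  have [_] := @pd_sum _ _ _ (fun p y => mxvec (ad br (a y)) 0 p * c p) mu x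
    (fun p => (pdM (dm p) (dc p)).1).
  rewrite (_ : (fun y => _) = cst 0); last first.
    apply/funext => y /=; have : (mxvec (ad br (a y)) <= Mad)%MS.
      by rewrite adE submxMl.
    by rewrite submxE => /eqP/rowP/(_ q); rewrite !mxE.
  rewrite {1}/pd derive_cst => E; rewrite [RHS]E; apply: eq_bigr => p _.
  rewrite (pdM (dm p) (dc p)).2 /pd derive_cst mulr0 addr0; congr (_ * _).
  exact/esym/(pd_mxvec p da).2.
case/submxP => D hD; exists D^T; apply: (can_inj mxvecK).
by rewrite adE trmxK.
Qed.

(** The curvature takes values in the Lie algebra: so do the derivatives of
    the connection form, and the commutators by the Jacobi identity. *)
Lemma ad_curvature (a : 'I_n -> 'rV[R]_n -> 'cV[R]_248) x :
  (forall mu nu, mx_derivable (fun y => ad br (a mu y)) x nu) ->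
  exists F : 'I_n -> 'I_n -> 'cV[R]_248, forall mu nu,
    curvature (fun mu y => ad br (a mu y)) x mu nu = ad br (F mu nu).
Proof.
move=> da.
have /choice[F1 hF1] : forall p : 'I_n * 'I_n, exists F,
    curvature (fun mu y => ad br (a mu y)) x p.1 p.2 = ad br F.
  case=> mu nu /=; have [F hF] := ad_derivative (da nu mu).
  have [G hG] := ad_derivative (da mu nu).
  exists (F - G + br (a mu x) (a nu x)).
  rewrite /curvature hF hG -addrA -ad_br !(ad_sum e8) -sumrB -big_split /=.
  by apply: eq_bigr => k _; rewrite !mxE scalerDl scalerBl.
by exists (fun mu nu => F1 (mu, nu)) => mu nu; rewrite -(hF1 (mu, nu)).
Qed.

End AdjointCurvature.

(** * The identity in degree twelve *)

Section Quadruples.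
Variable K : comNzRingType.
Local Notation quad := (K * K * K * K)%type.
Implicit Types a b : quad.

(** Truncated power series in one variable, for the components in degrees 0,
    4, 8, 12. *)
Definition qadd a b : quad :=
  let: (a0, a1, a2, a3) := a in let: (b0, b1, b2, b3) := b in
  (a0 + b0, a1 + b1, a2 + b2, a3 + b3).

Definition qopp a : quad := let: (a0, a1, a2, a3) := a in (- a0, - a1, - a2, - a3).

Definition qmul a b : quad :=
  let: (a0, a1, a2, a3) := a in let: (b0, b1, b2, b3) := b in
  (a0 * b0, a0 * b1 + a1 * b0, a0 * b2 + a1 * b1 + a2 * b0,
   a0 * b3 + a1 * b2 + a2 * b1 + a3 * b0).

Definition qnat m : quad := (m%:R, 0, 0, 0).

Variables x y z v w : K.

(** Expansion of [exp (6 u)]. *)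
Definition q_exp (u : K) : quad := (1, 6%:R * u, 18%:R * u ^+ 2, 36%:R * u ^+ 3).
Definition q_hatA : quad := (1, - (6 * x), 18 * x ^+ 2 + y, - (36 * x ^+ 3) - 6 * x * y - 8 * z).
Definition q_spinor : quad := (64 * 1, 64 * (18 * x), 64 * (162 * x ^+ 2 - 15 * y),
  64 * (972 * x ^+ 3 - 270 * x * y + 504 * z)).
Definition q_tangent : quad := (12%:R, 144%:R * x, 240%:R * y, 4032%:R * z).
Definition q_wedge : quad := (66%:R, 1440%:R * x, 960%:R * y + (72%:R * 144%:R) * x ^+ 2,
  - ((280%:R * 288%:R) * z) + (180%:R * 192%:R) * (x * y)).
Definition q_adjoint (u : K) : quad := (248%:R, - (4320%:R * u),
  (144%:R * 216%:R) * u ^+ 2, - ((288%:R * 432%:R) * u ^+ 3)).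
Definition q_reduced := qadd q_tangent (qopp (qnat 12)).

Definition q_first := qadd (qadd (qadd (qnat 8) (qmul (qnat 2) q_reduced))
  (q_adjoint v)) (q_adjoint w).

Definition q_second := qadd (qadd (qadd (qadd (qnat 1024) (qmul (qnat 128) q_reduced))
   (qmul (qnat 128) (q_adjoint v))) (qmul (qnat 128) (q_adjoint w)))
  (qmul (qnat 128) (qadd (qadd q_wedge (qopp (qmul (qnat 12) q_tangent)))
     (qadd (qmul (qnat 12) (qnat 12)) (qopp (qnat 66))))).

(** The polynomial identity behind the theorem. Its source is modular: the
    degree 12 component of [exp (E_2 c / 720)] times the A-hat form times
    twisting Chern characters is a modular form of weight 14 over the full
    modular group, hence a multiple of [E_4^2 E_6 = 1 - 24 q + ...], and the
    identity compares its coefficients of [1] and [q]. In degree 12 this is a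
    finite identity between polynomials in the five generators, which can be
    expanded. *)
Lemma weight14_identity (e := qmul (q_exp (v + w)) q_hatA) :
  (qmul (qmul e (0, 144%:R * (v + w), 0, 0)) (qadd q_spinor (qnat 128))).2 =
  (qmul e (qadd (qmul q_spinor q_first) q_second)).2.
Proof.
rewrite /e /qmul /q_exp /q_hatA /q_spinor /q_first /q_second /q_reduced /q_tangent
  /q_wedge /q_adjoint /qmul /qadd /qnat /qopp /=.
ring.
Qed.

Lemma exp_numeral2 (u : K) : (6%:R * u) ^+ 2 = 2%:R * (18%:R * u ^+ 2).
Proof. by ring. Qed.

Lemma exp_numeral3 (u : K) : (6%:R * u) ^+ 3 = 6%:R * (36%:R * u ^+ 3).
Proof. by ring. Qed.

End Quadruples.

Section GradedQuadruples.
Variable R : realType.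
Local Notation form := (evenform R[i] 12).
Local Notation cst := (cst_form 12).

Definition qgraded (u : form) (a : form * form * form * form) :=
  let: (a0, a1, a2, a3) := a in graded u a0 a1 a2 a3.

Lemma qgradedD u v a b : qgraded u a -> qgraded v b -> qgraded (u + v) (qadd a b).
Proof. by case: a b => [[[a0 a1] a2] a3] [[[b0 b1] b2] b3]; apply: gradedD. Qed.

Lemma qgradedM u v a b : qgraded u a -> qgraded v b -> qgraded (u * v) (qmul a b).
Proof. by case: a b => [[[a0 a1] a2] a3] [[[b0 b1] b2] b3]; apply: gradedM. Qed.

Lemma qgradedN u a : qgraded u a -> qgraded (- u) (qopp a).
Proof.
case: a => [[[a0 a1] a2] a3] [-> h0 h1 h2 h3].
by split; [rewrite !opprD | exact: homogN..].
Qed.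

Lemma qgraded_nat m : qgraded m%:R (qnat _ m). Proof. exact: graded_nat. Qed.

Lemma qgraded_top u a : qgraded u a -> hcomp 12 u = a.2.
Proof. by case: a => [[[a0 a1] a2] a3]; apply: graded_top. Qed.

Lemma form_exp_graded (u : form) : homog 4 u ->
  qgraded (form_exp (6%:R * u)) (q_exp u).
Proof.
move=> hu; pose f k := cst (k`!)%:R^-1 * (6%:R * u) ^+ k.
have h6 : homog 4 (6%:R * u) by apply: homog_natM.
have f4 k : (3 < k)%N -> f k = 0.
  move=> k3; rewrite /f (@big_homog0 _ (k * 4) ((6%:R * u) ^+ k)) ?mulr0 //.
    by apply: (@leq_trans (4 * 4)) => //; rewrite leq_mul2r k3 orbT.
  exact: homogX.
have E : form_exp (6%:R * u) = f 0%N + f 1%N + f 2%N + f 3%N.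
  rewrite /form_exp -/(f _) -(big_mkord xpredT f) (big_cat_nat (n := 4)) //=.
  rewrite [X in _ + X]big_nat_cond [X in _ + X]big1 => [|k /andP[/andP[k4 _] _]].
    by rewrite addr0 big_mkord !big_ord_recr big_ord0 /= add0r.
  exact: f4.
have f0 : f 0%N = 1 by rewrite /f fact0 invr1 rmorph1 mul1r.
have f1 : f 1%N = 6%:R * u by rewrite /f invr1 rmorph1 mul1r expr1.
have f2 : f 2%N = 18%:R * u ^+ 2.
  by apply: (@form_mulnI _ _ 1); rewrite natVcstK; apply: exp_numeral2.
have f3 : f 3%N = 36%:R * u ^+ 3.
  by apply: (@form_mulnI _ _ 5); rewrite natVcstK; apply: exp_numeral3.
rewrite E f0 f1 f2 f3; split=> //; first exact: homog_nat 1%N.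
  by apply: homog_natM; exact: (homogX (k := 2) hu).
by apply: homog_natM; exact: (homogX (k := 3) hu).
Qed.

Lemma vch_comb2 (m p : nat) (U V1 V2 : virt R 12) :
  vch (m%:V + p * U + V1 + V2)%virt = m%:R + p%:R * vch U + vch V1 + vch V2.
Proof. by rewrite !vchD vch_triv vch_muln. Qed.

Lemma vch_comb4 (m p : nat) (U1 U2 U3 U4 : virt R 12) :
  vch (m%:V + p * U1 + p * U2 + p * U3 + p * U4)%virt
  = m%:R + p%:R * vch U1 + p%:R * vch U2 + p%:R * vch U3 + p%:R * vch U4.
Proof. by rewrite !vchD vch_triv !vch_muln. Qed.

End GradedQuadruples.

Section Curvatures.
Variables (R : realType) (Z : topologicalType) (M : oriented_atlas R 12 Z).
Local Notation form := (evenform R[i] 12).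
Local Notation cst := (cst_form 12).

Let image_mem (a : chart M) (U : set Z) z : cdom a z -> U z ->
  (cmap a @` (cdom a `&` U)) (cmap a z).
Proof. by move=> az Uz; exists z. Qed.

(** The curvature of the Levi-Civita connection is antisymmetric with respect
    to the metric, which is invertible as it is positive definite. *)
Lemma tangent_traces_odd (g : riemannian_metric M) (D : tangent_connection M)
    (a : chart M) z : levi_civita g D -> cdom a z ->
  forall k, odd k -> \tr (curv (TCZ D a (cmap a z)) ^+ k) = 0.
Proof.
move=> LC za k ok; set x := cmap a z; set om := christoffel D a a.
have [om_smooth _ _] := christoffelP D.
have Om_skew mu nu : (curvature om x mu nu)^T *m gmx g a x
    + gmx g a x *m curvature om x mu nu = 0.
  apply: (@metric_curvature _ _ (cmap a @` cdom a) (gmx g a)).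
  - exact: cimg_open.
  - exact: gmx_smooth.
  - move=> l i j; have := om_smooth a a l i j; rewrite setIid; exact.
  - by move=> l _ [z' az' <-]; have [_] := LC a z' l l az'.
  - by exists z.
pose G : 'M[form]_12 := map_mx (fun r : R => cst r%:C%C) (gmx g a x).
apply: (skew_trace (G := G)) => //.
  have -> : G = map_mx cst (map_mx (real_complex R) (gmx g a x)).
    by apply/matrixP => i j; rewrite !mxE.
  rewrite unitmxE !det_map_mx rmorph_unit // unitfE fmorph_eq0.
  apply/det0P => -[v v0 vg].
  have v0' : v^T != 0 by apply: contra v0 => /eqP vt; rewrite -[v]trmxK vt trmx0.
  by have := gmx_pos g za v0'; rewrite trmxK -/x vg mul0mx mxE ltxx.
apply/matrixP => i j; rewrite !mxE.
pose Om := curvature om x.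
have Xe p q : curv (TCZ D a x) p q = form2 (fun mu nu => (Om mu nu p q)%:C%C).
  by rewrite mxE.
transitivity (form2 (fun mu nu => \sum_l (gmx g a x i l)%:C%C * (Om mu nu l j)%:C%C) : form).
  by rewrite form2_sum; apply: eq_bigr => l _; rewrite mxE Xe.
transitivity (- form2 (fun mu nu => \sum_l (gmx g a x l j)%:C%C * (Om mu nu l i)%:C%C) : form);
    last first.
  rewrite form2_sum; congr (- _); apply: eq_bigr => l _.
  by rewrite [G l j]mxE [_^T i l]mxE Xe mulrC.
rewrite -form2N; apply: eq_form2 => mu nu.
have /matrixP/(_ i j) := Om_skew mu nu; rewrite !mxE => /eqP.
rewrite addrC addr_eq0 => /eqP h.
have -> : \sum_l (gmx g a x i l)%:C%C * (Om mu nu l j)%:C%C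
    = (\sum_l gmx g a x i l * Om mu nu l j)%:C%C.
  by rewrite rmorph_sum; apply: eq_bigr => l _; rewrite rmorphM.
rewrite h rmorphN rmorph_sum /=; congr (- _); apply: eq_bigr => l _.
by rewrite !mxE rmorphM mulrC.
Qed.

Variable e8 : compact_e8 R.

(** The curvature matrix is the adjoint representation of an E8-valued
    two-form. *)
Lemma adjoint_traces (P : principal_e8_bundle M e8) (A : e8_connection P)
    (k : triv P) (a : chart M) z : cdom a z -> tdom k z ->
  let E := adjoint_bundle A k a (cmap a z) in
  [/\ power_trace E 1 = 0, power_trace E 3 = 0, power_trace E 5 = 0,
      100 * power_trace E 4 = power_trace E 2 ^+ 2 &
      7200 * power_trace E 6 = power_trace E 2 ^+ 3].
Proof.
move=> za zk E; set x := cmap a z.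
have [om_smooth _ _] := gaugeP A.
have da mu nu : mx_derivable (fun y => ad (e8_br e8) (gauge A k a mu y)) x nu.
  by move=> i j; exact: (smooth_derivable (om_smooth k a mu i j) (image_mem za zk)).
have [F hF] := ad_curvature da.
pose X : 'cV[form]_248 := \col_l form2 (fun mu nu => (F mu nu l 0)%:C%C).
have X2 l : homog 2 (X l 0) by rewrite mxE; apply: form2_homog.
have := e8_traces e8 X2.
have -> : adK (fun k => map_mx (real_complex R) (ad (e8_br e8) (delta_mx k 0))) X = curv E.
  apply/matrixP => i j; rewrite adKE [RHS]mxE.
  rewrite (@eq_form2 _ _ _ (fun mu nu => \sum_l (ad (e8_br e8) (delta_mx l 0) i j)%:C%C
      * (F mu nu l 0)%:C%C)); last first.
    move=> mu nu; rewrite hF ad_sum summxE rmorph_sum; apply: eq_bigr => l _.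
    by rewrite mxE rmorphM mulrC.
  by rewrite form2_sum; apply: eq_bigr => l _; rewrite [X l 0]mxE mxE mulrC.
exact: id.
Qed.

End Curvatures.

Theorem theorem3p5 (R : realType) (Z : topologicalType)
    (Z_compact : compact [set: Z]) (Z_hausdorff : hausdorff_space Z)
    (M : oriented_atlas R 12 Z)
    (g : riemannian_metric M) (D : tangent_connection M)
    (D_LC : levi_civita g D)
    (e8 : compact_e8 R)
    (P : 'I_2 -> principal_e8_bundle M e8)
    (A : forall l : 'I_2, e8_connection (P l))
    (i j : 'I_2)
    (z : Z) (a : chart M) (k : forall l : 'I_2, triv (P l))
    (za : cdom a z) (zk : forall l : 'I_2, tdom (k l) z) :
  let x := cmap a z in
  let T := TCZ D a x in
  let W (l : 'I_2) := adjoint_bundle (A l) (k l) a x in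
  let c2 := chern2 (W i) + chern2 (W j) in
  hcomp 12
    (form_exp (cst_form 12 (1 / 720) * c2) * hat_A T
     * (cst_form 12 (1 / 30) * c2) * (ch_spinor T + 128)) =
  hcomp 12
    (form_exp (cst_form 12 (1 / 720) * c2) * hat_A T
     * (ch_spinor T * vch (8%:V + 2 * vreduced T + W i + W j)%virt
        + vch (1024%:V + 128 * vreduced T + 128 * W i + 128 * W j
               + 128 * vwedge 2 (vreduced T))%virt)).
Proof.
move=> x T W c2.
pose X := curv T.
have X_homog : mx_homog 2 X by move=> p q; rewrite mxE; apply: form2_homog.
have X_odd := tangent_traces_odd D_LC za.
have W_homog l : mx_homog 2 (curv (W l)).
  by move=> p q; rewrite mxE; apply: form2_homog.
have hW l : qgraded (ch (W l)) (q_adjoint (pv (W l))).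
  have [t1 t3 t5 t4 t6] := adjoint_traces (A l) za (zk l).
  exact: (ch_adjoint_graded (W_homog l) t1 t3 t5 t4 t6).
pose v := pv (W i); pose w := pv (W j).
have v_homog : homog 4 (v + w) by apply: homogD; apply: pv_homog.
have c2E : c2 = 4320%:R * (v + w) by rewrite /c2 !chern2_pv mulrDr.
have e_graded : qgraded (form_exp (cst_form 12 (1 / 720) * c2)) (q_exp (v + w)).
  rewrite c2E (cst_ratio _ (_ : 1 / 720 * 4320%:R = 6%:R)); first exact: form_exp_graded.
  by field.
have c_graded : qgraded (cst_form 12 (1 / 30) * c2) (0, 144%:R * (v + w), 0, 0).
  rewrite c2E (cst_ratio _ (_ : 1 / 30 * 4320%:R = 144%:R)); last by field.
  by apply: graded_homog4; apply: homog_natM.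
have A_graded : qgraded (hat_A T) (q_hatA (px X) (py X) (pz X)).
  exact: hat_A_graded.
have S_graded : qgraded (ch_spinor T) (q_spinor (px X) (py X) (pz X)).
  exact: ch_spinor_graded.
have T_graded : qgraded (ch T) (q_tangent (px X) (py X) (pz X)).
  exact: ch_tangent_graded.
have L_graded : qgraded (ch (bwedge 2 (bsum T (btriv R 12 0)))) (q_wedge (px X) (py X) (pz X)).
  exact: ch_wedge_graded.
have red_graded := qgradedD T_graded (qgradedN (qgraded_nat R 12)).
have first_graded : qgraded (vch (8%:V + 2 * vreduced T + W i + W j)%virt)
    (q_first (px X) (py X) (pz X) v w).
  rewrite vch_comb2 (vch_reduced T) !vch_of.
  do 2!(apply: qgradedD => //).
  by apply: qgradedD; [exact: qgraded_nat | apply: qgradedM => //; exact: qgraded_nat].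
have second_graded : qgraded (vch (1024%:V + 128 * vreduced T + 128 * W i + 128 * W j
               + 128 * vwedge 2 (vreduced T))%virt)
    (q_second (px X) (py X) (pz X) v w).
  rewrite vch_comb4 vch_wedge2_reduced (vch_reduced T) !vch_of.
  have h128 := qgraded_nat R 128.
  have h12 := qgraded_nat R 12.
  apply: qgradedD; last first.
    apply: (qgradedM h128); apply: qgradedD; last first.
      exact: (qgradedD (qgradedM h12 h12) (qgradedN (qgraded_nat R 66))).
    exact: (qgradedD L_graded (qgradedN (qgradedM h12 T_graded))).
  apply: qgradedD; last exact: (qgradedM h128 (hW j)).
  apply: qgradedD; last exact: (qgradedM h128 (hW i)).
  exact: (qgradedD (qgraded_nat R 1024) (qgradedM h128 red_graded)).
have eA_graded := qgradedM e_graded A_graded.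
rewrite (qgraded_top (qgradedM (qgradedM eA_graded c_graded)
  (qgradedD S_graded (qgraded_nat R 128)))).
rewrite (qgraded_top (qgradedM eA_graded
  (qgradedD (qgradedM S_graded first_graded) second_graded))).
exact: weight14_identity.
Qed.
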